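(* Let $(\mathcal{A},\mathcal{E})$ be a weakly idempotent complete exact category, let $(\mathcal{C},\mathcal{W},\mathcal{F})$ be a Hovey triple in $(\mathcal{A},\mathcal{E})$, and let $\mathcal{M}$ be the exact model structure on $\mathcal{A}$ induced by $(\mathcal{C},\mathcal{W},\mathcal{F})$. Put $\mathcal{X}=\mathcal{C}\cap\mathcal{W}\cap\mathcal{F}$. Then the homotopy category $\mathrm{Ho}(\mathcal{M})$ is equivalent to the subfactor category $(\mathcal{C}\cap\mathcal{F})/\mathcal{X}$ as pre-triangulated categories.
   Context: **Conventions.** Subcategories of additive categories are full and closed under isomorphisms; functors between additive categories are additive. For additive $\mathcal{X}\subseteq\mathcal{C}$, the stable category $\mathcal{C}/\mathcal{X}$ has the objects of $\mathcal{C}$ and $\mathrm{Hom}_{\mathcal{C}/\mathcal{X}}(A,B)=\mathrm{Hom}_{\mathcal{C}}(A,B)/\mathcal{X}(A,B)$, where $\mathcal{X}(A,B)$ consists of the morphisms factoring through an object of $\mathcal{X}$; $\underline f$ is the class of $f$. **Hovey triples and exact model structures.** Members of $\mathcal{E}$ are called conflations $A\xrightarrow{i}B\xrightarrow{d}C$; $i$ is an inflation, $d$ a deflation. An exact category is weakly idempotent complete if every split monomorphism is an inflation. A cotorsion pair is a pair $(\mathcal{C},\mathcal{F})$ of classes of objects with $\mathcal{C}=\{C\mid\mathrm{Ext}^1_{\mathcal{A}}(C,\mathcal{F})=0\}$, $\mathcal{F}=\{F\mid\mathrm{Ext}^1_{\mathcal{A}}(\mathcal{C},F)=0\}$; it is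 complete if for each $A$ there are conflations $F\to C\to A$ and $A\to F'\to C'$ with $C,C'\in\mathcal{C}$, $F,F'\in\mathcal{F}$. A Hovey triple is a triple $(\mathcal{C},\mathcal{W},\mathcal{F})$ of classes of objects with $\mathcal{W}$ thick (closed under direct summands and satisfying two-out-of-three on conflations) and $(\mathcal{C},\mathcal{W}\cap\mathcal{F})$, $(\mathcal{C}\cap\mathcal{W},\mathcal{F})$ complete cotorsion pairs. By a theorem of Hovey it induces a model structure $\mathcal{M}$ on $\mathcal{A}$: cofibrations are the inflations with cokernel in $\mathcal{C}$, fibrations are the deflations with kernel in $\mathcal{F}$, weak equivalences are the composites $p\circ i$ with $i$ an inflation with cokernel in $\mathcal{C}\cap\mathcal{W}$ and $p$ a deflation with kernel in $\mathcal{W}\cap\mathcal{F}$. $\mathrm{Ho}(\mathcal{M})$ is the localization of $\mathcal{A}$ at the weak equivalences. **Right, left and pre-triangulated categories.** Given an endofunctor $\Psi$, a right $\Psi$-sequence is $A\to B\to C\to\Psi(A)$; morphisms are commutative ladders $(\alpha,\beta,\gamma,\Psi(\alpha))$. $(\mathcal{T},\Psi,\Delta)$, with $\mathcal{T}$ additive, $\Psi$ an additive endofunctor and $\Delta$ a class of right $\Psi$-sequences (right triangles) closed under isomorphisms, is right triangulated if: (RT1) every $f:A\to B$ occurs in some $A\xrightarrow{f}B\to C\to\Psi(A)$ in $\Delta$, and $0\to A\xrightarrow{1}A\to0$ is in $\Delta$; (RT2) if $A\xrightarrow{f}B\xrightarrow{g}C\xrightarrow{h}\Psi(A)$ is in $\Delta$,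 so is $B\xrightarrow{g}C\xrightarrow{h}\Psi(A)\xrightarrow{-\Psi(f)}\Psi(B)$; (RT3) given two right triangles with first maps $f,f'$ and $\alpha,\beta$ with $\beta f=f'\alpha$, there is $\gamma$ making $(\alpha,\beta,\gamma,\Psi(\alpha))$ a morphism; (RT4) for right triangles $A\xrightarrow{f}B\xrightarrow{l}C'\xrightarrow{m}\Psi(A)$, $B\xrightarrow{g}C\xrightarrow{h}A'\xrightarrow{j}\Psi(B)$, $A\xrightarrow{gf}C\xrightarrow{u}B'\xrightarrow{v}\Psi(A)$ there are $r:C'\to B'$, $s:B'\to A'$ with $rl=ug$, $vr=m$, $su=h$, $js=\Psi(f)v$ and $C'\xrightarrow{r}B'\xrightarrow{s}A'\xrightarrow{\Psi(l)j}\Psi(C')$ in $\Delta$. $(\mathcal{T},\Phi,\nabla)$, with $\nabla$ a class of left $\Phi$-sequences $\Phi(C)\to A\to B\to C$, is left triangulated if the opposite data are right triangulated. A pre-triangulated category $(\mathcal{T},\Psi,\Phi,\Delta,\nabla)$ consists of a right triangulated structure $(\Psi,\Delta)$ and a left triangulated structure $(\Phi,\nabla)$ on $\mathcal{T}$ such that: (a) $\Psi$ is left adjoint to $\Phi$, with unit $\eta$ and counit $\varepsilon$; and for every $A\xrightarrow{f}B\xrightarrow{g}C\xrightarrow{h}\Psi(A)$ in $\Delta$ and $\Phi(C')\xrightarrow{f'}A'\xrightarrow{g'}B'\xrightarrow{h'}C'$ in $\nabla$: (b) if $\alpha:A\to\Phi(C')$, $\beta:B\to A'$ satisfy $\beta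 f=f'\alpha$, there is $\gamma:C\to B'$ with $\gamma g=g'\beta$, $h'\gamma=\varepsilon_{C'}\Psi(\alpha)h$; (c) if $\beta:C\to B'$, $\alpha:\Psi(A)\to C'$ satisfy $h'\beta=\alpha h$, there is $\gamma:B\to A'$ with $g'\gamma=\beta g$, $\gamma f=f'\Phi(\alpha)\eta_A$. Two pre-triangulated categories are equivalent as such if there is an additive equivalence commuting, up to natural isomorphism, with the functors $\Psi$ and with the functors $\Phi$, and (via these isomorphisms) preserving right triangles and left triangles. **Structure on $\mathrm{Ho}(\mathcal{M})$.** This is Quillen's structure on the homotopy category of a pointed model category: suspension functor $\Sigma^{\mathcal{M}}$ (for cofibrant $A$, $\Sigma^{\mathcal{M}}(A)$ is the cokernel of $A\oplus A\to\mathrm{Cyl}(A)$ for a cylinder object) and loop functor $\Omega^{\mathcal{M}}$ (dually); right triangles are the sequences isomorphic in $\mathrm{Ho}(\mathcal{M})$ to cofibre sequences $A\xrightarrow{f}B\xrightarrow{g}C\to\Sigma^{\mathcal{M}}(A)$ of cofibrations $f$ between cofibrant objects, $C=\mathrm{Coker} f$, the last map being induced by the group coaction of $\Sigma^{\mathcal{M}}(A)$ on $C$; left triangles are the sequences isomorphic to fibre sequences, dually. **Structure on $(\mathcal{C}\cap\mathcal{F})/\mathcal{X}$.** For $A\in\mathcal{C}$ fix a conflation $A\xrightarrow{i^A}X^A\xrightarrow{p^A}U^A$ with $X^A\in\mathcal{X}$, $U^A\in\mathcal{C}$. Then $\Sigma^{\mathcal{X}}:\mathcal{C}/\mathcal{X}\to\mathcal{C}/\mathcal{X}$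 is $A\mapsto U^A$, $\underline f\mapsto\underline{\kappa^f}$ for $f:A\to B$, where $\sigma^fi^A=i^Bf$, $\kappa^fp^A=p^B\sigma^f$ for some $\sigma^f$; $\Delta^{\mathcal{X}}$ is the class of right $\Sigma^{\mathcal{X}}$-sequences isomorphic to $A\xrightarrow{\underline f}B\xrightarrow{\underline g}C\xrightarrow{\underline\xi}\Sigma^{\mathcal{X}}(A)$ for conflations $A\xrightarrow{f}B\xrightarrow{g}C$ with $A,B,C\in\mathcal{C}$, where $\delta f=i^A$, $\xi g=p^A\delta$ for some $\delta:B\to X^A$. For $A\in\mathcal{C}$ fix a conflation $A\xrightarrow{j^A}R(A)\to W^A$ with $R(A)\in\mathcal{F}$ (hence in $\mathcal{C}\cap\mathcal{F}$), $W^A\in\mathcal{C}\cap\mathcal{W}$; this gives a functor $R:\mathcal{C}/\mathcal{X}\to(\mathcal{C}\cap\mathcal{F})/\mathcal{X}$, $R(\underline f)=\underline{\hat f}$ with $\hat fj^A=j^Bf$, where $R(A)$ is identified with $A$ via $\underline{j}^A$ for $A\in\mathcal{C}\cap\mathcal{F}$. Put $G^{\mathcal{X}}=R\circ\Sigma^{\mathcal{X}}|_{(\mathcal{C}\cap\mathcal{F})/\mathcal{X}}$; right triangles are the right $G^{\mathcal{X}}$-sequences isomorphic to $A\xrightarrow{\underline f}B\xrightarrow{R(\underline g)}R(C)\xrightarrow{R(\underline h)}G^{\mathcal{X}}(A)$ with $A,B\in\mathcal{C}\cap\mathcal{F}$ and $A\xrightarrow{\underline f}B\xrightarrow{\underline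 g}C\xrightarrow{\underline h}\Sigma^{\mathcal{X}}(A)$ in $\Delta^{\mathcal{X}}$. Dually, for $A\in\mathcal{F}$ fix conflations $U_A\xrightarrow{\iota_A}X_A\xrightarrow{\pi_A}A$ with $X_A\in\mathcal{X}$, $U_A\in\mathcal{F}$, and $W_A\to Q(A)\xrightarrow{r_A}A$ with $Q(A)\in\mathcal{C}$, $W_A\in\mathcal{W}\cap\mathcal{F}$; define $\Omega_{\mathcal{X}}:\mathcal{F}/\mathcal{X}\to\mathcal{F}/\mathcal{X}$, $A\mapsto U_A$, the class $\nabla_{\mathcal{X}}$ of left $\Omega_{\mathcal{X}}$-sequences isomorphic to $\Omega_{\mathcal{X}}(B)\xrightarrow{\underline\zeta}K\xrightarrow{\underline v}A\xrightarrow{\underline f}B$ for conflations $K\xrightarrow{v}A\xrightarrow{f}B$ in $\mathcal{F}$ (with $f\delta=\pi_B$, $v\zeta=\delta\iota_B$ for some $\delta:X_B\to A$), $Q:\mathcal{F}/\mathcal{X}\to(\mathcal{C}\cap\mathcal{F})/\mathcal{X}$ with $Q(\underline f)=\underline{\check f}$, $r_B\check f=fr_A$ (with $Q(A)$ identified with $A$ for $A\in\mathcal{C}\cap\mathcal{F}$), $H_{\mathcal{X}}=Q\circ\Omega_{\mathcal{X}}|_{(\mathcal{C}\cap\mathcal{F})/\mathcal{X}}$, and left triangles as the left $H_{\mathcal{X}}$-sequences isomorphic to $H_{\mathcal{X}}(B)\xrightarrow{Q(\underline v)}Q(K)\xrightarrow{Q(\underline u)}A\xrightarrow{\underline f}B$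 with $A,B\in\mathcal{C}\cap\mathcal{F}$ and $\Omega_{\mathcal{X}}(B)\xrightarrow{\underline v}K\xrightarrow{\underline u}A\xrightarrow{\underline f}B$ in $\nabla_{\mathcal{X}}$. *)

(* Defs.v *)
From Stdlib Require Import ClassicalEpsilon.

Set Implicit Arguments.
Unset Strict Implicit.
Unset Printing Implicit Defensive.

(** Hom-types carry an explicit equality [heq], so that stable categories and
    localizations are obtained by coarsening [heq] or by generating it.  The
    records are raw data and the laws are separate predicates.  Primitive
    projections make [op] an involution up to conversion, so that every dual
    notion is the original one read in the opposite category. *)

Set Primitive Projections.

Record precat := Precat {
  ob :> Type;
  hom : ob -> ob -> Type;
  heq : forall X Y, hom X Y -> hom X Y -> Prop;
  idm : forall X, hom X X;
  comp : forall X Y Z, hom Y Z -> hom X Y -> hom X Z }.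

Arguments hom {_} _ _.
Arguments heq {_ _ _} _ _.
Arguments idm {_} _.
Arguments comp {_ _ _ _} _ _.

Notation "f ≈ g" := (heq f g) (at level 70, no associativity).
Notation "g ∘ f" := (comp g f) (at level 40, left associativity).

Record addstr (T : precat) := AddStr {
  hzero : forall X Y : T, hom X Y;
  hadd : forall X Y : T, hom X Y -> hom X Y -> hom X Y;
  hopp : forall X Y : T, hom X Y -> hom X Y }.

Arguments hzero {_} _ _ _.
Arguments hadd {_} _ {_ _} _ _.
Arguments hopp {_} _ {_ _} _.

Record fdata (T U : precat) := Fdata {
  fob :> T -> U;
  fmap : forall X Y : T, hom X Y -> hom (fob X) (fob Y) }.

Arguments fmap {_ _} _ {_ _} _.

Unset Primitive Projections.

Definition mor_class (T : precat) := forall X Y : T, hom X Y -> Prop.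

Record category_laws (T : precat) : Prop := {
  heq_refl : forall (X Y : T) (f : hom X Y), f ≈ f;
  heq_sym : forall (X Y : T) (f g : hom X Y), f ≈ g -> g ≈ f;
  heq_trans : forall (X Y : T) (f g h : hom X Y), f ≈ g -> g ≈ h -> f ≈ h;
  comp_heq : forall (X Y Z : T) (g g' : hom Y Z) (f f' : hom X Y),
    g ≈ g' -> f ≈ f' -> g ∘ f ≈ g' ∘ f';
  comp_id_l : forall (X Y : T) (f : hom X Y), idm Y ∘ f ≈ f;
  comp_id_r : forall (X Y : T) (f : hom X Y), f ∘ idm X ≈ f;
  comp_assoc : forall (X Y Z V : T) (h : hom Z V) (g : hom Y Z) (f : hom X Y),
    h ∘ (g ∘ f) ≈ (h ∘ g) ∘ f }.

Definition is_iso (T : precat) (X Y : T) (f : hom X Y) : Prop :=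
  exists g : hom Y X, g ∘ f ≈ idm X /\ f ∘ g ≈ idm Y.

Definition op (T : precat) : precat := {|
  ob := ob T;
  hom := fun X Y => @hom T Y X;
  heq := fun X Y f g => @heq T Y X f g;
  idm := fun X => @idm T X;
  comp := fun X Y Z g f => @comp T Z Y X f g |}.

Definition opS (T : precat) (S : addstr T) : addstr (op T) :=
  @AddStr (op T) (fun X Y => hzero S Y X)
    (fun X Y f g => @hadd T S Y X f g) (fun X Y f => @hopp T S Y X f).

Definition opF (T U : precat) (F : fdata T U) : fdata (op T) (op U) :=
  @Fdata (op T) (op U) (fun X => F X) (fun X Y f => @fmap T U F Y X f).

Definition fid (T : precat) : fdata T T :=
  @Fdata T T (fun X => X) (fun X Y f => f).

Definition fcomp (T U V : precat) (G : fdata U V) (F : fdata T U) : fdata T V :=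
  @Fdata T V (fun X => G (F X)) (fun X Y f => fmap G (fmap F f)).

Record is_functor (T U : precat) (F : fdata T U) : Prop := {
  fmap_heq : forall (X Y : T) (f g : hom X Y), f ≈ g -> fmap F f ≈ fmap F g;
  fmap_id : forall X : T, fmap F (idm X) ≈ idm (F X);
  fmap_comp : forall (X Y Z : T) (g : hom Y Z) (f : hom X Y),
    fmap F (g ∘ f) ≈ fmap F g ∘ fmap F f }.

Definition natural (T U : precat) (F G : fdata T U)
    (t : forall X : T, hom (F X) (G X)) : Prop :=
  forall (X Y : T) (f : hom X Y), t Y ∘ fmap F f ≈ fmap G f ∘ t X.

Definition nat_iso (T U : precat) (F G : fdata T U)
    (t : forall X : T, hom (F X) (G X)) : Prop :=
  natural t /\ forall X, is_iso (t X).

Definition adjunction (T U : precat) (L : fdata T U) (R : fdata U T)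
    (eta : forall X : T, hom X (R (L X)))
    (eps : forall Y : U, hom (L (R Y)) Y) : Prop :=
  natural (F := fid T) (G := fcomp R L) eta /\
  natural (F := fcomp L R) (G := fid U) eps /\
  (forall X, eps (L X) ∘ fmap L (eta X) ≈ idm (L X)) /\
  (forall Y, fmap R (eps Y) ∘ eta (R Y) ≈ idm (R Y)).

Record preadditive (T : precat) (S : addstr T) : Prop := {
  preadd_cat : category_laws T;
  hadd_heq : forall (X Y : T) (f f' g g' : hom X Y),
    f ≈ f' -> g ≈ g' -> hadd S f g ≈ hadd S f' g';
  hopp_heq : forall (X Y : T) (f f' : hom X Y), f ≈ f' -> hopp S f ≈ hopp S f';
  hadd_assoc : forall (X Y : T) (f g h : hom X Y),
    hadd S f (hadd S g h) ≈ hadd S (hadd S f g) h;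
  hadd_comm : forall (X Y : T) (f g : hom X Y), hadd S f g ≈ hadd S g f;
  hadd_zero : forall (X Y : T) (f : hom X Y), hadd S f (hzero S X Y) ≈ f;
  hadd_opp : forall (X Y : T) (f : hom X Y), hadd S f (hopp S f) ≈ hzero S X Y;
  comp_add_l : forall (X Y Z : T) (g g' : hom Y Z) (f : hom X Y),
    hadd S g g' ∘ f ≈ hadd S (g ∘ f) (g' ∘ f);
  comp_add_r : forall (X Y Z : T) (g : hom Y Z) (f f' : hom X Y),
    g ∘ hadd S f f' ≈ hadd S (g ∘ f) (g ∘ f') }.

Definition is_zero (T : precat) (O : T) : Prop :=
  (forall (X : T) (f g : hom O X), f ≈ g) /\ (forall (X : T) (f g : hom X O), f ≈ g).

Record biprod (T : precat) (S : addstr T) (X Y : T) := {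
  bp :> T;
  in1 : hom X bp;
  in2 : hom Y bp;
  pr1 : hom bp X;
  pr2 : hom bp Y;
  pr1_in1 : pr1 ∘ in1 ≈ idm X;
  pr2_in2 : pr2 ∘ in2 ≈ idm Y;
  pr1_in2 : pr1 ∘ in2 ≈ hzero S Y X;
  pr2_in1 : pr2 ∘ in1 ≈ hzero S X Y;
  in_pr : hadd S (in1 ∘ pr1) (in2 ∘ pr2) ≈ idm bp }.

Definition copair (T : precat) (S : addstr T) (X Y Z : T) (P : biprod S X Y)
    (f : hom X Z) (g : hom Y Z) : hom P Z :=
  hadd S (f ∘ pr1 P) (g ∘ pr2 P).

Record additive (T : precat) (S : addstr T) : Prop := {
  add_preadditive : preadditive S;
  add_zero_ob : exists O : T, is_zero O;
  add_biprod : forall X Y : T, inhabited (biprod S X Y) }.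

Definition additive_functor (T U : precat) (S : addstr T) (S' : addstr U)
    (F : fdata T U) : Prop :=
  is_functor F /\
  forall (X Y : T) (f g : hom X Y), fmap F (hadd S f g) ≈ hadd S' (fmap F f) (fmap F g).

Definition is_cokernel (T : precat) (S : addstr T) (X Y Z : T)
    (f : hom X Y) (g : hom Y Z) : Prop :=
  g ∘ f ≈ hzero S X Z /\
  forall (V : T) (h : hom Y V), h ∘ f ≈ hzero S X V ->
    exists u : hom Z V, u ∘ g ≈ h /\ forall u' : hom Z V, u' ∘ g ≈ h -> u' ≈ u.

Definition is_kernel (T : precat) (S : addstr T) (X Y Z : T)
    (f : hom X Y) (g : hom Y Z) : Prop :=
  @is_cokernel (op T) (opS S) Z Y X g f.

(** [P], with [u : Y -> P] and [v : Z -> P], is the pushout of [f] and [g]. *)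
Definition is_pushout (T : precat) (X Y Z P : T) (f : hom X Y) (g : hom X Z)
    (u : hom Y P) (v : hom Z P) : Prop :=
  u ∘ f ≈ v ∘ g /\
  forall (V : T) (a : hom Y V) (b : hom Z V), a ∘ f ≈ b ∘ g ->
    exists w : hom P V, w ∘ u ≈ a /\ w ∘ v ≈ b /\
      forall w' : hom P V, w' ∘ u ≈ a -> w' ∘ v ≈ b -> w' ≈ w.

Definition conf_class (T : precat) :=
  forall X Y Z : T, hom X Y -> hom Y Z -> Prop.

Definition opE (T : precat) (E : conf_class T) : conf_class (op T) :=
  fun X Y Z f g => E Z Y X g f.

Definition inflation (T : precat) (E : conf_class T) (X Y : T) (i : hom X Y) : Prop :=
  exists (Z : T) (d : hom Y Z), E X Y Z i d.

(** The axioms on inflations; read in [op T] they are the axioms on deflations. *)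
Record inflation_axioms (T : precat) (E : conf_class T) : Prop := {
  infl_id : forall X : T, inflation E (idm X);
  infl_comp : forall (X Y Z : T) (i : hom X Y) (j : hom Y Z),
    inflation E i -> inflation E j -> inflation E (j ∘ i);
  infl_pushout : forall (X Y X' : T) (i : hom X Y) (f : hom X X'), inflation E i ->
    exists (Y' : T) (f' : hom Y Y') (i' : hom X' Y'),
      is_pushout i f f' i' /\ inflation E i' }.

Record exact_category (T : precat) (S : addstr T) (E : conf_class T) : Prop := {
  ex_additive : additive S;
  ex_ker_coker : forall (X Y Z : T) (i : hom X Y) (d : hom Y Z),
    E X Y Z i d -> is_kernel S i d /\ is_cokernel S i d;
  ex_iso : forall (X Y Z X' Y' Z' : T) (i : hom X Y) (d : hom Y Z)
      (i' : hom X' Y') (d' : hom Y' Z') (a : hom X X') (b : hom Y Y') (c : hom Z Z'),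
    is_iso a -> is_iso b -> is_iso c -> b ∘ i ≈ i' ∘ a -> c ∘ d ≈ d' ∘ b ->
    E X Y Z i d -> E X' Y' Z' i' d';
  ex_infl : inflation_axioms E;
  ex_defl : inflation_axioms (opE E) }.

Definition weakly_idempotent_complete (T : precat) (E : conf_class T) : Prop :=
  forall (X Y : T) (i : hom X Y) (r : hom Y X), r ∘ i ≈ idm X -> inflation E i.

(** [Ext^1(X, Y) = 0]: every conflation [Y -> B -> X] splits. *)
Definition ext_zero (T : precat) (E : conf_class T) (X Y : T) : Prop :=
  forall (B : T) (i : hom Y B) (d : hom B X), E Y B X i d ->
    exists s : hom X B, d ∘ s ≈ idm X.

Definition cotorsion_pair (T : precat) (E : conf_class T) (C F : T -> Prop) : Prop :=
  (forall X, C X <-> forall Y, F Y -> ext_zero E X Y) /\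
  (forall Y, F Y <-> forall X, C X -> ext_zero E X Y).

Definition complete_cotorsion_pair (T : precat) (E : conf_class T)
    (C F : T -> Prop) : Prop :=
  cotorsion_pair E C F /\
  (forall A : T, exists (Y X : T) (i : hom Y X) (d : hom X A),
     E Y X A i d /\ F Y /\ C X) /\
  (forall A : T, exists (Y X : T) (i : hom A Y) (d : hom Y X),
     E A Y X i d /\ F Y /\ C X).

Definition thick (T : precat) (S : addstr T) (E : conf_class T) (W : T -> Prop) : Prop :=
  (forall (X Y : T) (P : biprod S X Y), W P -> W X) /\
  (forall (X Y Z : T) (i : hom X Y) (d : hom Y Z), E X Y Z i d ->
     (W X -> W Y -> W Z) /\ (W X -> W Z -> W Y) /\ (W Y -> W Z -> W X)).

Definition cap (T : Type) (P Q : T -> Prop) : T -> Prop := fun X => P X /\ Q X.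

Definition hovey_triple (T : precat) (S : addstr T) (E : conf_class T)
    (C W F : T -> Prop) : Prop :=
  thick S E W /\
  complete_cotorsion_pair E C (cap W F) /\
  complete_cotorsion_pair E (cap C W) F.

Record model_data (T : precat) := {
  cof : mor_class T;
  fib : mor_class T;
  weq : mor_class T }.

Definition opM (T : precat) (M : model_data T) : model_data (op T) :=
  @Build_model_data (op T) (fun X Y f => @fib T M Y X f)
    (fun X Y f => @cof T M Y X f) (fun X Y f => @weq T M Y X f).

Definition hovey_model (T : precat) (E : conf_class T) (C W F : T -> Prop) :
    model_data T := {|
  cof := fun X Y f => exists (Z : T) (d : hom Y Z), E X Y Z f d /\ C Z;
  fib := fun X Y f => exists (K : T) (k : hom K X), E K X Y k f /\ F K;
  weq := fun X Y f => exists (B : T) (i : hom X B) (p : hom B Y),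
    f ≈ p ∘ i /\
    (exists (Z : T) (d : hom B Z), E X B Z i d /\ C Z /\ W Z) /\
    (exists (K : T) (k : hom K B), E K B Y k p /\ W K /\ F K) |}.

(** The Gabriel-Zisman localization: morphisms are formal composites of
    morphisms of [T] and of formal inverses of members of [V], modulo the
    congruence generated by the obvious relations. *)

Inductive loc_hom (T : precat) (V : mor_class T) : T -> T -> Type :=
| lmap : forall X Y : T, hom X Y -> loc_hom V X Y
| linv : forall (X Y : T) (w : hom X Y), V X Y w -> loc_hom V Y X
| lcomp : forall X Y Z : T, loc_hom V Y Z -> loc_hom V X Y -> loc_hom V X Z.

Inductive loc_eq (T : precat) (V : mor_class T) :
    forall X Y : T, loc_hom V X Y -> loc_hom V X Y -> Prop :=
| le_refl : forall (X Y : T) (f : loc_hom V X Y), loc_eq f f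
| le_sym : forall (X Y : T) (f g : loc_hom V X Y), loc_eq f g -> loc_eq g f
| le_trans : forall (X Y : T) (f g h : loc_hom V X Y),
    loc_eq f g -> loc_eq g h -> loc_eq f h
| le_comp : forall (X Y Z : T) (g g' : loc_hom V Y Z) (f f' : loc_hom V X Y),
    loc_eq g g' -> loc_eq f f' -> loc_eq (lcomp g f) (lcomp g' f')
| le_id_l : forall (X Y : T) (f : loc_hom V X Y), loc_eq (lcomp (lmap V (idm Y)) f) f
| le_id_r : forall (X Y : T) (f : loc_hom V X Y), loc_eq (lcomp f (lmap V (idm X))) f
| le_assoc : forall (X Y Z U : T) (h : loc_hom V Z U) (g : loc_hom V Y Z)
    (f : loc_hom V X Y), loc_eq (lcomp h (lcomp g f)) (lcomp (lcomp h g) f)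
| le_map : forall (X Y : T) (f g : hom X Y), f ≈ g -> loc_eq (lmap V f) (lmap V g)
| le_map_comp : forall (X Y Z : T) (g : hom Y Z) (f : hom X Y),
    loc_eq (lmap V (g ∘ f)) (lcomp (lmap V g) (lmap V f))
| le_inv_l : forall (X Y : T) (w : hom X Y) (hw : V X Y w),
    loc_eq (lcomp (linv hw) (lmap V w)) (lmap V (idm X))
| le_inv_r : forall (X Y : T) (w : hom X Y) (hw : V X Y w),
    loc_eq (lcomp (lmap V w) (linv hw)) (lmap V (idm Y)).

Definition localization (T : precat) (V : mor_class T) : precat := {|
  ob := ob T;
  hom := loc_hom V;
  heq := fun X Y => @loc_eq T V X Y;
  idm := fun X => lmap V (idm X);
  comp := fun X Y Z g f => lcomp g f |}.

Definition Ho (T : precat) (M : model_data T) : precat := localization (weq M).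

Definition loc_functor (T : precat) (M : model_data T) : fdata T (Ho M) :=
  @Fdata T (Ho M) (fun X => X) (fun X Y f => lmap (weq M) f).

Record rseq (T : precat) (Psi : fdata T T) := RSeq {
  rA : T; rB : T; rC : T;
  r1 : hom rA rB; r2 : hom rB rC; r3 : hom rC (Psi rA) }.

Arguments RSeq {_} _ {_ _ _} _ _ _.

(** A left [Phi]-sequence [Phi C -> A -> B -> C] is a right sequence of the
    opposite category; [LSeq] takes the maps in the order of the display. *)
Definition lseq (T : precat) (Phi : fdata T T) : Type := @rseq (op T) (opF Phi).

Definition LSeq (T : precat) (Phi : fdata T T) (A B C : T)
    (f : hom (Phi C) A) (g : hom A B) (h : hom B C) : lseq Phi :=
  @RSeq (op T) (opF Phi) C B A h g f.

Definition rseq_iso (T : precat) (Psi : fdata T T) (s t : rseq Psi) : Prop :=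
  exists (a : hom (rA s) (rA t)) (b : hom (rB s) (rB t)) (c : hom (rC s) (rC t)),
    is_iso a /\ is_iso b /\ is_iso c /\
    b ∘ r1 s ≈ r1 t ∘ a /\ c ∘ r2 s ≈ r2 t ∘ b /\ fmap Psi a ∘ r3 s ≈ r3 t ∘ c.

Record right_triangulated (T : precat) (S : addstr T) (Psi : fdata T T)
    (Delta : rseq Psi -> Prop) : Prop := {
  rt_additive : additive S;
  rt_functor : additive_functor S S Psi;
  rt_iso : forall s t, rseq_iso s t -> Delta s -> Delta t;
  rt1 : forall (A B : T) (f : hom A B), exists (C : T) (g : hom B C) (h : hom C (Psi A)),
    Delta (RSeq Psi f g h);
  rt1_id : forall O A : T, is_zero O ->
    Delta (RSeq Psi (hzero S O A) (idm A) (hzero S A (Psi O)));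
  rt2 : forall (A B C : T) (f : hom A B) (g : hom B C) (h : hom C (Psi A)),
    Delta (RSeq Psi f g h) -> Delta (RSeq Psi g h (hopp S (fmap Psi f)));
  rt3 : forall (A B C A' B' C' : T)
      (f : hom A B) (g : hom B C) (h : hom C (Psi A))
      (f' : hom A' B') (g' : hom B' C') (h' : hom C' (Psi A'))
      (a : hom A A') (b : hom B B'),
    Delta (RSeq Psi f g h) -> Delta (RSeq Psi f' g' h') -> b ∘ f ≈ f' ∘ a ->
    exists c : hom C C', c ∘ g ≈ g' ∘ b /\ fmap Psi a ∘ h ≈ h' ∘ c;
  rt4 : forall (A B C A' B' C' : T)
      (f : hom A B) (l : hom B C') (m : hom C' (Psi A))
      (g : hom B C) (h : hom C A') (j : hom A' (Psi B))
      (u : hom C B') (v : hom B' (Psi A)),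
    Delta (RSeq Psi f l m) -> Delta (RSeq Psi g h j) -> Delta (RSeq Psi (g ∘ f) u v) ->
    exists (r : hom C' B') (s : hom B' A'),
      r ∘ l ≈ u ∘ g /\ v ∘ r ≈ m /\ s ∘ u ≈ h /\ j ∘ s ≈ fmap Psi f ∘ v /\
      Delta (RSeq Psi r s (fmap Psi l ∘ j)) }.

Definition left_triangulated (T : precat) (S : addstr T) (Phi : fdata T T)
    (Nabla : lseq Phi -> Prop) : Prop :=
  @right_triangulated (op T) (opS S) (opF Phi) Nabla.

Record pretri := Pretri {
  pt_cat :> precat;
  pt_add : addstr pt_cat;
  pt_Psi : fdata pt_cat pt_cat;
  pt_Phi : fdata pt_cat pt_cat;
  pt_right : rseq pt_Psi -> Prop;
  pt_left : lseq pt_Phi -> Prop }.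

Record pretriangulated (T : pretri) : Prop := {
  pt_rt : right_triangulated (pt_add T) (@pt_right T);
  pt_lt : left_triangulated (pt_add T) (@pt_left T);
  pt_compat : exists (eta : forall X : T, hom X (pt_Phi T (pt_Psi T X)))
      (eps : forall X : T, hom (pt_Psi T (pt_Phi T X)) X),
    adjunction eta eps /\
    forall (A B C : T) (f : hom A B) (g : hom B C) (h : hom C (pt_Psi T A))
      (A' B' C' : T) (f' : hom (pt_Phi T C') A') (g' : hom A' B') (h' : hom B' C'),
      pt_right (RSeq (pt_Psi T) f g h) -> pt_left (LSeq f' g' h') ->
      (forall (a : hom A (pt_Phi T C')) (b : hom B A'), b ∘ f ≈ f' ∘ a ->
         exists c : hom C B',
           c ∘ g ≈ g' ∘ b /\ h' ∘ c ≈ eps C' ∘ (fmap (pt_Psi T) a ∘ h)) /\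
      (forall (b : hom C B') (a : hom (pt_Psi T A) C'), h' ∘ b ≈ a ∘ h ->
         exists c : hom B A',
           g' ∘ c ≈ b ∘ g /\ c ∘ f ≈ f' ∘ (fmap (pt_Phi T) a ∘ eta A)) }.

(** Image of a right sequence under [F], the last map being corrected by
    [t : F Psi -> Psi' F]. *)
Definition map_rseq (T U : precat) (Psi : fdata T T) (Psi' : fdata U U) (F : fdata T U)
    (t : forall X : T, hom (F (Psi X)) (Psi' (F X))) (s : rseq Psi) : rseq Psi' :=
  RSeq Psi' (fmap F (r1 s)) (fmap F (r2 s)) (t (rA s) ∘ fmap F (r3 s)).

Definition equivalence (T U : precat) (F : fdata T U) : Prop :=
  is_functor F /\
  exists G : fdata U T, is_functor G /\
    (exists t : forall X : T, hom X (G (F X)), nat_iso (F := fid T) (G := fcomp G F) t) /\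
    (exists t : forall Y : U, hom (F (G Y)) Y, nat_iso (F := fcomp F G) (G := fid U) t).

(** The left-hand half is stated in the opposite categories, where [w X] is a
    map [Phi' (F X) -> F (Phi X)] of [T']. *)
Definition pretri_equiv (T T' : pretri) : Prop :=
  exists F : fdata T T',
    equivalence F /\ additive_functor (pt_add T) (pt_add T') F /\
    (exists t : forall X : T, hom (F (pt_Psi T X)) (pt_Psi T' (F X)),
       nat_iso (F := fcomp F (pt_Psi T)) (G := fcomp (pt_Psi T') F) t /\
       forall s : rseq (pt_Psi T), pt_right s -> pt_right (map_rseq t s)) /\
    (exists w : forall X : T, hom (pt_Phi T' (F X)) (F (pt_Phi T X)),
       nat_iso (F := fcomp (pt_Phi T') F) (G := fcomp F (pt_Phi T)) w /\
       forall s : lseq (pt_Phi T), pt_left s ->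
         pt_left (@map_rseq (op T) (op T') (opF (pt_Phi T)) (opF (pt_Phi T')) (opF F) w s)).

(** Quillen's structure is defined relative to a functor [L : T -> H], used with the localization
    functor of a model structure and with its opposite; the latter yields the
    loop functor and the fibre sequences. *)

Definition cofibrant (T : precat) (S : addstr T) (M : model_data T) (X : T) : Prop :=
  exists O : T, is_zero O /\ cof M (hzero S O X).

(** A cofibrant object with a cylinder object and the cokernel of its two ends. *)
Record cylobj (T : precat) (S : addstr T) (M : model_data T) := {
  cy_ob : T;
  cy_cofibrant : cofibrant S M cy_ob;
  cy_sum : biprod S cy_ob cy_ob;
  cy_cyl : T;
  cy_0 : hom cy_ob cy_cyl;
  cy_1 : hom cy_ob cy_cyl;
  cy_pr : hom cy_cyl cy_ob;
  cy_pr0 : cy_pr ∘ cy_0 ≈ idm cy_ob;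
  cy_pr1 : cy_pr ∘ cy_1 ≈ idm cy_ob;
  cy_cof : cof M (copair cy_sum cy_0 cy_1);
  cy_weq : weq M cy_pr;
  cy_susp : T;
  cy_quo : hom cy_cyl cy_susp;
  cy_coker : is_cokernel S (copair cy_sum cy_0 cy_1) cy_quo }.

Definition cyl_map (T : precat) (S : addstr T) (M : model_data T) (c d : cylobj S M)
    (f : hom (cy_ob c) (cy_ob d)) (k : hom (cy_cyl c) (cy_cyl d)) : Prop :=
  k ∘ cy_0 c ≈ cy_0 d ∘ f /\ k ∘ cy_1 c ≈ cy_1 d ∘ f /\ cy_pr d ∘ k ≈ f ∘ cy_pr c.

Definition cyl_susp_map (T : precat) (S : addstr T) (M : model_data T) (c d : cylobj S M)
    (f : hom (cy_ob c) (cy_ob d)) (s : hom (cy_susp c) (cy_susp d)) : Prop :=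
  exists k : hom (cy_cyl c) (cy_cyl d), cyl_map f k /\ s ∘ cy_quo c ≈ cy_quo d ∘ k.

Section Suspension.

Variables (T : precat) (S : addstr T) (M : model_data T).
Variables (H : precat) (L : fdata T H).

(** [psi] is the suspension of [phi], computed with the cylinders [c] and [c']:
    write [phi] as [j^-1 f] with [j] a weak equivalence between cofibrant objects
    and extend [f] and [j] to a third cylinder object. *)
Definition susp_rel (c c' : cylobj S M) (phi : hom (L (cy_ob c)) (L (cy_ob c')))
    (psi : hom (L (cy_susp c)) (L (cy_susp c'))) : Prop :=
  exists (d : cylobj S M) (f : hom (cy_ob c) (cy_ob d)) (j : hom (cy_ob c') (cy_ob d))
      (s : hom (cy_susp c) (cy_susp d)) (t : hom (cy_susp c') (cy_susp d)),
    weq M j /\ cyl_susp_map f s /\ cyl_susp_map j t /\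
    fmap L j ∘ phi ≈ fmap L f /\ fmap L t ∘ psi ≈ fmap L s.

(** A cofibrant replacement of each object, with a cylinder object of it. *)
Record susp_choice := {
  su_cyl : T -> cylobj S M;
  su_rep : forall A : T, hom (cy_ob (su_cyl A)) A;
  su_weq : forall A : T, weq M (su_rep A) }.

(** [d : C -> Sigma A] is the boundary map of the cofibre sequence
    [A -> B -> C] of the cofibration [f] between cofibrant objects.  The coaction
    [m : C -> C + Sigma A] is [w^-1 n1], where [Z] is [Cyl B] with the two copies
    of [A] collapsed, [n0, n1 : C -> Z] are its two ends and
    [w : C + Sigma A -> Z] is the map given by [n0] and by [Cyl A -> Cyl B];
    [d] is the second component of [m]. *)
Definition cofibre_boundary (cA cB : cylobj S M) (C : T)
    (f : hom (cy_ob cA) (cy_ob cB)) (g : hom (cy_ob cB) C)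
    (d : hom (L C) (L (cy_susp cA))) : Prop :=
  cof M f /\ is_cokernel S f g /\
  exists k : hom (cy_cyl cA) (cy_cyl cB), cyl_map f k /\
  (exists (P : T) (u : hom (cy_sum cB) P) (v : hom (cy_cyl cA) P) (e : hom P (cy_cyl cB)),
     is_pushout (copair (cy_sum cA) (in1 (cy_sum cB) ∘ f) (in2 (cy_sum cB) ∘ f))
       (copair (cy_sum cA) (cy_0 cA) (cy_1 cA)) u v /\
     e ∘ u ≈ copair (cy_sum cB) (cy_0 cB) (cy_1 cB) /\ e ∘ v ≈ k /\ cof M e) /\
  exists (Z : T) (z : hom (cy_cyl cB) Z) (n0 n1 : hom C Z) (t : hom (cy_susp cA) Z),
    is_cokernel S (copair (cy_sum cA) (cy_0 cB ∘ f) (cy_1 cB ∘ f)) z /\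
    n0 ∘ g ≈ z ∘ cy_0 cB /\ n1 ∘ g ≈ z ∘ cy_1 cB /\ t ∘ cy_quo cA ≈ z ∘ k /\
    exists (D : biprod S C (cy_susp cA)) (m : hom (L C) (L D)),
      fmap L (copair D n0 t) ∘ m ≈ fmap L n1 /\ d ≈ fmap L (pr2 D) ∘ m.

(** The suspension functor lives on the full image of [L], which has the objects of
    [T]; for a localization functor this is the localization itself. *)
Definition img : precat := {|
  ob := ob T;
  hom := fun X Y => hom (L X) (L Y);
  heq := fun X Y f g => f ≈ g;
  idm := fun X => idm (L X);
  comp := fun X Y Z g f => g ∘ f |}.

Variable su : susp_choice.

Definition susp_ob (A : T) : T := cy_susp (su_cyl su A).

(** [epsilon] picks a suspension of [phi]; any two are equal in the localization. *)
Definition suspension : fdata img img :=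
  @Fdata img img susp_ob (fun A B phi =>
    epsilon (inhabits (fmap L (hzero S (susp_ob A) (susp_ob B))))
      (fun psi => exists phi' : hom (L (cy_ob (su_cyl su A))) (L (cy_ob (su_cyl su B))),
         fmap L (su_rep su B) ∘ phi' ≈ phi ∘ fmap L (su_rep su A) /\ susp_rel phi' psi)).

(** In a cofibre sequence the cokernel of an arbitrary cylinder object of [A] is
    identified with [suspension A] through the suspension [th] of the inverse
    [phi] of the chosen cofibrant replacement. *)
Definition cofibre_triangles : rseq suspension -> Prop := fun s =>
  exists (cA cB : cylobj S M) (C : T) (f : hom (cy_ob cA) (cy_ob cB)) (g : hom (cy_ob cB) C)
      (d : hom (L C) (L (cy_susp cA)))
      (phi : hom (L (cy_ob cA)) (L (cy_ob (su_cyl su (cy_ob cA)))))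
      (th : hom (L (cy_susp cA)) (L (susp_ob (cy_ob cA)))),
    cofibre_boundary f g d /\
    fmap L (su_rep su (cy_ob cA)) ∘ phi ≈ idm (L (cy_ob cA)) /\ susp_rel phi th /\
    rseq_iso (@RSeq img suspension (cy_ob cA) (cy_ob cB) C
      (fmap L f) (fmap L g) (th ∘ d)) s.

End Suspension.

(** The loop functor and the fibre sequences are the suspension functor and the
    cofibre sequences of the opposite model structure, whose localization is
    [op (Ho M)].  The additive structure [SH] of [Ho M] is not constructed here;
    a category has at most one, up to [≈]. *)
Definition ho_pretri (T : precat) (S : addstr T) (M : model_data T)
    (cyl : susp_choice S M) (path : susp_choice (opS S) (opM M))
    (SH : addstr (Ho M)) : pretri :=
  @Pretri (Ho M) SH
    (suspension (loc_functor M) cyl)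
    (opF (suspension (opF (loc_functor M)) path))
    (@cofibre_triangles T S M (Ho M) (loc_functor M) cyl)
    (@cofibre_triangles (op T) (opS S) (opM M) (op (Ho M)) (opF (loc_functor M)) path).

Definition factors_through (T : precat) (X : T -> Prop) (A B : T) (f : hom A B) : Prop :=
  exists (Y : T) (u : hom A Y) (v : hom Y B), X Y /\ f ≈ v ∘ u.

Definition rel_class (T : precat) := forall A B : T, hom A B -> hom A B -> Prop.

Definition stable_eq (T : precat) (S : addstr T) (X : T -> Prop) : rel_class T :=
  fun A B f g => factors_through X (hadd S f (hopp S g)).

Definition op_rel (T : precat) (sim : rel_class T) : rel_class (op T) :=
  fun A B f g => sim B A f g.

(** Full subcategory on [P], modulo the congruence [sim] on morphisms; it is
    [P/X] for [sim = stable_eq S X]. *)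
Definition quot (T : precat) (P : T -> Prop) (sim : rel_class T) : precat := {|
  ob := {A : T | P A};
  hom := fun A B => hom (proj1_sig A) (proj1_sig B);
  heq := fun A B f g => sim _ _ f g;
  idm := fun A => idm (proj1_sig A);
  comp := fun A B C g f => g ∘ f |}.

Definition quotS (T : precat) (S : addstr T) (P : T -> Prop) (sim : rel_class T) :
    addstr (quot P sim) :=
  @AddStr (quot P sim) (fun A B => hzero S (proj1_sig A) (proj1_sig B))
    (fun A B f g => hadd S f g) (fun A B f => hopp S f).

Section Subfactor.

Variables (T : precat) (S : addstr T) (E : conf_class T).
Variables (C W X : T -> Prop) (sim : rel_class T).
(** [CF] will be the class [C ∩ F], kept abstract so that the section also applies
    to [(F, W, C)] in the opposite category without reordering the intersection. *)
Variables (CF : T -> Prop) (hCF : forall A, CF A -> C A).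

(** Fixed conflations [A -> X^A -> U^A] with [X^A] in [X] and [U^A] in [C]. *)
Record shift_choice := {
  sh_X : {A : T | C A} -> T;
  sh_U : {A : T | C A} -> {A : T | C A};
  sh_i : forall A, hom (proj1_sig A) (sh_X A);
  sh_p : forall A, hom (sh_X A) (proj1_sig (sh_U A));
  sh_conf : forall A, E (sh_i A) (sh_p A);
  sh_inX : forall A, X (sh_X A) }.

(** Fixed conflations [A -> R A -> W^A]. *)
Record repl_choice := {
  re_R : {A : T | C A} -> {A : T | CF A};
  re_W : {A : T | C A} -> T;
  re_j : forall A, hom (proj1_sig A) (proj1_sig (re_R A));
  re_d : forall A, hom (proj1_sig (re_R A)) (re_W A);
  re_conf : forall A, E (re_j A) (re_d A);
  re_inC : forall A, C (re_W A);
  re_inW : forall A, W (re_W A) }.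

Variables (sh : shift_choice) (re : repl_choice).

(** [epsilon] picks some [kappa^f]; it is unique modulo [X]. *)
Definition shift : fdata (quot C sim) (quot C sim) :=
  @Fdata (quot C sim) (quot C sim) (sh_U sh) (fun A B f =>
    epsilon (inhabits (hzero S (proj1_sig (sh_U sh A)) (proj1_sig (sh_U sh B))))
      (fun kappa => exists sigma : hom (sh_X sh A) (sh_X sh B),
         sigma ∘ sh_i sh A ≈ sh_i sh B ∘ f /\ kappa ∘ sh_p sh A ≈ sh_p sh B ∘ sigma)).

Definition shift_triangles : rseq shift -> Prop := fun s =>
  exists (A B D : {A : T | C A}) (f : hom (proj1_sig A) (proj1_sig B))
      (g : hom (proj1_sig B) (proj1_sig D)) (delta : hom (proj1_sig B) (sh_X sh A))
      (xi : hom (proj1_sig D) (proj1_sig (sh_U sh A))),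
    E f g /\ delta ∘ f ≈ sh_i sh A /\ xi ∘ g ≈ sh_p sh A ∘ delta /\
    rseq_iso (@RSeq (quot C sim) shift A B D f g xi) s.

Definition repl : fdata (quot C sim) (quot CF sim) :=
  @Fdata (quot C sim) (quot CF sim) (re_R re) (fun A B f =>
    epsilon (inhabits (hzero S (proj1_sig (re_R re A)) (proj1_sig (re_R re B))))
      (fun fhat => fhat ∘ re_j re A ≈ re_j re B ∘ f)).

Definition incl : fdata (quot CF sim) (quot C sim) :=
  @Fdata (quot CF sim) (quot C sim)
    (fun A => exist C (proj1_sig A) (hCF (proj2_sig A))) (fun A B f => f).

Definition subfactor_shift : fdata (quot CF sim) (quot CF sim) :=
  fcomp repl (fcomp shift incl).

(** [B] being identified with [R B] through [re_j], the map
    [R g : B -> R D] is [fmap repl g ∘ re_j B]. *)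
Definition subfactor_triangles : rseq subfactor_shift -> Prop := fun s =>
  exists (A B : quot CF sim) (D : quot C sim) (f : hom (incl A) (incl B))
      (g : hom (incl B) D) (h : hom D (shift (incl A))),
    shift_triangles (RSeq shift f g h) /\
    rseq_iso (@RSeq (quot CF sim) subfactor_shift A B (repl D)
      f (fmap repl g ∘ re_j re (incl B)) (fmap repl h)) s.

End Subfactor.

(** The category [(C ∩ F)/X], [X = C ∩ W ∩ F], with its right and left triangles;
    the latter are those of the Hovey triple [(F, W, C)] of the opposite category. *)
Definition subfactor_pretri (T : precat) (S : addstr T) (E : conf_class T)
    (C W F : T -> Prop) (X := cap C (cap W F))
    (sC : shift_choice E C X) (rC : repl_choice E C W (cap C F))
    (sF : @shift_choice (op T) (opE E) F X)
    (rF : @repl_choice (op T) (opE E) F W (cap C F)) : pretri :=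
  let sim := stable_eq S X in
  @Pretri (quot (cap C F) sim) (quotS S (cap C F) sim)
    (subfactor_shift S sim (fun A h => proj1 h) sC rC)
    (opF (subfactor_shift (opS S) (op_rel sim) (fun A h => proj2 h) sF rF))
    (@subfactor_triangles T S E C W X sim (cap C F) (fun A h => proj1 h) sC rC)
    (@subfactor_triangles (op T) (opS S) (opE E) F W X (op_rel sim) (cap C F)
       (fun A h => proj2 h) sF rF).

(* Main.v *)
(** Everything said about a Hovey triple [(C, W, F)] is stated so that it holds again for
    [(F, W, C)] in the opposite category; loops, left triangles and fibre sequences are
    therefore suspensions, right triangles and cofibre sequences of [op A].

    Given conflations [A -> K -> U] with [K] in [C ∩ W], [U] in [C], and [N -> J -> Y] with
    [J] in [W ∩ F], [N] in [F], extending and lifting maps yields a bijection between the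
    stable maps [U -> Y] and [A -> N] (the relation [adj]).  It gives the adjunction between
    the shift and the loop functor of [(C ∩ F)/X], and shows that the shift preserves the
    maps [f] which induce bijections on stable maps into objects of [F] (the predicate
    [local]); between objects of [C], these become isomorphisms in [(C ∩ F)/X].

    Bifibrant replacement inverts weak equivalences, hence extends to a functor from the
    homotopy category to [(C ∩ F)/X], and is an equivalence because stable maps from an
    object of [C] to an object of [F] are the same as maps in the homotopy category.  A map
    [Cyl A -> X^A] that is zero on one end and [i^A] on the other one induces a local map
    from the suspension of [A] to [U^A]; under it the boundary map of a cofibre sequence
    [A -> B -> C] corresponds to the map [C -> U^A] of the associated right triangle.  The
    pre-triangulated structure of the homotopy category is obtained by transport. *)

From Stdlib Require Import ClassicalEpsilon List ssreflect ssrfun Arith.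
Require Import Defs.
Import ListNotations.

Set Implicit Arguments.
Unset Strict Implicit.
Unset Printing Implicit Defensive.

Existing Class category_laws.
Existing Class preadditive.
#[export] Existing Instance preadd_cat.

(** Duality is used only through [op], but [op (Ho M)] is not by construction a localization of the
    opposite category. So [ho_setup] retains of the localization only what survives reversal: an
    additive functor that inverts weak equivalences, is full and stably faithful from objects of [C]
    to objects of [F], and comes with the equivalence [K].

    Right triangles raise two difficulties: a square that commutes stably need not commute, and a
    cone formed in [C] need not lie in [F]. With this freedom the octahedral axiom is the
    isomorphism theorem for a composite of two inflations.

    Shift, replacement and suspension are picked by [epsilon] and enter only through their
    specifications; for the suspension even functoriality is deduced from the comparison with the
    shift.

    Condition (b) produces the adjoint map with a minus sign. Counit and unit are therefore both
    negated, which leaves the triangle identities intact. *)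

Section Tools.
Context {T : precat} {HT : category_laws T}.

Lemma er X Y (f : @hom T X Y) : f ≈ f.
Proof. exact: heq_refl. Qed.

Lemma es X Y (f g : @hom T X Y) : f ≈ g -> g ≈ f.
Proof. exact: heq_sym. Qed.

Lemma et X Y (f g h : @hom T X Y) : f ≈ g -> g ≈ h -> f ≈ h.
Proof. exact: heq_trans. Qed.

Lemma cl X Y Z (x : hom Y Z) (f g : @hom T X Y) : f ≈ g -> x ∘ f ≈ x ∘ g.
Proof. move=> h; apply: comp_heq => //; exact: er. Qed.

Lemma cr X Y Z (f g : hom Y Z) (y : @hom T X Y) : f ≈ g -> f ∘ y ≈ g ∘ y.
Proof. move=> h; apply: comp_heq => //; exact: er. Qed.
End Tools.

Arguments er {T HT X Y} f.
Arguments cl {T HT X Y Z} x {f g} _.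
Arguments cr {T HT X Y Z} {f g} y _.

(** * Normal forms for equations in preadditive categories *)

Section Norm.
Context {T : precat} {S : addstr T} {HS : preadditive S}.

Inductive ex : T -> T -> Type :=
| EAt X Y : hom X Y -> ex X Y
| EId X : ex X X
| EComp X Y Z : ex Y Z -> ex X Y -> ex X Z
| EZero X Y : ex X Y
| EAdd X Y : ex X Y -> ex X Y -> ex X Y
| EOpp X Y : ex X Y -> ex X Y.

Fixpoint den X Y (e : ex X Y) : hom X Y :=
  match e with
  | EAt f => f
  | EId X => idm X
  | EComp a b => den a ∘ den b
  | EZero X Y => hzero S X Y
  | EAdd a b => hadd S (den a) (den b)
  | EOpp a => hopp S (den a)
  end.

Fixpoint sum X V (l : list (bool * @hom T X V)) : hom X V :=
  match l with
  | nil => hzero S X V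
  | (true, k) :: l => hadd S k (sum l)
  | (false, k) :: l => hadd S (hopp S k) (sum l)
  end.

Fixpoint negs X V (l : list (bool * @hom T X V)) :=
  match l with
  | nil => nil
  | (b, k) :: l => (negb b, k) :: negs l
  end.

Fixpoint post X Y V (f : hom X Y) (l : list (bool * @hom T Y V)) :=
  match l with
  | nil => nil
  | (b, k) :: l => (b, k ∘ f) :: post f l
  end.

(** The list [l] acts as a continuation: [fl e l] expands [sum l ∘ den e] into signed composites.
    Started at [idm Y], it leaves every composite nested to the left, so that associativity and
    distributivity are settled together. *)
Fixpoint fl X Y (e : ex X Y) V : list (bool * hom Y V) -> list (bool * hom X V) :=
  match e with
  | EAt f => post f
  | EId X => fun l => l
  | EComp a b => fun l => fl b (fl a l)
  | EZero X Y => fun l => nil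
  | EAdd a b => fun l => fl a l ++ fl b l
  | EOpp a => fun l => negs (fl a l)
  end.

Lemma ad X Y (f f' g g' : @hom T X Y) : f ≈ f' -> g ≈ g' -> hadd S f g ≈ hadd S f' g'.
Proof. exact: hadd_heq. Qed.

Lemma op_ X Y (f f' : @hom T X Y) : f ≈ f' -> hopp S f ≈ hopp S f'.
Proof. exact: hopp_heq. Qed.

Lemma ad0l X Y (f : @hom T X Y) : hadd S (hzero S X Y) f ≈ f.
Proof. exact: et (hadd_comm HS _ _) (hadd_zero HS _). Qed.

Lemma ad_cancel X Y (f g h : @hom T X Y) : hadd S f h ≈ hadd S g h -> f ≈ g.
Proof.
move=> e; pose proof (ad e (er (hopp S h))) as e'.
have k u : hadd S (hadd S u h) (hopp S h) ≈ u.
  apply: et (es (hadd_assoc HS _ _ _)) _.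
  exact: et (ad (er _) (hadd_opp HS _)) (hadd_zero HS _).
exact: et (es (k f)) (et e' (k g)).
Qed.

Lemma opp_uniq X Y (f g : @hom T X Y) : hadd S f g ≈ hzero S X Y -> g ≈ hopp S f.
Proof.
move=> e; apply: (@ad_cancel _ _ _ _ f).
apply: et (hadd_comm HS _ _) (et e _).
exact: es (et (hadd_comm HS _ _) (hadd_opp HS _)).
Qed.

Lemma ad4 X Y (a b c d : @hom T X Y) :
  hadd S (hadd S a b) (hadd S c d) ≈ hadd S (hadd S a c) (hadd S b d).
Proof.
apply: et (es (hadd_assoc HS _ _ _)) _; apply: et _ (hadd_assoc HS _ _ _).
apply: ad (er _) _; apply: et (hadd_assoc HS _ _ _) _; apply: et _ (es (hadd_assoc HS _ _ _)).
exact: ad (hadd_comm HS _ _) (er _).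
Qed.

Lemma opp_add X Y (a b : @hom T X Y) : hopp S (hadd S a b) ≈ hadd S (hopp S a) (hopp S b).
Proof.
apply: es; apply: opp_uniq; apply: et (ad4 _ _ _ _) _.
exact: et (ad (hadd_opp HS _) (hadd_opp HS _)) (ad0l _).
Qed.

Lemma opp0 X Y : hopp S (hzero S X Y) ≈ hzero S X Y.
Proof. apply: es; apply: opp_uniq; exact: ad0l. Qed.

Lemma oppK X Y (a : @hom T X Y) : hopp S (hopp S a) ≈ a.
Proof. apply: es; apply: opp_uniq; exact: et (hadd_comm HS _ _) (hadd_opp HS _). Qed.

Lemma comp0l X Y Z (f : @hom T X Y) : hzero S Y Z ∘ f ≈ hzero S X Z.
Proof.
apply: (@ad_cancel _ _ _ _ (hzero S Y Z ∘ f)); apply: et (es (comp_add_l HS _ _ _)) _.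
exact: et (cr _ (hadd_zero HS _)) (es (ad0l _)).
Qed.

Lemma comp0r X Y Z (f : @hom T Y Z) : f ∘ hzero S X Y ≈ hzero S X Z.
Proof.
apply: (@ad_cancel _ _ _ _ (f ∘ hzero S X Y)); apply: et (es (comp_add_r HS _ _ _)) _.
exact: et (cl _ (hadd_zero HS _)) (es (ad0l _)).
Qed.

Lemma compNl X Y Z (g : @hom T Y Z) (f : hom X Y) : hopp S g ∘ f ≈ hopp S (g ∘ f).
Proof.
apply: opp_uniq; apply: et (es (comp_add_l HS _ _ _)) _.
exact: et (cr _ (hadd_opp HS _)) (comp0l _ _).
Qed.

Lemma compNr X Y Z (g : @hom T Y Z) (f : hom X Y) : g ∘ hopp S f ≈ hopp S (g ∘ f).
Proof.
apply: opp_uniq; apply: et (es (comp_add_r HS _ _ _)) _.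
exact: et (cl _ (hadd_opp HS _)) (comp0r _ _).
Qed.

Lemma sum_app X V (l l' : list (bool * @hom T X V)) : sum (l ++ l') ≈ hadd S (sum l) (sum l').
Proof.
elim: l => [|[[] k] l ih] /=; first exact: es (ad0l _).
all: exact: et (ad (er _) ih) (hadd_assoc HS _ _ _).
Qed.

Lemma sum_negs X V (l : list (bool * @hom T X V)) : sum (negs l) ≈ hopp S (sum l).
Proof.
elim: l => [|[[] k] l ih] /=; first exact: es (opp0 _ _).
- exact: et (ad (er _) ih) (es (opp_add _ _)).
- apply: et (ad (er _) ih) (es (et (opp_add _ _) _)); exact: ad (oppK _) (er _).
Qed.

Lemma sum_post X Y V (f : hom X Y) (l : list (bool * @hom T Y V)) :
  sum (post f l) ≈ sum l ∘ f.
Proof.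
elim: l => [|[[] k] l ih] /=; first exact: es (comp0l _ _).
- exact: et (ad (er _) ih) (es (comp_add_l HS _ _ _)).
- apply: et (ad (er _) ih) (es (et (comp_add_l HS _ _ _) _)).
  exact: ad (compNl _ _) (er _).
Qed.

Lemma sum_fl X Y (e : ex X Y) V (l : list (bool * hom Y V)) : sum (fl e l) ≈ sum l ∘ den e.
Proof.
elim: e V l => {X Y} /=.
- move=> X Y f V l; exact: sum_post.
- move=> X V l; exact: es (comp_id_r _ _).
- move=> X Y Z a iha b ihb V l; apply: et (ihb _ _) _.
  exact: et (cr _ (iha _ _)) (es (comp_assoc _ _ _ _)).
- move=> X Y V l; exact: es (comp0r _ _).
- move=> X Y a iha b ihb V l; apply: et (sum_app _ _) (es (et (comp_add_r HS _ _ _) _)).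
  exact: ad (es (iha _ _)) (es (ihb _ _)).
- move=> X Y a iha V l; apply: et (sum_negs _) (es (et (compNr _ _) _)).
  exact: op_ (es (iha _ _)).
Qed.

(** Composites are represented by their index in a table, so that cancellation of opposite terms is
    a computation on numbers. *)
Fixpoint ins (s : bool) (n : nat) (l : list (bool * nat)) : list (bool * nat) :=
  match l with
  | nil => (s, n) :: nil
  | (s', m) :: l' => if Nat.eqb n m then if Bool.eqb s s' then (s, n) :: l else l'
                     else (s', m) :: ins s n l'
  end.

Fixpoint cancel (l : list (bool * nat)) : list (bool * nat) :=
  match l with nil => nil | (s, n) :: l => ins s n (cancel l) end.

Fixpoint look X V (ats : list (@hom T X V)) (n : nat) : hom X V :=
  match ats, n with
  | nil, _ => hzero S X V
  | a :: _, O => a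
  | _ :: ats, Datatypes.S n => look ats n
  end.

Fixpoint interp X V (ats : list (@hom T X V)) (l : list (bool * nat)) :=
  match l with
  | nil => nil
  | (s, n) :: l => (s, look ats n) :: interp ats l
  end.

Lemma sum_ins X V (ats : list (@hom T X V)) s n l :
  sum (interp ats (ins s n l)) ≈ sum (interp ats ((s, n) :: l)).
Proof.
have sw (a b c : @hom T X V) : hadd S a (hadd S b c) ≈ hadd S b (hadd S a c).
  apply: et (hadd_assoc HS _ _ _) (et _ (es (hadd_assoc HS _ _ _))).
  exact: ad (hadd_comm HS _ _) (er _).
elim: l => [|[s' m] l ih]; first exact: er.
rewrite [ins _ _ _]/=; case: (Nat.eqb_spec n m) => [<-|_].
- case: s {ih} => /=; case: s' => /=; try exact: er.
  + apply: es; apply: et (hadd_assoc HS _ _ _) _.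
    exact: et (ad (hadd_opp HS _) (er _)) (ad0l _).
  + apply: es; apply: et (hadd_assoc HS _ _ _) _.
    exact: et (ad (et (hadd_comm HS _ _) (hadd_opp HS _)) (er _)) (ad0l _).
- case: s ih => ih; case: s' => /=; exact: et (ad (er _) ih) (sw _ _ _).
Qed.

Lemma sum_cancel X V (ats : list (@hom T X V)) l :
  sum (interp ats (cancel l)) ≈ sum (interp ats l).
Proof.
elim: l => [|[s n] l ih]; first exact: er.
apply: et (sum_ins _ _ _ _) _; case: s => /=; exact: ad (er _) ih.
Qed.

Lemma norm_eq X Y (e e' : ex X Y) :
  sum (fl (EAdd e (EOpp e')) [(true, idm Y)]) ≈ hzero S X Y -> den e ≈ den e'.
Proof.
move=> h; pose proof (et (es (sum_fl _ _)) h) as k; simpl in k.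
apply: (@ad_cancel _ _ _ _ (hopp S (den e'))); apply: et (es (comp_id_l _ _)) _.
apply: et _ (es (hadd_opp HS _)); apply: et _ k; apply: cr; exact: es (hadd_zero HS _).
Qed.

Lemma cancel_zero X V (ats : list (@hom T X V)) l :
  cancel l = nil -> sum (interp ats l) ≈ hzero S X V.
Proof. move=> h; apply: et (es (sum_cancel _ _)) _; rewrite h; exact: er. Qed.

(** The second premise says, without subtraction, that [l - r] and [a - b] agree formally; [ncat]
    checks it. *)
Lemma lc_heq X Y (a b l r : @hom T X Y) :
  a ≈ b -> hadd S l b ≈ hadd S r a -> l ≈ r.
Proof. move=> h e; apply: (@ad_cancel _ _ _ _ b); exact: et e (ad (er _) h). Qed.
End Norm.

Ltac reify S e :=
  lazymatch e with
  | @idm ?T ?X => constr:(@EId T X)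
  | @comp _ _ _ _ ?g ?f => let a := reify S g in let b := reify S f in constr:(EComp a b)
  | @hzero ?T _ ?X ?Y => constr:(@EZero T X Y)
  | hadd _ ?f ?g => let a := reify S f in let b := reify S g in constr:(EAdd a b)
  | hopp _ ?f => let a := reify S f in constr:(EOpp a)
  | copair ?P ?f ?g =>
      reify S constr:(hadd S (comp f (pr1 P)) (comp g (pr2 P)))
  | ?f => constr:(EAt f)
  end.

Create HintDb object_conv discriminated.
Hint Constants Opaque : object_conv.
Hint Variables Transparent : object_conv.
Hint Transparent incl fob proj1_sig : object_conv.

(* The objects occurring in two equal composites may differ by the inclusion of
   a full subcategory. *)
Ltac same_mor a b :=
  first
    [ constr_eq a b
    | lazymatch a with
      | @comp _ _ _ _ ?x ?y =>
        lazymatch b with @comp _ _ _ _ ?x' ?y' => same_mor x x'; same_mor y y' end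
      | _ => unify a b with object_conv
      end ].

Ltac find_at k l :=
  lazymatch l with
  | nil => constr:(@None nat)
  | ?a :: ?l' =>
    match goal with
    | _ => let _ := match goal with _ => same_mor a k end in constr:(Some O)
    | _ => lazymatch find_at k l' with
           | Some ?n => constr:(Some (Datatypes.S n))
           | None => constr:(@None nat)
           end
    end
  end.

Ltac snoc l k :=
  lazymatch l with
  | nil => constr:(k :: nil)
  | ?a :: ?l' => let r := snoc l' k in constr:(a :: r)
  end.

Ltac index_list ats l :=
  lazymatch l with
  | nil => constr:((ats, @nil (bool * nat)))
  | (?s, ?k) :: ?l' =>
    lazymatch find_at k ats with
    | Some ?n => lazymatch index_list ats l' with
                 | (?ats', ?r) => constr:((ats', (s, n) :: r)) end
    | None => let n := eval cbv in (List.length ats) in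
              let ats1 := snoc ats k in
              lazymatch index_list ats1 l' with
              | (?ats', ?r) => constr:((ats', (s, n) :: r)) end
    end
  end.

(* Decides equations valid in every preadditive category. *)
Ltac ncat_with S :=
  lazymatch goal with
  | |- @heq ?T ?X ?Y ?l ?r =>
    let a := reify S l in let b := reify S r in
    refine (@norm_eq T S _ X Y a b _);
    lazymatch goal with
    | |- @heq _ ?X ?Y (sum ?l0) _ =>
      let l := eval cbv [fl post negs app negb] in l0 in
      lazymatch index_list (@nil (@hom T X Y)) l with
      | (?ats, ?r) =>
        refine (@cancel_zero T S _ X Y ats r _); vm_compute; reflexivity
      end
    end
  end.

Ltac ncat := lazymatch goal with
  | |- @heq ?T _ _ _ _ =>
    let HS := constr:(ltac:(eauto with typeclass_instances) : @preadditive T _) in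
    lazymatch type of HS with @preadditive _ ?S => ncat_with S end
  end.

(** The additive congruences on [T]. They let linear combinations of equations be formed modulo
    stable equality as well as modulo [≈]. *)
Class add_cong (T : precat) (S : addstr T) (R : rel_class T) : Prop := {
  ac_sub : forall (X Y : T) (f g : hom X Y), f ≈ g -> R X Y f g;
  ac_sym : forall (X Y : T) (f g : hom X Y), R X Y f g -> R X Y g f;
  ac_trans : forall (X Y : T) (f g h : hom X Y), R X Y f g -> R X Y g h -> R X Y f h;
  ac_add : forall (X Y : T) (f f' g g' : hom X Y),
    R X Y f f' -> R X Y g g' -> R X Y (hadd S f g) (hadd S f' g');
  ac_opp : forall (X Y : T) (f f' : hom X Y), R X Y f f' -> R X Y (hopp S f) (hopp S f');
  ac_l : forall (X Y Z : T) (x : hom Y Z) (f g : hom X Y),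
    R X Y f g -> R X Z (x ∘ f) (x ∘ g);
  ac_r : forall (X Y Z : T) (y : hom X Y) (f g : hom Y Z),
    R Y Z f g -> R X Z (f ∘ y) (g ∘ y) }.

Arguments ac_l {T S R _ X Y Z} x {f g} _.
Arguments ac_r {T S R _ X Y Z} y {f g} _.
Arguments ac_sub {T S R _ X Y f g} _.
Arguments ac_sym {T S R _ X Y f g} _.
Arguments ac_add {T S R _ X Y f f' g g'} _ _.
Arguments ac_opp {T S R _ X Y f f'} _.
Arguments ac_trans {T S R _ X Y f g h} _ _.

(** Proofs of equations are combined like the equations themselves: sum, negative, and composition
    on either side. The primed versions work modulo a congruence, into which [!] embeds a strict
    equation. *)
Notation "P ⊕ Q" := (ad P Q) (at level 50, left associativity).
Notation "⊖ P" := (op_ P) (at level 35, right associativity).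
Notation "x ▷ P" := (cl x P) (at level 41, right associativity).
Notation "P ◁ x" := (cr x P) (at level 40, left associativity).
Notation "P ⊕' Q" := (ac_add P Q) (at level 50, left associativity).
Notation "⊖' P" := (ac_opp P) (at level 35, right associativity).
Notation "x ▷' P" := (ac_l x P) (at level 41, right associativity).
Notation "P ◁' x" := (ac_r x P) (at level 40, left associativity).
Notation "! P" := (ac_sub P) (at level 35, right associativity).

Lemma lc_cong (T : precat) (S : addstr T) (HS : preadditive S) (R : rel_class T)
    (HR : add_cong S R) (X Y : T) (a b l r : hom X Y) :
  R X Y a b -> hadd S l b ≈ hadd S r a -> R X Y l r.
Proof.
move=> h e; have q : R X Y (hadd S l (hopp S r)) (hadd S a (hopp S b)).
  apply: ac_sub; apply: (lc_heq e); ncat.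
pose proof (ac_trans q (ac_add h (ac_sub (er (hopp S b))))) as k.
pose proof (ac_add k (ac_sub (er r))) as k'.
apply: (ac_trans _ (ac_trans k' _)); apply: ac_sub; ncat.
Qed.

(* [lc P] proves [l ≈ r], or [sim l r], when [l - r] is formally equal to the
   difference of the two sides of [P]. *)
Tactic Notation "lc" uconstr(P) :=
  lazymatch goal with
  | |- @heq ?T _ _ _ _ =>
    let HS := constr:(ltac:(eauto with typeclass_instances) : @preadditive T _) in
    refine (@lc_heq T _ HS _ _ _ _ _ _ P _); ncat
  | |- ?R ?X ?Y _ _ =>
    refine (@lc_cong _ _ _ R _ X Y _ _ _ _ P _); ncat
  end.

Ltac sncat :=
  lazymatch goal with
  | |- ?R ?X ?Y ?l ?r => refine (@ac_sub _ _ R _ X Y l r _); ncat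
  end.

(** * Normal forms in plain categories, for use before the homotopy category is additive *)

Section NormCat.
Context {T : precat} {HT : category_laws T}.

Inductive mex : T -> T -> Type :=
| MAt X Y : hom X Y -> mex X Y
| MId X : mex X X
| MComp X Y Z : mex Y Z -> mex X Y -> mex X Z.

Fixpoint mden X Y (e : mex X Y) : hom X Y :=
  match e with
  | MAt f => f
  | MId X => idm X
  | MComp a b => mden a ∘ mden b
  end.

Fixpoint mfl X Y (e : mex X Y) V : hom Y V -> hom X V :=
  match e with
  | MAt f => fun k => k ∘ f
  | MId X => fun k => k
  | MComp a b => fun k => mfl b (mfl a k)
  end.

Lemma mfl_ok X Y (e : mex X Y) V (k : hom Y V) : mfl e k ≈ k ∘ mden e.
Proof.
elim: e V k => {X Y} /=.
- move=> X Y f V k; exact: er.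
- move=> X V k; exact: es (comp_id_r _ _).
- move=> X Y Z a iha b ihb V k; apply: et (ihb _ _) _.
  exact: et (cr _ (iha _ _)) (es (comp_assoc _ _ _ _)).
Qed.

Lemma mnorm_eq X Y (e e' : mex X Y) : mfl e (idm Y) ≈ mfl e' (idm Y) -> mden e ≈ mden e'.
Proof.
move=> h; apply: et (es (comp_id_l _ _)) (et _ (comp_id_l _ _)).
exact: et (es (mfl_ok _ _)) (et h (mfl_ok _ _)).
Qed.
End NormCat.

Ltac mreify e :=
  lazymatch e with
  | @idm ?T ?X => constr:(@MId T X)
  | @comp _ _ _ _ ?g ?f => let a := mreify g in let b := mreify f in constr:(MComp a b)
  | ?f => constr:(MAt f)
  end.

(* Decides equations valid in every category. *)
Ltac mcat :=
  lazymatch goal with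
  | |- @heq ?T ?X ?Y ?l ?r =>
    let a := mreify l in let b := mreify r in
    refine (@mnorm_eq T _ X Y a b _); cbv [mfl]; exact (er _)
  end.

Tactic Notation "mstep" uconstr(P) := refine (et (_ : _ ≈ _) (et P _)); [mcat | ].
Tactic Notation "mc" uconstr(P) := refine (et (_ : _ ≈ _) (et P _)); [mcat | mcat].

(** * Triangles and their transport along equivalences *)

Section Iso.
Context {T : precat} {HT : category_laws T}.

Lemma iso_id (X : T) : is_iso (idm X).
Proof. by exists (idm X); split; apply: comp_id_l. Qed.

Lemma iso_comp (X Y Z : T) (g : hom Y Z) (f : hom X Y) :
  is_iso g -> is_iso f -> is_iso (g ∘ f).
Proof.
move=> [g' [gl gr]] [f' [fl_ fr]]; exists (f' ∘ g'); split.
- apply: et (comp_assoc _ _ _ _) (et (cr _ (es (comp_assoc _ _ _ _))) _).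
  exact: et (cr _ (et (cl _ gl) (comp_id_r _ _))) fl_.
- apply: et (comp_assoc _ _ _ _) (et (cr _ (es (comp_assoc _ _ _ _))) _).
  exact: et (cr _ (et (cl _ fr) (comp_id_r _ _))) gr.
Qed.

Lemma iso_heq (X Y : T) (f g : hom X Y) : f ≈ g -> is_iso f -> is_iso g.
Proof.
move=> e [f' [l r]]; exists f'; split.
- exact: et (cl _ (es e)) l.
- exact: et (cr _ (es e)) r.
Qed.

Lemma iso_inv (X Y : T) (f : hom X Y) (g : hom Y X) :
  g ∘ f ≈ idm X -> f ∘ g ≈ idm Y -> is_iso g.
Proof. by exists f. Qed.

Lemma functor_iso (U : precat) (HU : category_laws U) (F : fdata T U) (HF : is_functor F)
    (X Y : T) (f : hom X Y) : is_iso f -> is_iso (fmap F f).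
Proof.
move=> [g [l r]]; exists (fmap F g); split.
- apply: et (es (fmap_comp HF _ _)) (et (fmap_heq HF l) (fmap_id HF _)).
- apply: et (es (fmap_comp HF _ _)) (et (fmap_heq HF r) (fmap_id HF _)).
Qed.
End Iso.

Section AdditiveFunctor.
Context {T U : precat} {S : addstr T} {SU : addstr U}.
Context {HS : preadditive S} {HU : preadditive SU}.
Variables (F : fdata T U) (HF : additive_functor S SU F).

Lemma fmap_zero (X Y : T) : fmap F (hzero S X Y) ≈ hzero SU (F X) (F Y).
Proof.
have e : fmap F (hzero S X Y) ≈ hadd SU (fmap F (hzero S X Y)) (fmap F (hzero S X Y)).
  apply: et _ (proj2 HF _ _ _ _); apply: (fmap_heq (proj1 HF)); ncat.
lc (⊖ e).
Qed.

Lemma fmap_opp (X Y : T) (f : hom X Y) : fmap F (hopp S f) ≈ hopp SU (fmap F f).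
Proof.
have e : hadd SU (fmap F f) (fmap F (hopp S f)) ≈ fmap F (hzero S X Y).
  apply: et (es (proj2 HF _ _ _ _)) _; apply: (fmap_heq (proj1 HF)); ncat.
lc (e ⊕ fmap_zero X Y).
Qed.
End AdditiveFunctor.

Lemma zero_from (T : precat) (S : addstr T) (HS : preadditive S) (O : T) :
  idm O ≈ hzero S O O -> is_zero O.
Proof.
move=> e; split => X f g.
- lc ((f ▷ e) ⊕ (⊖ (g ▷ e))).
- lc ((e ◁ f) ⊕ (⊖ (e ◁ g))).
Qed.

Lemma riso_intro (T : precat) (Psi : fdata T T) (A B C A' B' C' : T)
    (f : hom A B) (g : hom B C) (h : hom C (Psi A))
    (f' : hom A' B') (g' : hom B' C') (h' : hom C' (Psi A'))
    (a : hom A A') (b : hom B B') (c : hom C C') :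
  is_iso a -> is_iso b -> is_iso c -> b ∘ f ≈ f' ∘ a -> c ∘ g ≈ g' ∘ b ->
  fmap Psi a ∘ h ≈ h' ∘ c -> rseq_iso (RSeq Psi f g h) (RSeq Psi f' g' h').
Proof. by exists a, b, c. Qed.

Lemma rseq_iso_refl (T : precat) (HT : category_laws T) (Psi : fdata T T)
    (HP : is_functor Psi) (s : rseq Psi) : rseq_iso s s.
Proof.
exists (idm _), (idm _), (idm _); split; first exact: iso_id.
split; first exact: iso_id.
split; first exact: iso_id.
split; first by apply: et (comp_id_l _ _) (es (comp_id_r _ _)).
split; first by apply: et (comp_id_l _ _) (es (comp_id_r _ _)).
apply: et (cr _ (fmap_id HP _)) _; exact: et (comp_id_l _ _) (es (comp_id_r _ _)).
Qed.

Section RseqIso.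
Context {T : precat} {HT : category_laws T} (Psi : fdata T T) (HP : is_functor Psi).

Lemma sq_comp (X Y Z X' Y' Z' : T) (f : hom X X') (f' : hom Y Y') (f'' : hom Z Z')
    (a : hom X Y) (b : hom Y Z) (a' : hom X' Y') (b' : hom Y' Z') :
  a' ∘ f ≈ f' ∘ a -> b' ∘ f' ≈ f'' ∘ b -> (b' ∘ a') ∘ f ≈ f'' ∘ (b ∘ a).
Proof.
move=> e1 e2; apply: et (es (comp_assoc _ _ _ _)) (et (cl _ e1) _).
apply: et (comp_assoc _ _ _ _) (et (cr _ e2) _); exact: es (comp_assoc _ _ _ _).
Qed.

Lemma sq_inv (X Y X' Y' : T) (f : hom X X') (f' : hom Y Y') (a : hom X Y) (a' : hom X' Y')
    (i : hom Y X) (i' : hom Y' X') :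
  a ∘ i ≈ idm _ -> i' ∘ a' ≈ idm _ -> a' ∘ f ≈ f' ∘ a -> i' ∘ f' ≈ f ∘ i.
Proof.
move=> ia ia' e.
apply: et (es (comp_id_r _ _)) (et (cl _ (es ia)) _).
apply: et (comp_assoc _ _ _ _) (et (cr _ _) (cr _ (et (cr f ia') (comp_id_l _ _)))).
apply: et (es (comp_assoc _ _ _ _)) (et (cl _ (es e)) (comp_assoc _ _ _ _)).
Qed.

Lemma rseq_iso_trans (s t u : rseq Psi) : rseq_iso s t -> rseq_iso t u -> rseq_iso s u.
Proof.
move=> [a [b [c [ia [ib [ic [e1 [e2 e3]]]]]]]] [a' [b' [c' [ia' [ib' [ic' [e1' [e2' e3']]]]]]]].
exists (a' ∘ a), (b' ∘ b), (c' ∘ c).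
split; first exact: iso_comp.
split; first exact: iso_comp.
split; first exact: iso_comp.
split; first exact: sq_comp e1 e1'.
split; first exact: sq_comp e2 e2'.
apply: et (cr _ (fmap_comp HP _ _)) _; exact: sq_comp e3 e3'.
Qed.

Lemma rseq_iso_sym (s t : rseq Psi) : rseq_iso s t -> rseq_iso t s.
Proof.
move=> [a [b [c [[a' [al ar]] [[b' [bl br]] [[c' [cl_ cr_]] [e1 [e2 e3]]]]]]]].
exists a', b', c'.
split; first by exists a.
split; first by exists b.
split; first by exists c.
split; first exact: sq_inv ar bl e1.
split; first exact: sq_inv br cl_ e2.
apply: sq_inv cr_ _ e3.
exact: et (es (fmap_comp HP _ _)) (et (fmap_heq HP al) (fmap_id HP _)).
Qed.
End RseqIso.

(** * Right triangulations from octahedra on representatives *)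

Section Octahedron.
Context {T : precat} {S : addstr T}.
Variables (Psi : fdata T T) (Delta : rseq Psi -> Prop).
Hypothesis hadd_ : additive S.
Let HS : preadditive S := add_preadditive hadd_.
Hypothesis HP : additive_functor S S Psi.
Hypothesis hiso : forall s t, rseq_iso s t -> Delta s -> Delta t.
Hypothesis h1 : forall (A B : T) (f : hom A B), exists (C : T) (g : hom B C) (h : hom C (Psi A)),
  Delta (RSeq Psi f g h).
Hypothesis h1_id : forall O A : T, is_zero O ->
  Delta (RSeq Psi (hzero S O A) (idm A) (hzero S A (Psi O))).
Hypothesis h2 : forall (A B C : T) (f : hom A B) (g : hom B C) (h : hom C (Psi A)),
  Delta (RSeq Psi f g h) -> Delta (RSeq Psi g h (hopp S (fmap Psi f))).
Hypothesis h3 : forall (A B C A' B' C' : T)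
    (f : hom A B) (g : hom B C) (h : hom C (Psi A))
    (f' : hom A' B') (g' : hom B' C') (h' : hom C' (Psi A'))
    (a : hom A A') (b : hom B B'),
  Delta (RSeq Psi f g h) -> Delta (RSeq Psi f' g' h') -> b ∘ f ≈ f' ∘ a ->
  exists c : hom C C', c ∘ g ≈ g' ∘ b /\ fmap Psi a ∘ h ≈ h' ∘ c.
Hypothesis h4 : forall (A B C : T) (f : hom A B) (g : hom B C),
  exists (A0 B0 C0 C' A' B' : T) (a : hom A A0) (b : hom B B0) (c : hom C C0)
    (f0 : hom A0 B0) (g0 : hom B0 C0)
    (l : hom B0 C') (m : hom C' (Psi A0)) (h : hom C0 A') (j : hom A' (Psi B0))
    (u : hom C0 B') (v : hom B' (Psi A0)) (r : hom C' B') (s : hom B' A'),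
  is_iso a /\ is_iso b /\ is_iso c /\ b ∘ f ≈ f0 ∘ a /\ c ∘ g ≈ g0 ∘ b /\
  Delta (RSeq Psi f0 l m) /\ Delta (RSeq Psi g0 h j) /\ Delta (RSeq Psi (g0 ∘ f0) u v) /\
  r ∘ l ≈ u ∘ g0 /\ v ∘ r ≈ m /\ s ∘ u ≈ h /\ j ∘ s ≈ fmap Psi f0 ∘ v /\
  Delta (RSeq Psi r s (fmap Psi l ∘ j)).

#[local] Existing Instance HS.

(** (RT3) is applied from the rotated trivial triangle, which starts with [idm A] followed by zero,
    to the given triangle, along [idm A] and [f]. *)
Lemma tri_comp0 (A B C : T) (f : hom A B) (g : hom B C) (h : hom C (Psi A)) :
  Delta (RSeq Psi f g h) -> g ∘ f ≈ hzero S A C.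
Proof.
move=> D; have [O zO] := add_zero_ob hadd_.
have [|c [e _]] := h3 (a := idm A) (b := f) (h2 (h1_id A zO)) D; first ncat.
lc (⊖ e).
Qed.

(** (RT3) into the trivial triangle [O -> Y -> Y]: every map of a right triangle is a weak cokernel
    of the preceding one. *)
Lemma tri_ext (A B C : T) (f : hom A B) (g : hom B C) (h : hom C (Psi A)) Y (y : hom B Y) :
  Delta (RSeq Psi f g h) -> y ∘ f ≈ hzero S A Y -> exists u : hom C Y, u ∘ g ≈ y.
Proof.
move=> D e; have [O zO] := add_zero_ob hadd_.
have [|c [e' _]] := h3 (a := hzero S A O) (b := y) D (h1_id Y zO); first by lc e.
by exists c; lc e'.
Qed.

(** The shift need not be invertible, so only maps out of the third terms can be tested. Weak
    cokernels show that composition with [c] is bijective on maps into every [Y]; surjectivity gives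
    a left inverse of [c], injectivity makes it two-sided. *)
Lemma tri_five (A B C A' B' C' : T)
    (f : hom A B) (g : hom B C) (h : hom C (Psi A))
    (f' : hom A' B') (g' : hom B' C') (h' : hom C' (Psi A'))
    (a : hom A A') (b : hom B B') (c : hom C C') :
  Delta (RSeq Psi f g h) -> Delta (RSeq Psi f' g' h') -> b ∘ f ≈ f' ∘ a ->
  c ∘ g ≈ g' ∘ b -> fmap Psi a ∘ h ≈ h' ∘ c -> is_iso a -> is_iso b -> is_iso c.
Proof.
move=> D D' e1 e2 e3 [a' [al ar]] [b' [bl br]].
have HPf := proj1 HP.
have Pal : fmap Psi a' ∘ fmap Psi a ≈ idm _.
  exact: et (es (fmap_comp HPf _ _)) (et (fmap_heq HPf al) (fmap_id HPf _)).
have Par : fmap Psi a ∘ fmap Psi a' ≈ idm _.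
  exact: et (es (fmap_comp HPf _ _)) (et (fmap_heq HPf ar) (fmap_id HPf _)).
have Pe1 : fmap Psi b ∘ fmap Psi f ≈ fmap Psi f' ∘ fmap Psi a.
  exact: et (es (fmap_comp HPf _ _)) (et (fmap_heq HPf e1) (fmap_comp HPf _ _)).
have surj Y (y : hom C Y) : exists x : hom C' Y, x ∘ c ≈ y.
  have [|u eu] := tri_ext (y := y ∘ g ∘ b') D'.
    have gf := tri_comp0 D.
    lc ((y ∘ g ∘ b') ▷ (f' ▷ (⊖ ar)) ⊕ ((y ∘ g ∘ b') ▷ (⊖ e1) ◁ a')
        ⊕ (y ∘ g) ▷ bl ◁ (f ∘ a') ⊕ y ▷ gf ◁ a').
  have [|z ez] := tri_ext (y := hadd S y (hopp S (u ∘ c))) (h2 D).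
    lc (⊖ (u ▷ e2) ⊕ ⊖ (eu ◁ b) ⊕ ⊖ ((y ∘ g) ▷ bl)).
  exists (hadd S u (z ∘ fmap Psi a' ∘ h')).
  lc (⊖ ((z ∘ fmap Psi a') ▷ e3) ⊕ (z ▷ Pal ◁ h) ⊕ ez).
have inj Y (y : hom C' Y) : y ∘ c ≈ hzero S _ _ -> y ≈ hzero S _ _.
  move=> e.
  have [|z ez] := tri_ext (y := y) (h2 D').
    lc (⊖ (y ∘ g' ▷ br) ⊕ ⊖ (y ▷ e2 ◁ b') ⊕ e ◁ (g ∘ b')).
  have [|w ew] := tri_ext (y := z ∘ fmap Psi a) (h2 (h2 D)).
    lc (z ▷ e3 ⊕ ez ◁ c ⊕ e).
  have fh : fmap Psi f' ∘ h' ≈ hzero S _ _ by lc (⊖ (tri_comp0 (h2 (h2 D')))).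
  have Pbl : fmap Psi b' ∘ fmap Psi b ≈ idm _.
    exact: et (es (fmap_comp HPf _ _)) (et (fmap_heq HPf bl) (fmap_id HPf _)).
  lc (⊖ ez ⊕ ⊖ (z ▷ Par ◁ h') ⊕ ⊖ (ew ◁ (fmap Psi a' ∘ h'))
      ⊕ (w ▷ Pbl ◁ (fmap Psi f ∘ fmap Psi a' ∘ h'))
      ⊕ ⊖ ((w ∘ fmap Psi b') ▷ Pe1 ◁ (fmap Psi a' ∘ h'))
      ⊕ ⊖ ((w ∘ fmap Psi b' ∘ fmap Psi f') ▷ Par ◁ h')
      ⊕ ⊖ ((w ∘ fmap Psi b') ▷ fh)).
have [x ex_] := surj _ (idm C).
exists x; split => //.
have k : hadd S (c ∘ x) (hopp S (idm _)) ≈ hzero S _ _.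
  by apply: inj; lc (c ▷ ex_).
lc k.
Qed.

(** Only (RT4) needs proof. (RT3) compares the three given triangles with those of one octahedron on
    isomorphic maps, [tri_five] makes the comparisons invertible, and conjugating the octahedron by
    them gives [r] and [s]. *)
Lemma rt_of_octahedra : right_triangulated S Delta.
Proof.
split=> //.
move=> A B C A' B' C' f l m g h j u v D1 D2 D3.
have [A0 [B0 [C0 [C1 [A1 [B1 [a [b [c [f0 [g0 [l0 [m0 [h0 [j0 [u0 [v0 [r0 [s0 H]]]]]]]]]]]]]]]]]]] :=
  h4 f g.
have {H} [ia [ib [ic [ef [eg [E1 [E2 [E3 [rl [vr [su [js E4]]]]]]]]]]]] := H.
have [x [x1 x2]] := h3 D1 E1 ef.
have [y [y1 y2]] := h3 D2 E2 eg.
have egf : c ∘ (g ∘ f) ≈ (g0 ∘ f0) ∘ a by lc (eg ◁ f ⊕ g0 ▷ ef).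
have [z [z1 z2]] := h3 D3 E3 egf.
have ix := tri_five D1 E1 ef x1 x2 ia ib.
have iy := tri_five D2 E2 eg y1 y2 ib ic.
have iz := tri_five D3 E3 egf z1 z2 ia ic.
have HPf := proj1 HP.
have [y' [yl yr]] := iy.
have [z' [zl zr]] := iz.
have [pa [pal par]] := functor_iso _ HPf ia.
have [pb [pbl pbr]] := functor_iso _ HPf ib.
exists (z' ∘ r0 ∘ x), (y' ∘ s0 ∘ z).
have Pef : fmap Psi b ∘ fmap Psi f ≈ fmap Psi f0 ∘ fmap Psi a.
  exact: et (es (fmap_comp HPf _ _)) (et (fmap_heq HPf ef) (fmap_comp HPf _ _)).
have Pex : fmap Psi x ∘ fmap Psi l ≈ fmap Psi l0 ∘ fmap Psi b.
  exact: et (es (fmap_comp HPf _ _)) (et (fmap_heq HPf x1) (fmap_comp HPf _ _)).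
split; first by lc ((z' ∘ r0) ▷ x1 ⊕ z' ▷ rl ◁ b ⊕ ⊖ ((z' ∘ u0) ▷ eg) ⊕ ⊖ (z' ▷ z1 ◁ g)
  ⊕ zl ◁ (u ∘ g)).
split.
  lc (⊖ (pal ◁ (v ∘ z' ∘ r0 ∘ x)) ⊕ pa ▷ z2 ◁ (z' ∘ r0 ∘ x) ⊕ (pa ∘ v0) ▷ zr ◁ (r0 ∘ x)
      ⊕ pa ▷ vr ◁ x ⊕ ⊖ (pa ▷ x2) ⊕ pal ◁ m).
split.
  lc ((y' ∘ s0) ▷ z1 ⊕ y' ▷ su ◁ c ⊕ ⊖ (y' ▷ y1) ⊕ yl ◁ h).
split.
  lc (⊖ (pbl ◁ (j ∘ y' ∘ s0 ∘ z)) ⊕ pb ▷ y2 ◁ (y' ∘ s0 ∘ z) ⊕ (pb ∘ j0) ▷ yr ◁ (s0 ∘ z)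
      ⊕ pb ▷ js ◁ z ⊕ ⊖ ((pb ∘ fmap Psi f0) ▷ z2) ⊕ ⊖ (pb ▷ Pef ◁ v) ⊕ pbl ◁ (fmap Psi f ∘ v)).
apply: hiso E4; apply: (rseq_iso_sym HPf).
apply: (riso_intro (a := x) (b := z) (c := y)) => //.
- lc (zr ◁ (r0 ∘ x)).
- lc (yr ◁ (s0 ∘ z)).
- lc (Pex ◁ j ⊕ fmap Psi l0 ▷ y2).
Qed.
End Octahedron.

(** * Transport of a right triangulation along an equivalence *)

Section Transport.
Context {T U : precat} {ST : addstr T} {SU : addstr U}.
Variables (Psi : fdata T T) (Delta : rseq Psi -> Prop).
Variables (Psi' : fdata U U) (Delta' : rseq Psi' -> Prop).
Hypothesis HT : category_laws T.
Variables (F : fdata T U) (HF : is_functor F).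
Hypothesis full : forall X Y (g : hom (F X) (F Y)), exists f : hom X Y, fmap F f ≈ g.
Hypothesis faithful : forall X Y (f g : hom X Y), fmap F f ≈ fmap F g -> f ≈ g.
Hypothesis surj : forall Y : U, exists (X : T) (f : hom (F X) Y), is_iso f.
Hypothesis Fadd : forall X Y (f g : hom X Y),
  fmap F (hadd ST f g) ≈ hadd SU (fmap F f) (fmap F g).
Hypothesis Fzero : forall X Y, fmap F (hzero ST X Y) ≈ hzero SU (F X) (F Y).
Hypothesis Fopp : forall X Y (f : hom X Y), fmap F (hopp ST f) ≈ hopp SU (fmap F f).

Lemma transport_preadditive : preadditive SU -> preadditive ST.
Proof.
move=> HU; split=> //.
- move=> X Y f f' g g' e1 e2; apply: faithful.
  lc (Fadd f g ⊕ ⊖ (Fadd f' g') ⊕ fmap_heq HF e1 ⊕ fmap_heq HF e2).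
- move=> X Y f f' e; apply: faithful.
  lc (Fopp f ⊕ ⊖ (Fopp f') ⊕ ⊖ (fmap_heq HF e)).
- move=> X Y f g h; apply: faithful.
  lc (Fadd f (hadd ST g h) ⊕ Fadd g h ⊕ ⊖ (Fadd (hadd ST f g) h) ⊕ ⊖ (Fadd f g)).
- move=> X Y f g; apply: faithful; lc (Fadd f g ⊕ ⊖ (Fadd g f)).
- move=> X Y f; apply: faithful; lc (Fadd f (hzero ST X Y) ⊕ Fzero X Y).
- move=> X Y f; apply: faithful.
  lc (Fadd f (hopp ST f) ⊕ Fopp f ⊕ ⊖ (Fzero X Y)).
- move=> X Y Z g g' f; apply: faithful.
  lc (fmap_comp HF (hadd ST g g') f ⊕ Fadd g g' ◁ fmap F f ⊕ ⊖ (Fadd (g ∘ f) (g' ∘ f))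
      ⊕ ⊖ (fmap_comp HF g f) ⊕ ⊖ (fmap_comp HF g' f)).
- move=> X Y Z g f f'; apply: faithful.
  lc (fmap_comp HF g (hadd ST f f') ⊕ fmap F g ▷ Fadd f f' ⊕ ⊖ (Fadd (g ∘ f) (g ∘ f'))
      ⊕ ⊖ (fmap_comp HF g f) ⊕ ⊖ (fmap_comp HF g f')).
Qed.

Lemma reflect_iso (HU : category_laws U) (X Y : T) (f : hom X Y) :
  is_iso (fmap F f) -> is_iso f.
Proof.
move=> [g0 [l r]]; have [g eg] := full g0; exists g; split; apply: faithful.
- apply: et (fmap_comp HF _ _) (et (cr _ eg) (et l (es (fmap_id HF _)))).
- apply: et (fmap_comp HF _ _) (et (cl _ eg) (et r (es (fmap_id HF _)))).
Qed.

Lemma preserve_zero (SUp : preadditive SU) (O : T) : is_zero O -> is_zero (F O).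
Proof.
move=> [zO _]; apply: (zero_from (S := SU)).
have e : idm O ≈ hzero ST O O by apply: zO.
exact: et (es (fmap_id HF _)) (et (fmap_heq HF e) (Fzero _ _)).
Qed.

Lemma transport_additive : additive SU -> additive ST.
Proof.
move=> HA; have HU := add_preadditive HA; have HSp := transport_preadditive HU.
split=> //.
- have [O zO] := add_zero_ob HA; have [O' [f [g [l r]]]] := surj O.
  exists O'; apply: (zero_from (S := ST)); apply: faithful.
  apply: et (fmap_id HF _) (et (es l) (et _ (es (Fzero _ _)))).
  have e : f ≈ hzero SU _ _ by apply: (proj2 zO).
  lc (g ▷ e).
- move=> X Y; have [P] := add_biprod HA (F X) (F Y); have [P' [f [g [l r]]]] := surj P.
  have [i1 e1] := full (g ∘ in1 P); have [i2 e2] := full (g ∘ in2 P).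
  have [p1 q1] := full (pr1 P ∘ f); have [p2 q2] := full (pr2 P ∘ f).
  constructor; apply: (@Build_biprod T ST X Y P' i1 i2 p1 p2); apply: faithful.
  + lc (fmap_comp HF p1 i1 ⊕ ⊖ (fmap_id HF X) ⊕ q1 ◁ fmap F i1 ⊕ (pr1 P ∘ f) ▷ e1
        ⊕ pr1 P ▷ r ◁ in1 P ⊕ pr1_in1 P).
  + lc (fmap_comp HF p2 i2 ⊕ ⊖ (fmap_id HF Y) ⊕ q2 ◁ fmap F i2 ⊕ (pr2 P ∘ f) ▷ e2
        ⊕ pr2 P ▷ r ◁ in2 P ⊕ pr2_in2 P).
  + lc (fmap_comp HF p1 i2 ⊕ ⊖ (Fzero Y X) ⊕ q1 ◁ fmap F i2 ⊕ (pr1 P ∘ f) ▷ e2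
        ⊕ pr1 P ▷ r ◁ in2 P ⊕ pr1_in2 P).
  + lc (fmap_comp HF p2 i1 ⊕ ⊖ (Fzero X Y) ⊕ q2 ◁ fmap F i1 ⊕ (pr2 P ∘ f) ▷ e1
        ⊕ pr2 P ▷ r ◁ in1 P ⊕ pr2_in1 P).
  + lc (Fadd (i1 ∘ p1) (i2 ∘ p2) ⊕ fmap_comp HF i1 p1 ⊕ fmap_comp HF i2 p2
        ⊕ e1 ◁ fmap F p1 ⊕ (g ∘ in1 P) ▷ q1 ⊕ e2 ◁ fmap F p2 ⊕ (g ∘ in2 P) ▷ q2
        ⊕ g ▷ in_pr P ◁ f ⊕ l ⊕ ⊖ (fmap_id HF P')).
Qed.

Variable t : forall X : T, hom (F (Psi X)) (Psi' (F X)).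
Hypothesis Ht : nat_iso (F := fcomp F Psi) (G := fcomp Psi' F) t.
Hypothesis HD : forall s, Delta s <-> Delta' (map_rseq t s).
Hypothesis RU : right_triangulated SU Delta'.

Let HAU : additive SU := rt_additive RU.
Let HU : preadditive SU := add_preadditive HAU.
#[local] Existing Instance HU.
Let HPf : is_functor Psi' := proj1 (rt_functor RU).

(** By naturality and invertibility of [t], the assignment [F Psi] is conjugate to the functor
    [Psi' F], and [F] is faithful. *)
Lemma transport_functor : is_functor Psi.
Proof.
have tn := proj1 Ht; have ti := proj2 Ht; split.
- move=> X Y f g e; apply: faithful; have [t' [l r]] := ti Y.
  have e' := fmap_heq HPf (fmap_heq HF e).
  have n1 := tn X Y f; have n2 := tn X Y g; rewrite /fcomp /= in n1 n2.
  lc (⊖ (l ◁ fmap F (fmap Psi f)) ⊕ l ◁ fmap F (fmap Psi g) ⊕ t' ▷ n1 ⊕ ⊖ (t' ▷ n2)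
      ⊕ t' ▷ e' ◁ t X).
- move=> X; apply: faithful; have [t' [l r]] := ti X.
  have n1 := tn X X (idm X); rewrite /fcomp /= in n1.
  have e1 := fmap_heq HPf (fmap_id HF X); have e2 := fmap_id HPf (F X).
  lc (⊖ (l ◁ fmap F (fmap Psi (idm X))) ⊕ t' ▷ n1 ⊕ t' ▷ e1 ◁ t X ⊕ t' ▷ e2 ◁ t X ⊕ l
      ⊕ ⊖ (fmap_id HF (Psi X))).
- move=> X Y Z g f; apply: faithful; have [t' [l r]] := ti Z.
  have n1 := tn X Y f; have n2 := tn Y Z g; have n3 := tn X Z (g ∘ f).
  rewrite /fcomp /= in n1 n2 n3.
  have e1 := fmap_heq HPf (fmap_comp HF g f); have e2 := fmap_comp HPf (fmap F g) (fmap F f).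
  lc (⊖ (l ◁ fmap F (fmap Psi (g ∘ f))) ⊕ t' ▷ n3 ⊕ t' ▷ e1 ◁ t X ⊕ t' ▷ e2 ◁ t X
      ⊕ ⊖ (t' ∘ fmap Psi' (fmap F g) ▷ n1) ⊕ ⊖ (t' ▷ n2 ◁ fmap F (fmap Psi f))
      ⊕ l ◁ (fmap F (fmap Psi g) ∘ fmap F (fmap Psi f))
      ⊕ ⊖ (fmap_comp HF (fmap Psi g) (fmap Psi f))).
Qed.

Lemma map_rseq_iso (s s' : rseq Psi) :
  rseq_iso s s' -> rseq_iso (map_rseq t s) (map_rseq t s').
Proof.
move=> [a [b [c [ia [ib [ic [e1 [e2 e3]]]]]]]].
exists (fmap F a), (fmap F b), (fmap F c); rewrite /map_rseq /=.
split; first exact: functor_iso.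
split; first exact: functor_iso.
split; first exact: functor_iso.
have f1 := fmap_heq HF e1; have f2 := fmap_heq HF e2; have f3 := fmap_heq HF e3.
have n := proj1 Ht _ _ a; rewrite /fcomp /= in n.
split; first by lc (f1 ⊕ ⊖ (fmap_comp HF b (r1 s)) ⊕ fmap_comp HF (r1 s') a).
split; first by lc (f2 ⊕ ⊖ (fmap_comp HF c (r2 s)) ⊕ fmap_comp HF (r2 s') b).
lc (⊖ (n ◁ fmap F (r3 s)) ⊕ t (rA s') ▷ f3 ⊕ ⊖ (t (rA s') ▷ fmap_comp HF (fmap Psi a) (r3 s))
    ⊕ t (rA s') ▷ fmap_comp HF (r3 s') c).
Qed.

Lemma map_rseq_iso_reflect (s s' : rseq Psi) :
  rseq_iso (map_rseq t s) (map_rseq t s') -> rseq_iso s s'.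
Proof.
move=> [a0 [b0 [c0]]].
have [a ea] := full (X := rA s) (Y := rA s') a0; have [b eb] := full (X := rB s) (Y := rB s') b0.
have [c ec] := full (X := rC s) (Y := rC s') c0.
rewrite /map_rseq /=; move=> [ia [ib [ic [e1 [e2 e3]]]]].
have n := proj1 Ht _ _ a; rewrite /fcomp /= in n.
exists a, b, c.
split; first by apply: reflect_iso; apply: iso_heq (es ea) ia.
split; first by apply: reflect_iso; apply: iso_heq (es eb) ib.
split; first by apply: reflect_iso; apply: iso_heq (es ec) ic.
split; first by apply: faithful; lc (fmap_comp HF b (r1 s) ⊕ ⊖ (fmap_comp HF (r1 s') a)
  ⊕ eb ◁ fmap F (r1 s) ⊕ ⊖ (fmap F (r1 s') ▷ ea) ⊕ e1).
split; first by apply: faithful; lc (fmap_comp HF c (r2 s) ⊕ ⊖ (fmap_comp HF (r2 s') b)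
  ⊕ ec ◁ fmap F (r2 s) ⊕ ⊖ (fmap F (r2 s') ▷ eb) ⊕ e2).
apply: faithful; have [t' [l r]] := proj2 Ht (rA s'); rewrite /fcomp /= in t' l r.
have ea' := fmap_heq HPf ea.
have k : t (rA s') ∘ fmap F (fmap Psi a ∘ r3 s) ≈ t (rA s') ∘ fmap F (r3 s' ∘ c).
  lc (t (rA s') ▷ fmap_comp HF (fmap Psi a) (r3 s) ⊕ n ◁ fmap F (r3 s)
      ⊕ ea' ◁ (t (rA s) ∘ fmap F (r3 s)) ⊕ e3 ⊕ ⊖ ((t (rA s') ∘ fmap F (r3 s')) ▷ ec)
      ⊕ ⊖ (t (rA s') ▷ fmap_comp HF (r3 s') c)).
lc (⊖ (l ◁ fmap F (fmap Psi a ∘ r3 s)) ⊕ t' ▷ k ⊕ l ◁ fmap F (r3 s' ∘ c)).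
Qed.

Lemma transport_rt : right_triangulated ST Delta.
Proof.
have HA := transport_additive HAU; have HSp := add_preadditive HA.
have HP := transport_functor.
have tn := proj1 Ht; have ti := proj2 Ht; rewrite /natural /fcomp /= in tn ti.
have lift X Y (g : hom (F X) (Psi' (F Y))) : exists f : hom X (Psi Y), t Y ∘ fmap F f ≈ g.
  have [t' [l r]] := ti Y; have [f e] := full (t' ∘ g).
  by exists f; lc (t Y ▷ e ⊕ r ◁ g).
have refl X Y (f g : hom X (Psi Y)) : t Y ∘ fmap F f ≈ t Y ∘ fmap F g -> f ≈ g.
  move=> e; apply: faithful; have [t' [l r]] := ti Y.
  lc (⊖ (l ◁ fmap F f) ⊕ t' ▷ e ⊕ l ◁ fmap F g).
split=> //.
- split=> // X Y f g; apply: faithful; have [t' [l r]] := ti Y.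
  have n1 := tn _ _ f; have n2 := tn _ _ g; have n3 := tn _ _ (hadd ST f g).
  have e1 := fmap_heq HPf (Fadd f g); have e2 := proj2 (rt_functor RU) _ _ (fmap F f) (fmap F g).
  lc (⊖ (l ◁ fmap F (fmap Psi (hadd ST f g))) ⊕ t' ▷ n3 ⊕ t' ▷ e1 ◁ t X ⊕ t' ▷ e2 ◁ t X
      ⊕ ⊖ (t' ▷ n1) ⊕ ⊖ (t' ▷ n2) ⊕ l ◁ fmap F (fmap Psi f) ⊕ l ◁ fmap F (fmap Psi g)
      ⊕ ⊖ (Fadd (fmap Psi f) (fmap Psi g))).
- move=> s s' i /HD d; apply/HD; apply: (rt_iso RU) d; exact: map_rseq_iso.
- move=> A B f; have [C0 [g0 [h0 D]]] := rt1 RU (fmap F f).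
  have [C [c [c' [l r]]]] := surj C0.
  have [g eg] := full (c' ∘ g0); have [h eh] := lift _ _ (h0 ∘ c).
  exists C, g, h; apply/HD; apply: (rt_iso RU) D; rewrite /map_rseq /=.
  apply: (riso_intro (a := idm _) (b := idm _) (c := c')).
  + exact: iso_id.
  + exact: iso_id.
  + exact: iso_inv l r.
  + ncat.
  + lc (⊖ eg).
  + lc (fmap_id HPf (F A) ◁ h0 ⊕ ⊖ (h0 ▷ r) ⊕ ⊖ (eh ◁ c')).
- move=> O A zO; apply/HD; have D := rt1_id RU (F A) (preserve_zero HU zO).
  apply: (rt_iso RU) D; rewrite /map_rseq /=.
  apply: (riso_intro (a := idm _) (b := idm _) (c := idm _)); try exact: iso_id.
  + lc (⊖ (Fzero O A)).
  + lc (⊖ (fmap_id HF A)).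
  + lc (⊖ (t O ▷ Fzero A (Psi O))).
- move=> A B C f g h /HD D; apply/HD; apply: (rt_iso RU) (rt2 RU D); rewrite /map_rseq /=.
  apply: rseq_iso_sym; first exact: HPf.
  apply: (riso_intro (a := idm _) (b := idm _) (c := t A)); try exact: iso_id.
  + exact: ti.
  + ncat.
  + ncat.
  + have n := tn _ _ f.
    lc (fmap_id HPf (F B) ◁ (t B ∘ fmap F (hopp ST (fmap Psi f))) ⊕ t B ▷ Fopp (fmap Psi f)
        ⊕ ⊖ n).
- move=> A B C A' B' C' f g h f' g' h' a b /HD D /HD D' e.
  have e' : fmap F b ∘ fmap F f ≈ fmap F f' ∘ fmap F a.
    lc (fmap_heq HF e ⊕ ⊖ (fmap_comp HF b f) ⊕ fmap_comp HF f' a).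
  have [c0 [e1 e2]] := rt3 RU D D' e'; rewrite /map_rseq /= in e1 e2.
  have [c ec] := full (X := C) (Y := C') c0; exists c; split.
  + apply: faithful; lc (fmap_comp HF c g ⊕ ec ◁ fmap F g ⊕ e1 ⊕ ⊖ (fmap_comp HF g' b)).
  + have n := tn _ _ a; apply: refl.
    lc (t A' ▷ fmap_comp HF (fmap Psi a) h ⊕ n ◁ fmap F h ⊕ e2
        ⊕ ⊖ (t A' ▷ fmap_comp HF h' c) ⊕ ⊖ (t A' ∘ fmap F h' ▷ ec)).
- move=> A B C A' B' C' f l m g h j u v /HD D1 /HD D2 /HD D3.
  have D3' : Delta' (RSeq Psi' (fmap F g ∘ fmap F f) (fmap F u) (t A ∘ fmap F v)).
  { apply: (rt_iso RU) D3; rewrite /map_rseq /=.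
    apply: (riso_intro (a := idm _) (b := idm _) (c := idm _)); try exact: iso_id.
    * lc (fmap_comp HF g f).
    * ncat.
    * lc (fmap_id HPf (F A) ◁ (t A ∘ fmap F v)). }
  have [r0 [s0 [e1 [e2 [e3 [e4 D]]]]]] := rt4 RU D1 D2 D3'; simpl in r0, s0, e1, e2, e3, e4, D.
  have [r er_] := full (X := C') (Y := B') r0; have [s es_] := full (X := B') (Y := A') s0.
  exists r, s; split.
    apply: faithful.
    lc (fmap_comp HF r l ⊕ er_ ◁ fmap F l ⊕ e1 ⊕ ⊖ (fmap_comp HF u g)).
  split.
    by apply: refl; lc (t A ▷ fmap_comp HF v r ⊕ (t A ∘ fmap F v) ▷ er_ ⊕ e2).
  split.
    by apply: faithful; lc (fmap_comp HF s u ⊕ es_ ◁ fmap F u ⊕ e3).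
  split.
    have n := tn _ _ f; apply: refl.
    lc (t B ▷ fmap_comp HF j s ⊕ (t B ∘ fmap F j) ▷ es_ ⊕ e4
        ⊕ ⊖ (t B ▷ fmap_comp HF (fmap Psi f) v) ⊕ ⊖ (n ◁ fmap F v)).
  apply/HD; apply: (rt_iso RU) D; rewrite /map_rseq /=.
  apply: (riso_intro (a := idm _) (b := idm _) (c := idm _)); try exact: iso_id.
  + lc (⊖ er_).
  + lc (⊖ es_).
  + have n := tn _ _ l.
    lc (fmap_id HPf (F C') ◁ (fmap Psi' (fmap F l) ∘ (t B ∘ fmap F j))
        ⊕ ⊖ (t C' ▷ fmap_comp HF (fmap Psi l) j) ⊕ ⊖ (n ◁ fmap F j)).
Qed.
End Transport.

(** * Exact categories *)

Lemma op_laws (T : precat) : category_laws T -> category_laws (op T).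
Proof.
move=> H; split=> //=.
- move=> X Y; exact: (@heq_refl T H Y X).
- move=> X Y; exact: (@heq_sym T H Y X).
- move=> X Y; exact: (@heq_trans T H Y X).
- move=> X Y Z g g' f f' e1 e2; exact: (@comp_heq T H _ _ _ _ _ _ _ e2 e1).
- move=> X Y f; exact: (@comp_id_r T H _ _ f).
- move=> X Y f; exact: (@comp_id_l T H _ _ f).
- move=> X Y Z V h g f; exact: es (@comp_assoc T H _ _ _ _ f g h).
Qed.

Lemma op_preadditive (T : precat) (S : addstr T) : preadditive S -> preadditive (opS S).
Proof.
move=> H; split=> //=.
- exact: op_laws.
- move=> X Y; exact: (@hadd_heq T S H Y X).
- move=> X Y; exact: (@hopp_heq T S H Y X).
- move=> X Y; exact: (@hadd_assoc T S H Y X).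
- move=> X Y; exact: (@hadd_comm T S H Y X).
- move=> X Y; exact: (@hadd_zero T S H Y X).
- move=> X Y; exact: (@hadd_opp T S H Y X).
- move=> X Y Z g g' f; exact: (@comp_add_r T S H _ _ _ f g g').
- move=> X Y Z g f f'; exact: (@comp_add_l T S H _ _ _ f f' g).
Qed.

Definition op_biprod (T : precat) (S : addstr T) (X Y : T) (P : biprod S X Y) :
  @biprod (op T) (opS S) X Y :=
  @Build_biprod (op T) (opS S) X Y (bp P) (pr1 P) (pr2 P) (in1 P) (in2 P)
    (pr1_in1 P) (pr2_in2 P) (pr2_in1 P) (pr1_in2 P) (in_pr P).

Lemma op_is_zero (T : precat) (O : T) : is_zero O -> @is_zero (op T) O.
Proof. by case. Qed.

Lemma op_additive (T : precat) (S : addstr T) : additive S -> additive (opS S).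
Proof.
move=> [H [O zO] B]; split; first exact: op_preadditive.
- by exists O; apply: op_is_zero.
- move=> X Y; have [P] := B X Y; constructor; exact: op_biprod.
Qed.

Lemma op_exact (T : precat) (S : addstr T) (E : conf_class T) :
  exact_category S E -> exact_category (opS S) (opE E).
Proof.
move=> [H1 H2 H3 H4 H5]; split.
- exact: op_additive.
- move=> X Y Z i d /H2 [a b]; by split.
- move=> X Y Z X' Y' Z' i d i' d' a b c [a' [al ar]] [b' [bl br]] [c' [c_l c_r]] e1 e2 k.
  have HT : category_laws T := preadd_cat (add_preadditive H1).
  rewrite /opE /= in k *.
  refine (H3 _ _ _ _ _ _ d i d' i' c' b' a' _ _ _ _ _ k).
  + by exists c.
  + by exists b.
  + by exists a.
  + exact (@sq_inv T HT _ _ _ _ d' d c b c' b' c_l br (@es T HT _ _ _ _ e2)).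
  + exact (@sq_inv T HT _ _ _ _ i' i b a b' a' bl ar (@es T HT _ _ _ _ e1)).
- exact: H5.
- exact: H4.
Qed.

Lemma pullback_intro (T : precat) (X Y Z P : T) (f : hom Y X) (g : hom Z X) (u : hom P Y)
    (v : hom P Z) :
  f ∘ u ≈ g ∘ v ->
  (forall (V : T) (a : hom V Y) (b : hom V Z), f ∘ a ≈ g ∘ b ->
    exists w : hom V P, u ∘ w ≈ a /\ v ∘ w ≈ b /\
      forall w' : hom V P, u ∘ w' ≈ a -> v ∘ w' ≈ b -> w' ≈ w) ->
  @is_pushout (op T) X Y Z P f g u v.
Proof. by move=> e k; split; [exact: e | exact: k]. Qed.

Section Exact.
Context {T : precat} {S : addstr T} (E : conf_class T).
Hypothesis HE : exact_category S E.
Let HA : additive S := ex_additive HE.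
Let HS : preadditive S := add_preadditive HA.
#[local] Existing Instance HS.

Lemma conf_zero (X Y Z : T) (i : hom X Y) (d : hom Y Z) : E i d -> d ∘ i ≈ hzero S X Z.
Proof. by move=> /(ex_ker_coker HE) [_ []]. Qed.

Lemma conf_desc (X Y Z V : T) (i : hom X Y) (d : hom Y Z) (h : hom Y V) :
  E i d -> h ∘ i ≈ hzero S X V -> exists u : hom Z V, u ∘ d ≈ h.
Proof. by move=> /(ex_ker_coker HE) [_ [_ k]] e; have [u [? _]] := k _ _ e; exists u. Qed.

Lemma coker_epi (X Y Z V : T) (i : hom X Y) (d : hom Y Z) (u u' : hom Z V) :
  is_cokernel S i d -> u ∘ d ≈ u' ∘ d -> u ≈ u'.
Proof.
move=> [z k] e; have [|w [_ kw]] := k _ (u ∘ d); first by lc (u ▷ z).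
exact: et (kw _ (er _)) (es (kw _ (es e))).
Qed.

Lemma conf_epi (X Y Z V : T) (i : hom X Y) (d : hom Y Z) (u u' : hom Z V) :
  E i d -> u ∘ d ≈ u' ∘ d -> u ≈ u'.
Proof. by move=> /(ex_ker_coker HE) [_ k]; apply: (coker_epi k). Qed.

Lemma conf_lift (X Y Z V : T) (i : hom X Y) (d : hom Y Z) (h : hom V Y) :
  E i d -> d ∘ h ≈ hzero S V Z -> exists u : hom V X, i ∘ u ≈ h.
Proof. by move=> /(ex_ker_coker HE) [[_ k] _] e; have [u [? _]] := k _ _ e; exists u. Qed.

Lemma conf_mono (X Y Z V : T) (i : hom X Y) (d : hom Y Z) (u u' : hom V X) :
  E i d -> i ∘ u ≈ i ∘ u' -> u ≈ u'.
Proof.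
move=> c e; have /(ex_ker_coker HE) [[_ k] _] := c.
have z : d ∘ (i ∘ u) ≈ hzero S V Z by lc (conf_zero c ◁ u).
have [w [_ kw]] := k V (i ∘ u : @hom T V Y) z.
exact (@et T _ _ _ _ _ _ (kw u (@er T _ _ _ (i ∘ u)))
  (@es T _ _ _ _ _ (kw u' (@es T _ _ _ _ _ e)))).
Qed.

Lemma coker_iso (X Y Z Z' : T) (i : hom X Y) (d : hom Y Z) (d' : hom Y Z') :
  is_cokernel S i d -> is_cokernel S i d' -> exists c : hom Z Z', is_iso c /\ c ∘ d ≈ d'.
Proof.
move=> k k'; have [u [eu _]] := proj2 k _ _ (proj1 k').
have [v [ev _]] := proj2 k' _ _ (proj1 k); exists u; split => //; exists v; split.
- apply: (coker_epi k); lc (v ▷ eu ⊕ ev).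
- apply: (coker_epi k'); lc (u ▷ ev ⊕ eu).
Qed.

Lemma conf_coker (X Y Z Z' : T) (i : hom X Y) (d : hom Y Z) (d' : hom Y Z') :
  E i d -> is_cokernel S i d' -> E i d'.
Proof.
move=> c k'; have [_ k] := ex_ker_coker HE c; have [u [iu eu]] := coker_iso k k'.
by apply: (ex_iso HE _ _ _ _ _ c); [exact: iso_id | exact: iso_id | exact: iu | ncat | lc eu].
Qed.

Lemma conf_heq (X Y Z : T) (i i' : hom X Y) (d d' : hom Y Z) : i ≈ i' -> d ≈ d' -> E i d -> E i' d'.
Proof.
move=> e e' c.
by apply: (ex_iso HE _ _ _ _ _ c); [exact: iso_id | exact: iso_id | exact: iso_id | lc e | lc e'].
Qed.

Lemma coker_is_conf (X Y Z : T) (i : hom X Y) (d : hom Y Z) :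
  inflation E i -> is_cokernel S i d -> E i d.
Proof. by move=> [Z' [d' c]]; apply: conf_coker c. Qed.

Lemma pushout_iso (X Y Z P P' : T) (f : hom X Y) (g : hom X Z) (u : hom Y P) (v : hom Z P)
    (u' : hom Y P') (v' : hom Z P') :
  is_pushout f g u v -> is_pushout f g u' v' ->
  exists w : hom P P', is_iso w /\ w ∘ u ≈ u' /\ w ∘ v ≈ v'.
Proof.
move=> [e k] [e' k']; have [w [w1 [w2 _]]] := k _ _ _ e'; have [w' [w1' [w2' _]]] := k' _ _ _ e.
exists w; split => //; exists w'; split.
- have [z [_ [_ kz]]] := k _ _ _ e; apply: et (kz _ _ _) (es (kz _ _ _)).
  + lc (w' ▷ w1 ⊕ w1').
  + lc (w' ▷ w2 ⊕ w2').
  + ncat.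
  + ncat.
- have [z [_ [_ kz]]] := k' _ _ _ e'; apply: et (kz _ _ _) (es (kz _ _ _)).
  + lc (w ▷ w1' ⊕ w1).
  + lc (w ▷ w2' ⊕ w2).
  + ncat.
  + ncat.
Qed.

Lemma pushout_epi (X Y Z P V : T) (f : hom X Y) (g : hom X Z) (u : hom Y P) (v : hom Z P)
    (w w' : hom P V) :
  is_pushout f g u v -> w ∘ u ≈ w' ∘ u -> w ∘ v ≈ w' ∘ v -> w ≈ w'.
Proof.
move=> [e k] e1 e2; have [|z [_ [_ kz]]] := k _ (w ∘ u) (w ∘ v); first by lc (w ▷ e).
exact: et (kz _ (er _) (er _)) (es (kz _ (es e1) (es e2))).
Qed.

Lemma pushout_sym (X Y Z P : T) (f : hom X Y) (g : hom X Z) (u : hom Y P) (v : hom Z P) :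
  is_pushout f g u v -> is_pushout g f v u.
Proof.
move=> [e k]; split; first exact: es.
by move=> V a b /es e'; have [w [? [? kw]]] := k _ _ _ e'; exists w; do 2!split=> //;
  move=> w' ? ?; apply: kw.
Qed.

(** The maps [d] and zero induce [d'] on the pushout, and it is a cokernel of [i']. That [i'] is an
    inflation is carried over from the pushout supplied by the axiom. *)
Lemma pushout_conf (X Y Z X' Y' : T) (i : hom X Y) (d : hom Y Z) (f : hom X X') (f' : hom Y Y')
    (i' : hom X' Y') :
  E i d -> is_pushout i f f' i' -> exists d' : hom Y' Z, E i' d' /\ d' ∘ f' ≈ d.
Proof.
move=> c po; have z := conf_zero c.
have [d' [d1 [d2 _]]] : exists w : hom Y' Z, w ∘ f' ≈ d /\ w ∘ i' ≈ hzero S _ _ /\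
    forall w' : hom Y' Z, w' ∘ f' ≈ d -> w' ∘ i' ≈ hzero S _ _ -> w' ≈ w.
  by apply: (proj2 po); lc z.
exists d'; split => //; apply: coker_is_conf; last first.
  split=> // V h e; have [|u eu] := conf_desc (h := h ∘ f') c.
    by lc (h ▷ proj1 po ⊕ e ◁ f).
  exists u; split.
    apply: (pushout_epi po); [lc (u ▷ d1 ⊕ eu) | lc (u ▷ d2 ⊕ ⊖ e)].
  by move=> u' eu'; apply: (conf_epi c); lc (⊖ (u' ▷ d1) ⊕ eu' ◁ f' ⊕ ⊖ eu).
have [Y1 [f1 [i1 [po1 [Z1 [e1 c1]]]]]] :=
  infl_pushout (ex_infl HE) f (ex_intro _ Z (ex_intro _ d c)).
have [w [iw [w1 w2]]] := pushout_iso po1 po.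
have [w' [wl wr]] := iw.
exists Z1, (e1 ∘ w'); apply: (ex_iso HE (iso_id _) iw (iso_id _) _ _ c1).
- lc w2.
- lc (⊖ (e1 ▷ wl)).
Qed.

Lemma push (X Y Z X' : T) (i : hom X Y) (d : hom Y Z) (f : hom X X') :
  E i d -> exists Y' (f' : hom Y Y') (i' : hom X' Y') (d' : hom Y' Z),
    is_pushout i f f' i' /\ E i' d' /\ d' ∘ f' ≈ d.
Proof.
move=> c; have [Y1 [f1 [i1 [po1 _]]]] :=
  infl_pushout (ex_infl HE) f (ex_intro _ Z (ex_intro _ d c)).
have [d' [c' e']] := pushout_conf c po1; by exists Y1, f1, i1, d'.
Qed.

(** With [D = Y/X], [P = Z/X] and [G = Z/Y], the square formed by [g], [l], [u], [r] is a pushout,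
    so [r] is an inflation with the cokernel of [g]. *)
Lemma noether_given (X Y Z D P G : T) (f : hom X Y) (l : hom Y D) (g : hom Y Z) (h : hom Z G)
    (u : hom Z P) :
  E f l -> E g h -> E (g ∘ f) u ->
  exists (r : hom D P) (s : hom P G), E r s /\ r ∘ l ≈ u ∘ g /\ s ∘ u ≈ h.
Proof.
move=> cf cg cu.
have [|r er_] := conf_desc (h := u ∘ g) cf; first by lc (conf_zero cu).
have po : is_pushout g l u r.
  split; first by lc (⊖ er_).
  move=> V a b e; have [|w ew] := conf_desc (h := a) cu.
    by lc (e ◁ f ⊕ b ▷ conf_zero cf).
  exists w; split => //; split.
    by apply: (conf_epi cf); lc (w ▷ er_ ⊕ ew ◁ g ⊕ e).
  by move=> w' e1 e2; apply: (conf_epi cu); lc (e1 ⊕ ⊖ ew).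
have [s [cs es_]] := pushout_conf cg po.
by exists r, s.
Qed.

Lemma noether (X Y Z D G : T) (f : hom X Y) (l : hom Y D) (g : hom Y Z) (h : hom Z G) :
  E f l -> E g h -> exists P (u : hom Z P) (r : hom D P) (s : hom P G),
    E (g ∘ f) u /\ E r s /\ r ∘ l ≈ u ∘ g /\ s ∘ u ≈ h.
Proof.
move=> cf cg.
have [P [u cu]] : inflation E (g ∘ f).
  by apply: (infl_comp (ex_infl HE)); [exists D, l | exists G, h].
by have [r [s [? [? ?]]]] := noether_given cf cg cu; exists P, u, r, s.
Qed.

Lemma split_retraction (X Y Z : T) (i : hom X Y) (d : hom Y Z) (s : hom Z Y) :
  E i d -> d ∘ s ≈ idm Z -> exists r : hom Y X, r ∘ i ≈ idm X /\
    r ∘ s ≈ hzero S _ _ /\ hadd S (i ∘ r) (s ∘ d) ≈ idm Y.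
Proof.
move=> c e; have [|r er_] := conf_lift (h := hadd S (idm Y) (hopp S (s ∘ d))) c.
  by lc (⊖ (e ◁ d)).
exists r; split; first by apply: (conf_mono c); lc (er_ ◁ i ⊕ ⊖ (s ▷ conf_zero c)).
split; first by apply: (conf_mono c); lc (er_ ◁ s ⊕ ⊖ (s ▷ e)).
lc er_.
Qed.

Lemma conf_of_zero (O X : T) : is_zero O -> E (idm X) (hzero S X O).
Proof.
move=> zO; apply: coker_is_conf; first exact: infl_id (ex_infl HE) X.
split; first ncat.
move=> V h e; exists (hzero S O V); split; first by lc (⊖ e).
by move=> u _; apply: (proj1 zO).
Qed.
End Exact.

Lemma conf_of_zero' (T : precat) (S : addstr T) (E : conf_class T) O X :
  exact_category S E -> is_zero O -> E _ _ _ (hzero S O X) (idm X).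
Proof. by move=> HE zO; apply: (conf_of_zero (op_exact HE) X (op_is_zero zO)). Qed.

(** * Extension and lifting of maps from vanishing of Ext *)

Section Ext.
Context {T : precat} {S : addstr T} (E : conf_class T).
Hypothesis HE : exact_category S E.
Let HA : additive S := ex_additive HE.
Let HS : preadditive S := add_preadditive HA.
#[local] Existing Instance HS.

(** The pushout of the conflation along [h] splits, and a retraction of it gives the extension. *)
Lemma ext_extend (X Y Z V : T) (i : hom X Y) (d : hom Y Z) (h : hom X V) :
  ext_zero E Z V -> E i d -> exists h' : hom Y V, h' ∘ i ≈ h.
Proof.
move=> ez c; have [Y' [f' [i' [d' [[po _] [c' e]]]]]] := push HE h c.
have [s es_] := ez _ _ _ c'; have [r [r1 [r2 r3]]] := split_retraction HE c' es_.
by exists (r ∘ f'); lc (r ▷ po ⊕ r1 ◁ h).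
Qed.

Lemma ext_zero_op (X Y : T) : ext_zero E X Y <-> @ext_zero (op T) (opE E) Y X.
Proof.
split=> h B i d c.
- have [s es_] := h B d i c; have [r [r1 _]] := split_retraction HE c es_; by exists r.
- have [r er_] := h B d i c.
  have [s [s1 _]] := split_retraction (op_exact HE) (c : opE E d i) er_; by exists s.
Qed.
End Ext.

Section Lifting.
Context {T : precat} {S : addstr T} (E : conf_class T).
Hypothesis HE : exact_category S E.
Let HA : additive S := ex_additive HE.
Let HS : preadditive S := add_preadditive HA.
#[local] Existing Instance HS.

Lemma ext_lift (X Y Z V : T) (i : hom X Y) (d : hom Y Z) (h : hom V Z) :
  ext_zero E V X -> E i d -> exists h' : hom V Y, d ∘ h' ≈ h.
Proof.
move=> /(ext_zero_op HE) ez c.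
exact: (ext_extend (op_exact HE) (i := d : @hom (op T) Z Y) (h : @hom (op T) Z V) ez c).
Qed.

Lemma noether_ker (N U V Z K : T) (n : hom N U) (p : hom U V) (k : hom K V) (q : hom V Z) :
  E n p -> E k q -> exists P (m : hom P U) (n' : hom N P) (p' : hom P K),
    E m (q ∘ p) /\ E n' p' /\ m ∘ n' ≈ n /\ k ∘ p' ≈ p ∘ m.
Proof.
move=> c1 c2.
have [P [m [p' [n' [H1 [H2 [H3 H4]]]]]]] :=
  noether (op_exact HE) (f := q : @hom (op T) Z V) (l := k : @hom (op T) V K)
    (g := p : @hom (op T) V U) (h := n : @hom (op T) U N) c2 c1.
by exists P, m, n', p'.
Qed.

Lemma pull (N U V Y : T) (n : hom N U) (p : hom U V) (b : hom Y V) : E n p ->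
  exists U' (b' : hom U' U) (p' : hom U' Y) (n' : hom N U'),
    @is_pushout (op T) V U Y U' p b b' p' /\ E n' p' /\ b' ∘ n' ≈ n.
Proof.
move=> c.
exact: (push (op_exact HE) (i := p : @hom (op T) V U) (d := n : @hom (op T) U N)
  (b : @hom (op T) V Y) c).
Qed.

(** After pulling [p] back along [b], one needs a section of [p'] that extends the partial section
    [s] over [X]. On the preimage [P] of [X] the section [s] has a complementary retraction onto
    [N]; it extends to [rho] on [U'] because its obstruction lies in Ext of [Z] by [N], and
    [1 - n' rho] descends to the section. *)
Lemma lifting (X Y Z N U V : T) (i : hom X Y) (d : hom Y Z) (n : hom N U) (p : hom U V)
    (a : hom X U) (b : hom Y V) :
  E i d -> E n p -> ext_zero E Z N -> p ∘ a ≈ b ∘ i ->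
  exists t : hom Y U, t ∘ i ≈ a /\ p ∘ t ≈ b.
Proof.
move=> ci cp ez e.
have [U' [b' [p' [n' [[po1 po2] [c' e']]]]]] := pull b cp.
have [s [s1 [s2 _]]] := po2 _ (a : @hom (op T) U X) (i : @hom (op T) Y X) e.
rewrite /= in po1 s s1 s2.
have [P [m [n'' [q [c1 [c2 [e1 e2]]]]]]] := noether_ker c' ci.
have [|s0 es0] := conf_lift HE (h := s) c1; first by lc (d ▷ s2 ⊕ conf_zero HE ci).
have qs : q ∘ s0 ≈ idm X.
  by apply: (conf_mono HE ci); lc (e2 ◁ s0 ⊕ p' ▷ es0 ⊕ s2).
have [r [r1 [r2 r3]]] := split_retraction HE c2 qs.
have [rho erho] := ext_extend HE r ez c1.
have rn : rho ∘ n' ≈ idm _ by lc (⊖ (rho ▷ e1) ⊕ erho ◁ n'' ⊕ r1).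
have [|t0 et0] := conf_desc HE (h := hadd S (idm _) (hopp S (n' ∘ rho))) c'.
  by lc (⊖ (n' ▷ rn)).
have pt : p' ∘ t0 ≈ idm _.
  by apply: (conf_epi HE c'); lc (p' ▷ et0 ⊕ ⊖ (conf_zero HE c' ◁ rho)).
have ti : t0 ∘ i ≈ s.
  lc (⊖ (t0 ▷ s2) ⊕ et0 ◁ s ⊕ (n' ∘ rho) ▷ es0 ⊕ ⊖ (n' ▷ erho ◁ s0) ⊕ ⊖ (n' ▷ r2)).
exists (b' ∘ t0); split.
- by lc (b' ▷ ti ⊕ s1).
- by lc (po1 ◁ t0 ⊕ b ▷ pt).
Qed.

Lemma ext_extension (X Y Z V : T) (i : hom X Y) (d : hom Y Z) :
  E i d -> ext_zero E X V -> ext_zero E Z V -> ext_zero E Y V.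
Proof.
move=> c x z B j q cq.
have [s es_] := ext_lift i x cq.
have [|t [_ t2]] := lifting (a := s) (b := idm Y) c cq z; first by lc es_.
by exists t.
Qed.

Lemma ext_zero_iso (X X' V : T) (f : hom X X') : is_iso f -> ext_zero E X V -> ext_zero E X' V.
Proof.
move=> [g [l r]] x B j q cq.
have [|s es_] := x B j (g ∘ q).
{ apply: (ex_iso HE (iso_id _) (iso_id _) _ _ _ cq).
  - by exists f; split; [exact: r | exact: l].
  - ncat.
  - ncat. }
by exists (s ∘ g); lc (⊖ (r ◁ (q ∘ s ∘ g)) ⊕ f ▷ es_ ◁ g ⊕ r).
Qed.

(** * Conflations built from direct sums *)

Section Wic.
Hypothesis hwic : weakly_idempotent_complete E.

Lemma biprod_conf (X Y : T) (P : biprod S X Y) : E (in1 P) (pr2 P).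
Proof.
apply: (coker_is_conf HE); first exact: hwic (pr1_in1 P).
split; first exact: pr2_in1.
move=> V h e; exists (h ∘ in2 P); split.
- lc (h ▷ in_pr P ⊕ ⊖ (e ◁ pr1 P)).
- move=> u' e'; lc (e' ◁ in2 P ⊕ ⊖ (u' ▷ pr2_in2 P)).
Qed.

Definition swap X Y (P : biprod S X Y) : biprod S Y X.
Proof.
apply: (@Build_biprod T S Y X (bp P) (in2 P) (in1 P) (pr2 P) (pr1 P)).
- exact: pr2_in2.
- exact: pr1_in1.
- exact: pr2_in1.
- exact: pr1_in2.
- lc (in_pr P).
Defined.

Lemma biprod_conf' (X Y : T) (P : biprod S X Y) : E (in2 P) (pr1 P).
Proof. exact: biprod_conf (swap P). Qed.

Lemma split_conf (X Y Z : T) (i : hom X Y) (d : hom Y Z) (s : hom Z Y) :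
  E i d -> d ∘ s ≈ idm Z -> exists r : hom Y X, r ∘ i ≈ idm X /\ E s r.
Proof.
move=> c e; have [r [r1 [r2 r3]]] := split_retraction HE c e.
set P := @Build_biprod T S X Z Y i s r d r1 e r2 (conf_zero HE c) r3.
exists r; split=> //; exact: (biprod_conf' P).
Qed.

(** The first map is the split monomorphism [(f, 1) : X -> X' ⊕ X], an inflation by weak idempotent
    completeness, followed by [1 ⊕ i], which is a pushout of [i]. *)
Lemma pushout_biprod_conf (X Y Z X' Y' : T) (i : hom X Y) (d : hom Y Z) (f : hom X X')
    (f' : hom Y Y') (i' : hom X' Y') (P : biprod S X' Y) :
  E i d -> is_pushout i f f' i' ->
  E (hadd S (in1 P ∘ f) (in2 P ∘ i)) (hadd S (i' ∘ pr1 P) (hopp S (f' ∘ pr2 P))).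
Proof.
move=> c po; apply: (coker_is_conf HE).
  have [Q] := add_biprod HA X' X.
  pose k := hadd S (in1 P ∘ pr1 Q) (in2 P ∘ i ∘ pr2 Q).
  have po' : is_pushout i (in2 Q) (in2 P) k.
    split; first by rewrite /k; lc (⊖ (in2 P ∘ i ▷ pr2_in2 Q) ⊕ ⊖ (in1 P ▷ pr1_in2 Q)).
    move=> V a b e; exists (hadd S (a ∘ pr2 P) (b ∘ in1 Q ∘ pr1 P)); split.
      by lc (a ▷ pr2_in2 P ⊕ (b ∘ in1 Q) ▷ pr1_in2 P).
    split.
      rewrite /k; lc (a ▷ pr2_in1 P ◁ pr1 Q ⊕ a ▷ pr2_in2 P ◁ (i ∘ pr2 Q)
        ⊕ (b ∘ in1 Q) ▷ pr1_in1 P ◁ pr1 Q ⊕ (b ∘ in1 Q) ▷ pr1_in2 P ◁ (i ∘ pr2 Q)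
        ⊕ e ◁ pr2 Q ⊕ b ▷ in_pr Q).
    move=> w e1 e2.
    have e3 : w ∘ in1 P ≈ b ∘ in1 Q.
      rewrite /k in e2; lc (e2 ◁ in1 Q ⊕ ⊖ ((w ∘ in1 P) ▷ pr1_in1 Q)
        ⊕ ⊖ ((w ∘ in2 P ∘ i) ▷ pr2_in1 Q)).
    lc (⊖ (w ▷ in_pr P) ⊕ e3 ◁ pr1 P ⊕ e1 ◁ pr2 P).
  have [d' [ck _]] := pushout_conf HE c po'.
  have ij : inflation E (hadd S (in1 Q ∘ f) (in2 Q)).
    by apply: (hwic (r := pr2 Q)); lc (pr2_in1 Q ◁ f ⊕ pr2_in2 Q).
  have [Z1 [q cq]] := infl_comp (ex_infl HE) ij (ex_intro _ _ (ex_intro _ _ ck)).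
  exists Z1, q; apply: (conf_heq HE _ (er _) cq); rewrite /k.
  lc (in1 P ▷ pr1_in1 Q ◁ f ⊕ in1 P ▷ pr1_in2 Q ⊕ (in2 P ∘ i) ▷ pr2_in1 Q ◁ f
      ⊕ (in2 P ∘ i) ▷ pr2_in2 Q).
split.
  lc (i' ▷ pr1_in1 P ◁ f ⊕ i' ▷ pr1_in2 P ◁ i ⊕ ⊖ (f' ▷ pr2_in1 P ◁ f)
      ⊕ ⊖ (f' ▷ pr2_in2 P ◁ i) ⊕ ⊖ (proj1 po)).
move=> V h e.
have [|w [w1 [w2 kw]]] := proj2 po _ (hopp S (h ∘ in2 P)) (h ∘ in1 P).
  by lc (⊖ e).
exists w; split; first by lc (w2 ◁ pr1 P ⊕ ⊖ (w1 ◁ pr2 P) ⊕ h ▷ in_pr P).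
move=> w' e'; apply: kw.
- lc (⊖ (e' ◁ in2 P) ⊕ (w' ∘ i') ▷ pr1_in2 P ⊕ ⊖ ((w' ∘ f') ▷ pr2_in2 P)).
- lc (e' ◁ in1 P ⊕ ⊖ ((w' ∘ i') ▷ pr1_in1 P) ⊕ (w' ∘ f') ▷ pr2_in1 P).
Qed.

(** Since [i] extends along [f] to [delta], the pushout of [i] along [f] is the direct sum [D ⊕ J].
    This is the conflation behind the rotation of a triangle. *)
Lemma bicartesian_conf (A B D J U : T) (f : hom A B) (g : hom B D) (i : hom A J) (p : hom J U)
    (delta : hom B J) (xi : hom D U) (P : biprod S D J) :
  E f g -> E i p -> delta ∘ f ≈ i -> xi ∘ g ≈ p ∘ delta ->
  E (hadd S (in1 P ∘ g) (in2 P ∘ delta)) (hadd S (p ∘ pr2 P) (hopp S (xi ∘ pr1 P))).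
Proof.
move=> cf ci e1 e2.
have po : is_pushout i f (in2 P) (hadd S (in1 P ∘ g) (in2 P ∘ delta)).
  split; first by lc (⊖ (in1 P ▷ conf_zero HE cf) ⊕ ⊖ (in2 P ▷ e1)).
  move=> V a b e.
  have [|c ec] := conf_desc HE (h := hadd S b (hopp S (a ∘ delta))) cf.
    by lc (⊖ e ⊕ ⊖ (a ▷ e1)).
  exists (hadd S (c ∘ pr1 P) (a ∘ pr2 P)); split; first by lc (c ▷ pr1_in2 P ⊕ a ▷ pr2_in2 P).
  split.
    lc (c ▷ pr1_in1 P ◁ g ⊕ c ▷ pr1_in2 P ◁ delta ⊕ a ▷ pr2_in1 P ◁ g ⊕ a ▷ pr2_in2 P ◁ delta
        ⊕ ec).
  move=> w w1 w2.
  have w3 : w ∘ in1 P ≈ c by apply: (conf_epi HE cf); lc (w2 ⊕ ⊖ (w1 ◁ delta) ⊕ ⊖ ec).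
  lc (⊖ (w ▷ in_pr P) ⊕ w3 ◁ pr1 P ⊕ w1 ◁ pr2 P).
have [d' [cd ed]] := pushout_conf HE ci po.
apply: (conf_heq HE (er _) _ cd).
have e3 : d' ∘ in1 P ≈ hopp S xi.
  by apply: (conf_epi HE cf); lc (conf_zero HE cd ⊕ ⊖ (ed ◁ delta) ⊕ e2).
lc (⊖ (d' ▷ in_pr P) ⊕ e3 ◁ pr1 P ⊕ ed ◁ pr2 P).
Qed.
End Wic.
End Lifting.

(** The cokernel [c] of the section [r] is split by the map [m] induced by [1 - r i]. This exhibits
    [Y] as a direct sum with [i] as a projection, so weak idempotent completeness is self-dual. *)
Lemma split_epi_conf (T : precat) (S : addstr T) (E : conf_class T) (X Y : T)
    (i : hom Y X) (r : hom X Y) :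
  exact_category S E -> weakly_idempotent_complete E -> i ∘ r ≈ idm X ->
  exists (Z : T) (m : hom Z Y), E _ _ _ m i.
Proof.
move=> HE hw e.
have HS := add_preadditive (ex_additive HE).
have [Z [c cc]] := hw _ _ r i e.
have [|m em] := conf_desc HE (h := hadd S (idm _) (hopp S (r ∘ i))) cc.
  by lc (⊖ (r ▷ e)).
have cm : c ∘ m ≈ idm Z.
  by apply: (conf_epi HE cc); lc (c ▷ em ⊕ ⊖ (conf_zero HE cc ◁ i)).
have [k [k1 [k2 k3]]] := split_retraction HE cc cm.
have [r' [r1 cr_]] := split_conf HE hw cc cm.
have e' : r' ≈ i.
  have im : i ∘ m ≈ hzero S _ _.
    by apply: (conf_epi HE cc); lc (i ▷ em ⊕ ⊖ (e ◁ i)).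
  lc (⊖ (r' ▷ k3) ⊕ r1 ◁ k ⊕ conf_zero HE cr_ ◁ c ⊕ ⊖ (e ◁ k) ⊕ ⊖ (im ◁ c) ⊕ i ▷ k3).
by exists Z, m; apply: (conf_heq HE (er _) e' cr_).
Qed.

Lemma op_wic (T : precat) (S : addstr T) (E : conf_class T) :
  exact_category S E -> weakly_idempotent_complete E ->
  weakly_idempotent_complete (opE E).
Proof. move=> HE hw X Y i r e; exact: (split_epi_conf HE hw e). Qed.

Section SumConf.
Context {T : precat} {S : addstr T} (E : conf_class T).
Hypothesis HE : exact_category S E.
Let HS : preadditive S := add_preadditive (ex_additive HE).
#[local] Existing Instance HS.

(** The map [f ⊕ 1] is the pushout of [f] along the inclusion of [A]. *)
Lemma sum_inflation (A B D V : T) (f : hom A B) (g : hom B D) (P : biprod S A V)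
    (Q : biprod S B V) :
  E f g -> inflation E (hadd S (in1 Q ∘ f ∘ pr1 P) (in2 Q ∘ pr2 P)).
Proof.
move=> c; have [|d [cd _]] := pushout_conf HE c (X' := P) (f := in1 P) (f' := in1 Q)
    (i' := hadd S (in1 Q ∘ f ∘ pr1 P) (in2 Q ∘ pr2 P)).
{ split; first by lc (⊖ ((in1 Q ∘ f) ▷ pr1_in1 P) ⊕ ⊖ (in2 Q ▷ pr2_in1 P)).
  move=> Y a b e; exists (hadd S (a ∘ pr1 Q) (b ∘ in2 P ∘ pr2 Q)); split.
    lc (a ▷ pr1_in1 Q ⊕ (b ∘ in2 P) ▷ pr2_in1 Q).
  split.
    lc (a ▷ pr1_in1 Q ◁ (f ∘ pr1 P) ⊕ a ▷ pr1_in2 Q ◁ pr2 P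
       ⊕ (b ∘ in2 P) ▷ pr2_in1 Q ◁ (f ∘ pr1 P) ⊕ (b ∘ in2 P) ▷ pr2_in2 Q ◁ pr2 P
       ⊕ e ◁ pr1 P ⊕ b ▷ in_pr P).
  move=> w w1 w2.
  lc (⊖ (w ▷ in_pr Q) ⊕ w1 ◁ pr1 Q ⊕ w2 ◁ (in2 P ∘ pr2 Q) ⊕ ⊖ ((w ∘ in1 Q ∘ f) ▷ pr1_in2 P ◁ pr2 Q)
      ⊕ ⊖ ((w ∘ in2 Q) ▷ pr2_in2 P ◁ pr2 Q)). }
by exists D, d.
Qed.

(** Writes [f ⊕ f] as the composite of [f ⊕ 1] and [1 ⊕ f]. *)
Lemma double_inflation (A B D : T) (f : hom A B) (g : hom B D) (P : biprod S A A)
    (Q : biprod S B B) :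
  E f g -> inflation E (copair P (in1 Q ∘ f) (in2 Q ∘ f)).
Proof.
move=> c; have [R] := add_biprod (ex_additive HE) B A.
have [D1 [d1 c1]] := sum_inflation P R c.
have [D2 [d2 c2]] := sum_inflation (swap HE R) (swap HE Q) c.
have [V [d c3]] := infl_comp (ex_infl HE) (ex_intro _ D1 (ex_intro _ d1 c1))
  (ex_intro _ D2 (ex_intro _ d2 c2)).
exists V, d; apply: (conf_heq HE _ (er _) c3); rewrite /swap /=.
lc ((in2 Q ∘ f) ▷ pr2_in1 R ◁ (f ∘ pr1 P) ⊕ (in2 Q ∘ f) ▷ pr2_in2 R ◁ pr2 P
   ⊕ in1 Q ▷ pr1_in1 R ◁ (f ∘ pr1 P) ⊕ in1 Q ▷ pr1_in2 R ◁ pr2 P).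
Qed.
End SumConf.

(** * Hovey triples and stable maps *)

(* A Hovey triple in a self-dual form: the record for [(C, W, F)] in [T] is the record
   for [(F, W, C)] in [op T]. *)
Record hovey_setup (T : precat) (S : addstr T) (E : conf_class T) (C W F X CF : T -> Prop)
    (sim : rel_class T) : Prop := {
  hs_exact : exact_category S E;
  hs_wic : weakly_idempotent_complete E;
  hs_thick : thick S E W;
  hs_ext : forall A B, C A -> F B -> W A \/ W B -> ext_zero E A B;
  hs_C : forall A, (forall B, W B -> F B -> ext_zero E A B) -> C A;
  hs_F : forall B, (forall A, C A -> W A -> ext_zero E A B) -> F B;
  hs_cof_repl : forall A, exists (N Q : T) (i : hom N Q) (d : hom Q A),
    E _ _ _ i d /\ W N /\ F N /\ C Q;
  hs_fib_repl : forall A, exists (V Q : T) (d : hom Q V) (i : hom A Q),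
    E _ _ _ i d /\ W V /\ C V /\ F Q;
  hs_cof_triv : forall A, exists (N Q : T) (i : hom N Q) (d : hom Q A),
    E _ _ _ i d /\ W Q /\ C Q /\ F N;
  hs_fib_triv : forall A, exists (V Q : T) (d : hom Q V) (i : hom A Q),
    E _ _ _ i d /\ W Q /\ F Q /\ C V;
  hs_X : forall A, X A <-> C A /\ W A /\ F A;
  hs_CF : forall A, CF A <-> C A /\ F A;
  hs_sim : forall A B (f g : hom A B), sim _ _ f g <-> stable_eq S X f g }.

Lemma hovey_setup_op (T : precat) (S : addstr T) (E : conf_class T) (C W F X CF : T -> Prop)
    (sim : rel_class T) : hovey_setup S E C W F X CF sim ->
  hovey_setup (opS S) (opE E) F W C X CF (op_rel sim).
Proof.
move=> H; have HE := hs_exact H; split.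
- exact: op_exact.
- exact: (op_wic HE (hs_wic H)).
- have [t1 t2] := hs_thick H; split.
  + by move=> X0 Y P; apply: (t1 X0 Y (op_biprod P)).
  + move=> X0 Y Z i d c; have [a [b c']] := t2 Z Y X0 d i c; split; first by move=> ? ?; apply: c'.
    by split=> ? ?; [apply: b | apply: a].
- move=> A B fA cB w; apply/(ext_zero_op HE); apply: (hs_ext H) => //; by case: w; [right|left].
- by move=> A k; apply: (hs_F H) => B c w; apply/(ext_zero_op HE); apply: k.
- by move=> A k; apply: (hs_C H) => B w f; apply/(ext_zero_op HE); apply: k.
- exact: (hs_fib_repl H).
- exact: (hs_cof_repl H).
- exact: (hs_fib_triv H).
- exact: (hs_cof_triv H).
- by move=> A; split=> [/(hs_X H) [? [? ?]]|[? [? ?]]]; [|apply/(hs_X H)].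
- by move=> A; split=> [/(hs_CF H) [? ?]|[? ?]]; [|apply/(hs_CF H)].
- move=> A B f g; split.
  + by move=> /(hs_sim H) [Y [u [v [? ?]]]]; exists Y, v, u.
  + by move=> [Y [u [v [? ?]]]]; apply/(hs_sim H); exists Y, v, u.
Qed.

Section CotorsionClasses.
Context {T : precat} {S : addstr T} {E : conf_class T} {C W F X CF : T -> Prop}.
Context {sim : rel_class T}.
Hypothesis H : hovey_setup S E C W F X CF sim.
Let HE : exact_category S E := hs_exact H.
Let HA : additive S := ex_additive HE.
Let HS : preadditive S := add_preadditive HA.
#[local] Existing Instance HS.

Notation "0" := (hzero S _ _).

Lemma C_ext (A B D : T) (f : hom A B) (g : hom B D) : E f g -> C A -> C D -> C B.
Proof.
move=> c cA cD; apply: (hs_C H) => Y wY fY.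
by apply: (ext_extension HE c); apply: (hs_ext H) => //; right.
Qed.

Lemma C_iso (A B : T) (f : hom A B) : is_iso f -> C A -> C B.
Proof.
move=> i cA; apply: (hs_C H) => Y wY fY; apply: (ext_zero_iso HE i).
by apply: (hs_ext H) => //; right.
Qed.

Lemma C_zero (O : T) : is_zero O -> C O.
Proof.
move=> zO; apply: (hs_C H) => Y _ _ B i d _; exists (hzero S O B); apply: (proj1 zO).
Qed.

Lemma W_zero (O : T) : is_zero O -> W O.
Proof.
move=> zO; have [N [Q [i [d [_ [wN _]]]]]] := hs_cof_repl H O.
have z A (f g : hom O A) : f ≈ g by apply: (proj1 zO).
have z' A (f g : hom A O) : f ≈ g by apply: (proj2 zO).
(* [O] is a direct summand of [N], with [N] itself as complement. *)
apply: (proj1 (hs_thick H) O N (@Build_biprod T S O N N 0 (idm N) 0 (idm N) _ _ _ _ _) wN);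
  try exact: z; try exact: z'; ncat.
Qed.

Lemma W_2of3 (A B D : T) (f : hom A B) (g : hom B D) : E f g ->
  (W A -> W B -> W D) /\ (W A -> W D -> W B) /\ (W B -> W D -> W A).
Proof. exact: (proj2 (hs_thick H)). Qed.
End CotorsionClasses.

(** * The stable congruence *)

Section StableEquality.
Context {T : precat} {S : addstr T} {E : conf_class T} {C W F X CF : T -> Prop}.
Context {sim : rel_class T}.
Hypothesis H : hovey_setup S E C W F X CF sim.
Let HE : exact_category S E := hs_exact H.
Let hw : weakly_idempotent_complete E := hs_wic H.
Let HA : additive S := ex_additive HE.
Let HS : preadditive S := add_preadditive HA.
#[local] Existing Instance HS.
Let Hop := hovey_setup_op H.

Notation "f ~ g" := (sim f g) (at level 70, no associativity).
Notation "0" := (hzero S _ _).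

Lemma F_ext (A B D : T) (f : hom A B) (g : hom B D) : E f g -> F A -> F D -> F B.
Proof. by move=> c fA fD; apply: (C_ext Hop c). Qed.

Lemma X_biprod (A B : T) (P : biprod S A B) : X A -> X B -> X P.
Proof.
move=> /(hs_X H) [cA [wA fA]] /(hs_X H) [cB [wB fB]]; have c := biprod_conf HE hw P.
apply/(hs_X H); split; first exact (C_ext H c cA cB).
split; last exact (F_ext c fA fB).
by apply: (proj1 (proj2 (W_2of3 H c))).
Qed.

Lemma sim_zero (A B : T) (f : hom A B) : f ~ 0 <-> factors_through X f.
Proof.
split.
- move=> /(hs_sim H) [Y [u [v [xY e]]]]; exists Y, u, v; split=> //; lc e.
- move=> [Y [u [v [xY e]]]]; apply/(hs_sim H); exists Y, u, v; split=> //; lc e.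
Qed.

Lemma sim_through (A B Y : T) (u : hom A Y) (v : hom Y B) : X Y -> v ∘ u ~ 0.
Proof. by move=> xY; apply/sim_zero; exists Y, u, v; split=> //; apply: er. Qed.

Lemma sim_cong : add_cong S sim.
Proof.
have sub A B (f g : hom A B) : f ≈ g -> f ~ g.
  move=> e; apply/(hs_sim H); have [O zO] := add_zero_ob HA.
  exists O, 0, 0; split; last by lc e.
  apply/(hs_X H); split; first exact: (C_zero H zO).
  split; first exact: (W_zero H zO).
  exact: (C_zero Hop (op_is_zero zO)).
have opp A B (f g : hom A B) : f ~ g -> hopp S f ~ hopp S g.
  move=> /(hs_sim H) [Y [u [v [xY e]]]]; apply/(hs_sim H); exists Y, u, (hopp S v).
  by split=> //; lc (⊖ e).
have add A B (f f' g g' : hom A B) : f ~ f' -> g ~ g' -> hadd S f g ~ hadd S f' g'.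
  move=> /(hs_sim H) [Y [u [v [xY e]]]] /(hs_sim H) [Y' [u' [v' [xY' e']]]].
  have [P] := add_biprod HA Y Y'; apply/(hs_sim H).
  exists P, (hadd S (in1 P ∘ u) (in2 P ∘ u')), (hadd S (v ∘ pr1 P) (v' ∘ pr2 P)).
  split; first exact: X_biprod.
  lc (e ⊕ e' ⊕ ⊖ (v ▷ pr1_in1 P ◁ u) ⊕ ⊖ (v' ▷ pr2_in2 P ◁ u') ⊕ ⊖ (v ▷ pr1_in2 P ◁ u')
      ⊕ ⊖ (v' ▷ pr2_in1 P ◁ u)).
split=> //.
- move=> A B f g /(hs_sim H) [Y [u [v [xY e]]]]; apply/(hs_sim H); exists Y, u, (hopp S v).
  by split=> //; lc (⊖ e).
- move=> A B f g h e1 e2.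
  have e := add _ _ _ _ _ _ e1 e2; move: e => /(hs_sim H) [Y [u [v [xY e]]]].
  by apply/(hs_sim H); exists Y, u, v; split=> //; lc e.
- move=> A B D x f g /(hs_sim H) [Y [u [v [xY e]]]]; apply/(hs_sim H); exists Y, u, (x ∘ v).
  by split=> //; lc (x ▷ e).
- move=> A B D y f g /(hs_sim H) [Y [u [v [xY e]]]]; apply/(hs_sim H); exists Y, (u ∘ y), v.
  by split=> //; lc (e ◁ y).
Qed.

#[local] Existing Instance sim_cong.

(** The middle term is chosen in [W ∩ F]; it lies in [C] as an extension of [U] by [A]. *)
Lemma shift_exists (A : T) : C A ->
  exists (J U : T) (i : hom A J) (p : hom J U), E i p /\ X J /\ C U.
Proof.
move=> cA; have [U [J [p [i [c [wJ [fJ cU]]]]]]] := hs_fib_triv H A.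
exists J, U, i, p; split=> //; split=> //; apply/(hs_X H); split=> //; exact (C_ext H c cA cU).
Qed.
End StableEquality.

(** * Criteria for stable triviality *)

Section Stable.
Context {T : precat} {S : addstr T} {E : conf_class T} {C W F X CF : T -> Prop}.
Context {sim : rel_class T}.
Hypothesis H : hovey_setup S E C W F X CF sim.
Let HE : exact_category S E := hs_exact H.
Let HA : additive S := ex_additive HE.
Let HS : preadditive S := add_preadditive HA.
#[local] Existing Instance HS.
Let Hop := hovey_setup_op H.
Let Hsim := sim_cong H.
#[local] Existing Instance Hsim.

Notation "f ~ g" := (sim f g) (at level 70, no associativity).
Notation "0" := (hzero S _ _).

Lemma extend (A B D Y : T) (i : hom A B) (d : hom B D) (h : hom A Y) :
  E i d -> C D -> F Y -> W D \/ W Y -> exists h' : hom B Y, h' ∘ i ≈ h.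
Proof. move=> c cD fY w; apply: (ext_extend HE h _ c); exact: (hs_ext H). Qed.

Lemma lift_ (N B D A : T) (i : hom N B) (d : hom B D) (h : hom A D) :
  E i d -> C A -> F N -> W A \/ W N -> exists h' : hom A B, d ∘ h' ≈ h.
Proof. move=> c cA fN w; apply: (ext_lift HE h _ c); exact: (hs_ext H). Qed.

Lemma loop_exists (Y : T) : F Y ->
  exists (J N : T) (pi : hom J Y) (iota : hom N J), E iota pi /\ X J /\ F N.
Proof. exact: (shift_exists Hop (A := Y)). Qed.

(** If [A] is in [W], the map lifts through the deflation onto [B] from an object of [X], whose
    kernel is in [F]. If [B] is in [W], it extends dually. *)
Lemma nul_W (A B : T) (f : hom A B) : C A -> F B -> W A \/ W B -> f ~ 0.
Proof.
move=> cA fB [wA|wB].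
- have [J [N [p [i [c [xJ fN]]]]]] := loop_exists fB.
  have [|h eh] := lift_ f c cA fN; first by left.
  lc (! (es eh) ⊕' sim_through H h p xJ).
- have [J [U [i [p [c [xJ cU]]]]]] := shift_exists H cA.
  have [|h eh] := extend f c cU fB; first by right.
  lc (! (es eh) ⊕' sim_through H i h xJ).
Qed.

Lemma X_W (Y : T) : X Y -> W Y.
Proof. by move=> /(hs_X H) [_ [? _]]. Qed.

Lemma X_C (Y : T) : X Y -> C Y.
Proof. by move=> /(hs_X H) [? _]. Qed.

Lemma X_F (Y : T) : X Y -> F Y.
Proof. by move=> /(hs_X H) [_ [_ ?]]. Qed.

(** Write [a] as [v u] through an object of [X] and extend [u] to [u'] along [f]. Then [x - i v u']
    vanishes on [A], hence is [tau g]; so [y] is [p tau], where [tau] ends in an object of [W ∩ F].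
    Uniqueness of shifts, connecting maps and adjoints rests on this. *)
Lemma coker_null (A B D A' J U : T) (f : hom A B) (g : hom B D) (i : hom A' J) (p : hom J U)
    (x : hom B J) (y : hom D U) (a : hom A A') :
  E f g -> C D -> E i p -> F J -> W J -> x ∘ f ≈ i ∘ a -> y ∘ g ≈ p ∘ x -> a ~ 0 -> y ~ 0.
Proof.
move=> cf cD ci fJ wJ e1 e2 /(sim_zero H) [Y [u [v [xY ea]]]].
have [|u' eu] := extend u cf cD (X_F xY); first by right; apply: X_W.
have [|tau et_] := conf_desc HE (h := hadd S x (hopp S (i ∘ v ∘ u'))) cf.
  lc (e1 ⊕ i ▷ ea ⊕ ⊖ ((i ∘ v) ▷ eu)).
have ey : y ≈ p ∘ tau.
  apply: (conf_epi HE cf); lc (e2 ⊕ ⊖ (p ▷ et_) ⊕ conf_zero HE ci ◁ (v ∘ u')).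
have n : tau ~ 0 by apply: nul_W => //; right.
lc (! ey ⊕' p ▷' n).
Qed.

(** A factorization of [h i] through [X] extends along [i]; what remains of [h] factors through [V],
    which lies in [C ∩ W]. *)
Lemma triv_cof_inj (A B V Y : T) (i : hom A B) (d : hom B V) (h : hom B Y) :
  E i d -> C V -> W V -> F Y -> h ∘ i ~ 0 -> h ~ 0.
Proof.
move=> c cV wV fY /(sim_zero H) [Z [u [v [xZ e]]]].
have [|u' eu] := extend u c cV (X_F xZ); first by left.
have [|tau et_] := conf_desc HE (h := hadd S h (hopp S (v ∘ u'))) c.
  lc (e ⊕ ⊖ (v ▷ eu)).
have n : tau ~ 0 by apply: nul_W => //; left.
lc (! (es et_) ⊕' n ◁' d ⊕' sim_through H u' v xZ).
Qed.
End Stable.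

(** * The bijection between maps out of a cokernel and maps into a kernel *)

Section Adjoint.
Context {T : precat} {S : addstr T} {E : conf_class T} {C W F X CF : T -> Prop}.
Context {sim : rel_class T}.
Hypothesis H : hovey_setup S E C W F X CF sim.
Let HE : exact_category S E := hs_exact H.
Let HA : additive S := ex_additive HE.
Let HS : preadditive S := add_preadditive HA.
#[local] Existing Instance HS.
Let Hop := hovey_setup_op H.
Let Hsim := sim_cong H.
#[local] Existing Instance Hsim.

Notation "f ~ g" := (sim f g) (at level 70, no associativity).
Notation "0" := (hzero S _ _).

Lemma ker_null (N J Y A K U : T) (n : hom N J) (q : hom J Y) (i : hom A K) (p : hom K U)
    (x : hom K J) (y : hom U Y) (a : hom A N) :
  E n q -> F N -> E i p -> C K -> W K -> q ∘ x ≈ y ∘ p -> n ∘ a ≈ x ∘ i -> y ~ 0 -> a ~ 0.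
Proof.
move=> c1 fN c2 cK wK e1 e2 e3.
by apply: (coker_null Hop (c1 : opE E q n) fN (c2 : opE E p i) cK wK
  (x := x : @hom (op T) J K) (a := y : @hom (op T) Y U)).
Qed.

Lemma triv_fib_inj (N B D A : T) (n : hom N B) (q : hom B D) (h : hom A B) :
  E n q -> F N -> W N -> C A -> q ∘ h ~ 0 -> h ~ 0.
Proof. by move=> c fN wN cA e; apply: (triv_cof_inj Hop (c : opE E q n) fN wN cA). Qed.

Section Adj.
Variables (A K U : T) (i : hom A K) (p : hom K U).
Variables (N J Y : T) (n : hom N J) (q : hom J Y).

Definition adj (alpha : hom U Y) (a : hom A N) : Prop :=
  exists s : hom K J, s ∘ i ≈ n ∘ a /\ q ∘ s ≈ alpha ∘ p.

Hypothesis ci : E i p.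
Hypothesis cn : E n q.
Hypotheses (cU : C U) (cK : C K) (wK : W K).
Hypotheses (fN : F N) (fJ : F J) (wJ : W J).

Lemma adj_total_l (a : hom A N) : exists alpha, adj alpha a.
Proof.
have [|s es_] := extend H (n ∘ a) ci cU fJ; first by right.
have [|alpha ea] := conf_desc HE (h := q ∘ s) ci; first by lc (q ▷ es_ ⊕ conf_zero HE cn ◁ a).
by exists alpha, s; split=> //; apply: es.
Qed.

Lemma adj_total_r (alpha : hom U Y) : exists a, adj alpha a.
Proof.
have [|s es_] := lift_ H (alpha ∘ p) cn cK fN; first by left.
have [|a ea] := conf_lift HE (h := s ∘ i) cn; first by lc (es_ ◁ i ⊕ alpha ▷ conf_zero HE ci).
by exists a, s; split=> //; apply: es.
Qed.

Lemma adj_uniq_l (alpha alpha' : hom U Y) (a a' : hom A N) :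
  adj alpha a -> adj alpha' a' -> a ~ a' -> alpha ~ alpha'.
Proof.
move=> [s [s1 s2]] [s' [s1' s2']] e.
have k : hadd S alpha (hopp S alpha') ~ 0.
{ apply: (coker_null H ci cU cn fJ wJ (x := hadd S s (hopp S s')) (a := hadd S a (hopp S a'))).
  - lc (s1 ⊕ ⊖ s1').
  - lc (⊖ s2 ⊕ s2').
  - lc e. }
lc k.
Qed.

Lemma adj_uniq_r (alpha alpha' : hom U Y) (a a' : hom A N) :
  adj alpha a -> adj alpha' a' -> alpha ~ alpha' -> a ~ a'.
Proof.
move=> [s [s1 s2]] [s' [s1' s2']] e.
have k : hadd S a (hopp S a') ~ 0.
{ apply: (ker_null cn fN ci cK wK (x := hadd S s (hopp S s')) (y := hadd S alpha (hopp S alpha'))).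
  - lc (s2 ⊕ ⊖ s2').
  - lc (⊖ s1 ⊕ s1').
  - lc e. }
lc k.
Qed.
End Adj.

Lemma adj_comp_r (A K U A' K' U' N J Y : T) (i : hom A K) (p : hom K U) (i' : hom A' K')
    (p' : hom K' U') (n : hom N J) (q : hom J Y) (f : hom A' A) (s : hom K' K) (k : hom U' U)
    (alpha : hom U Y) (a : hom A N) :
  s ∘ i' ≈ i ∘ f -> k ∘ p' ≈ p ∘ s -> adj i p n q alpha a ->
  adj i' p' n q (alpha ∘ k) (a ∘ f).
Proof.
move=> e1 e2 [t [t1 t2]]; exists (t ∘ s); split.
- lc (t ▷ e1 ⊕ t1 ◁ f).
- lc (t2 ◁ s ⊕ ⊖ (alpha ▷ e2)).
Qed.
End Adjoint.

(** * Right triangles of the subfactor category *)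

Section Representatives.
Context {T : precat} {S : addstr T} {HS : preadditive S}.
Variables (Psi : fdata T T) (HP : additive_functor S S Psi).

Definition rot (s : rseq Psi) : rseq Psi := RSeq Psi (r2 s) (r3 s) (hopp S (fmap Psi (r1 s))).

Lemma rot_iso (s s' : rseq Psi) : rseq_iso s s' -> rseq_iso (rot s) (rot s').
Proof.
move=> [a [b [c [ia [ib [ic [e1 [e2 e3]]]]]]]]; exists b, c, (fmap Psi a).
split=> //; split=> //; split; first exact: (functor_iso _ (proj1 HP)).
split=> //; split=> //=.
have P := fmap_heq (proj1 HP) e1.
lc (⊖ P ⊕ fmap_comp (proj1 HP) b (r1 s) ⊕ ⊖ (fmap_comp (proj1 HP) (r1 s') a)).
Qed.

Definition fills (s s' : rseq Psi) : Prop :=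
  forall (a : hom (rA s) (rA s')) (b : hom (rB s) (rB s')), b ∘ r1 s ≈ r1 s' ∘ a ->
  exists c : hom (rC s) (rC s'), c ∘ r2 s ≈ r2 s' ∘ b /\ fmap Psi a ∘ r3 s ≈ r3 s' ∘ c.

(** Reduces (RT3) to one representative of each isomorphism class of triangles. *)
Lemma fills_iso (s s' t t' : rseq Psi) : rseq_iso s t -> rseq_iso s' t' -> fills s s' -> fills t t'.
Proof.
move=> i i' h a b e.
have HPf := proj1 HP.
have [a0 [b0 [c0 [_ [_ [_ [e1 [e2 e3]]]]]]]] := rseq_iso_sym HPf i'.
have [a1 [b1 [c1 [ia1 [ib1 [ic1 [f1 [f2 f3]]]]]]]] := i.
have [a2 [b2 [c2 [ia2 [ib2 [ic2 [g1 [g2 g3]]]]]]]] := i'.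
have [a0' [al ar]] := ia1; have [b0' [bl br]] := ib1; have [c0' [cl_ cr_]] := ic1.
have [a3 [al2 ar2]] := ia2; have [b3 [bl2 br2]] := ib2; have [c3 [cl2 cr2]] := ic2.
have [c [k1 k2]] : exists c : hom (rC s) (rC s'), c ∘ r2 s ≈ r2 s' ∘ (b3 ∘ b ∘ b1) /\
    fmap Psi (a3 ∘ a ∘ a1) ∘ r3 s ≈ r3 s' ∘ c.
  apply: h.
  lc ((b3 ∘ b) ▷ f1 ⊕ b3 ▷ e ◁ a1 ⊕ ⊖ (b3 ∘ r1 t' ▷ ar2 ◁ (a ∘ a1)) ⊕ ⊖ (b3 ▷ g1 ◁ (a3 ∘ a ∘ a1))
      ⊕ bl2 ◁ (r1 s' ∘ a3 ∘ a ∘ a1)).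
exists (c2 ∘ c ∘ c0'); split.
- pose proof (sq_inv br cl_ f2) as f2'.
  lc ((c2 ∘ c) ▷ f2' ⊕ c2 ▷ k1 ◁ b0' ⊕ g2 ◁ (b3 ∘ b ∘ b1 ∘ b0') ⊕ r2 t' ▷ br2 ◁ (b ∘ b1 ∘ b0')
      ⊕ (r2 t' ∘ b) ▷ br).
- have p1 : fmap Psi (a3 ∘ a ∘ a1) ≈ fmap Psi a3 ∘ fmap Psi a ∘ fmap Psi a1.
    lc (fmap_comp HPf (a3 ∘ a) a1 ⊕ fmap_comp HPf a3 a ◁ fmap Psi a1).
  have p2 : fmap Psi a2 ∘ fmap Psi a3 ≈ idm _.
    exact: (et (es (fmap_comp HPf _ _)) (et (fmap_heq HPf ar2) (fmap_id HPf _))).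
  lc (⊖ (fmap Psi a ∘ r3 t ▷ cr_) ⊕ ⊖ (fmap Psi a ▷ f3 ◁ c0')
      ⊕ ⊖ (p2 ◁ (fmap Psi a ∘ fmap Psi a1 ∘ r3 s ∘ c0'))
      ⊕ ⊖ (fmap Psi a2 ▷ p1 ◁ (r3 s ∘ c0')) ⊕ fmap Psi a2 ▷ k2 ◁ c0' ⊕ g3 ◁ (c ∘ c0')).
Qed.
End Representatives.

Lemma fcomp_additive (T1 T2 T3 : precat) (S1 : addstr T1) (S2 : addstr T2) (S3 : addstr T3)
    (HS3 : preadditive S3) (G : fdata T2 T3) (K : fdata T1 T2) :
  additive_functor S2 S3 G -> additive_functor S1 S2 K -> additive_functor S1 S3 (fcomp G K).
Proof.
move=> [[g1 g2 g3] g4] [[k1 k2 k3] k4]; split; first split.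
- by move=> A B f g e; apply: g1; apply: k1.
- by move=> A; apply: et (g1 _ _ _ _ (k2 A)) (g2 _).
- by move=> A B D g f; apply: et (g1 _ _ _ _ (k3 _ _ _ g f)) (g3 _ _ _ _ _).
- by move=> A B f g; apply: et (g1 _ _ _ _ (k4 _ _ f g)) (g4 _ _ _ _).
Qed.

Section Subfactor.
Context {T : precat} {S : addstr T} {E : conf_class T} {C W F X CF : T -> Prop}.
Context {sim : rel_class T}.
Hypothesis H : hovey_setup S E C W F X CF sim.
Variables (sh : shift_choice E C X) (hCF : forall A, CF A -> C A) (re : repl_choice E C W CF).
Let HE : exact_category S E := hs_exact H.
Let hw : weakly_idempotent_complete E := hs_wic H.
Let HA : additive S := ex_additive HE.
Let HS : preadditive S := add_preadditive HA.
#[local] Existing Instance HS.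
Let Hop := hovey_setup_op H.
Let Hsim := sim_cong H.
#[local] Existing Instance Hsim.

Notation "f ~ g" := (sim f g) (at level 70, no associativity).
Notation "0" := (hzero S _ _).
Notation v A := (proj1_sig A).

Lemma quot_preadditive (P : T -> Prop) : preadditive (quotS S P sim).
Proof.
split; [split|..] => /=.
- by move=> A B f; apply: ac_sub; apply: er.
- by move=> A B f g; apply: ac_sym.
- by move=> A B f g h; apply: ac_trans.
- move=> A B D g g' f f' e1 e2; exact: (ac_trans (ac_r f e1) (ac_l g' e2)).
- by move=> A B f; apply: ac_sub; ncat.
- by move=> A B f; apply: ac_sub; ncat.
- by move=> A B D D' h g f; apply: ac_sub; ncat.
- by move=> A B f f' g g'; apply: ac_add.
- by move=> A B f f'; apply: ac_opp.
- by move=> A B f g h; apply: ac_sub; ncat.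
- by move=> A B f g; apply: ac_sub; ncat.
- by move=> A B f; apply: ac_sub; ncat.
- by move=> A B f; apply: ac_sub; ncat.
- by move=> A B D g g' f; apply: ac_sub; ncat.
- by move=> A B D g f f'; apply: ac_sub; ncat.
Qed.

Lemma CF_C (A : T) : CF A -> C A. Proof. by move=> /(hs_CF H) []. Qed.
Lemma CF_F (A : T) : CF A -> F A. Proof. by move=> /(hs_CF H) []. Qed.

Lemma CF_biprod (A B : T) (P : biprod S A B) : CF A -> CF B -> CF P.
Proof.
move=> /(hs_CF H) [cA fA] /(hs_CF H) [cB fB]; have c := biprod_conf HE hw P.
apply/(hs_CF H); split; [exact: (C_ext H c cA cB) | exact: (F_ext H c fA fB)].
Qed.

Lemma X_CF (A : T) : X A -> CF A.
Proof. by move=> /(hs_X H) [? [? ?]]; apply/(hs_CF H). Qed.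

Lemma quot_additive : additive (quotS S CF sim).
Proof.
split; first exact: quot_preadditive.
- have [O zO] := add_zero_ob HA.
  have cO : CF O.
    by apply/(hs_CF H); split; [exact: (C_zero H zO) | exact: (C_zero Hop (op_is_zero zO))].
  exists (exist CF O cO); apply: (zero_from (quot_preadditive CF)) => /=.
  by apply: ac_sub; apply: (proj1 zO).
- move=> [A cA] [B cB]; have [P] := add_biprod HA A B; constructor.
  apply: (@Build_biprod (quot CF sim) (quotS S CF sim) (exist CF A cA) (exist CF B cB)
    (exist CF (bp P) (CF_biprod P cA cB)) (in1 P) (in2 P) (pr1 P) (pr2 P)) => /=;
    apply: ac_sub.
  + exact: pr1_in1.
  + exact: pr2_in2.
  + exact: pr1_in2.
  + exact: pr2_in1.
  + exact: in_pr.
Qed.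

Lemma sh_C (A : {A | C A}) : C (v (sh_U sh A)).
Proof. exact: proj2_sig. Qed.

Definition kap (A B : {A | C A}) (f : hom (v A) (v B)) : hom (v (sh_U sh A)) (v (sh_U sh B)) :=
  @fmap (quot C sim) (quot C sim) (shift S sim sh) A B f.

Lemma kap_spec (A B : {A | C A}) (f : hom (v A) (v B)) :
  exists s : hom (sh_X sh A) (sh_X sh B),
    s ∘ sh_i sh A ≈ sh_i sh B ∘ f /\ kap f ∘ sh_p sh A ≈ sh_p sh B ∘ s.
Proof.
refine (epsilon_spec (inhabits (hzero S _ _)) (fun k : hom _ _ =>
  exists s : hom (sh_X sh A) (sh_X sh B),
    s ∘ sh_i sh A ≈ sh_i sh B ∘ f /\ k ∘ sh_p sh A ≈ sh_p sh B ∘ s) _).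
have xB := sh_inX sh B.
have [|s es_] := extend H (sh_i sh B ∘ f) (sh_conf sh A) (sh_C A) (X_F H xB).
  by right; apply: (X_W H).
have [|k ek] := conf_desc HE (h := sh_p sh B ∘ s) (sh_conf sh A).
  by lc (sh_p sh B ▷ es_ ⊕ conf_zero HE (sh_conf sh B) ◁ f).
by exists k, s.
Qed.

(** The difference of two candidates is induced by a ladder with zero left map, so [coker_null]
    applies. Functoriality and additivity of the shift then only require a ladder to be
    exhibited. *)
Lemma kap_uniq (A B : {A | C A}) (f : hom (v A) (v B)) (s : hom (sh_X sh A) (sh_X sh B)) k :
  s ∘ sh_i sh A ≈ sh_i sh B ∘ f -> k ∘ sh_p sh A ≈ sh_p sh B ∘ s -> k ~ kap f.
Proof.
move=> e1 e2; have [s' [e1' e2']] := kap_spec f; have xB := sh_inX sh B.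
have n : hadd S k (hopp S (kap f)) ~ 0.
{ apply: (coker_null H (sh_conf sh A) (sh_C A) (sh_conf sh B) (X_F H xB) (X_W H xB)
    (x := hadd S s (hopp S s')) (a := hzero S _ _)).
  - lc (e1 ⊕ ⊖ e1').
  - lc (e2 ⊕ ⊖ e2').
  - sncat. }
lc n.
Qed.

Lemma kap_sim (A B : {A | C A}) (f g : hom (v A) (v B)) : f ~ g -> kap f ~ kap g.
Proof.
move=> e; have [s [e1 e2]] := kap_spec f; have [s' [e1' e2']] := kap_spec g.
have xB := sh_inX sh B.
have n : hadd S (kap f) (hopp S (kap g)) ~ 0.
{ apply: (coker_null H (sh_conf sh A) (sh_C A) (sh_conf sh B) (X_F H xB) (X_W H xB)
    (x := hadd S s (hopp S s')) (a := hadd S f (hopp S g))).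
  - lc (e1 ⊕ ⊖ e1').
  - lc (e2 ⊕ ⊖ e2').
  - lc e. }
lc n.
Qed.

Lemma kap_id (A : {A | C A}) : idm (v (sh_U sh A)) ~ kap (idm (v A)).
Proof. by apply: (kap_uniq (s := idm _)); ncat. Qed.

Lemma kap_comp (A B D : {A | C A}) (g : hom (v B) (v D)) (f : hom (v A) (v B)) :
  kap g ∘ kap f ~ kap (g ∘ f).
Proof.
have [s [e1 e2]] := kap_spec f; have [s' [e1' e2']] := kap_spec g.
apply: (kap_uniq (s := s' ∘ s)).
- lc (s' ▷ e1 ⊕ e1' ◁ f).
- lc (kap g ▷ e2 ⊕ e2' ◁ s).
Qed.

Lemma kap_add (A B : {A | C A}) (f g : hom (v A) (v B)) :
  hadd S (kap f) (kap g) ~ kap (hadd S f g).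
Proof.
have [s [e1 e2]] := kap_spec f; have [s' [e1' e2']] := kap_spec g.
apply: (kap_uniq (s := hadd S s s')).
- lc (e1 ⊕ e1').
- lc (e2 ⊕ e2').
Qed.

Lemma re_ext (A : {A | C A}) (Y : T) (f : hom (v A) Y) : F Y ->
  exists f' : hom (v (re_R re A)) Y, f' ∘ re_j re A ≈ f.
Proof.
move=> fY; apply: (extend H f (re_conf re A) (re_inC re A) fY); left; exact: re_inW.
Qed.

Lemma re_inj (A : {A | C A}) (Y : T) (f g : hom (v (re_R re A)) Y) : F Y ->
  f ∘ re_j re A ~ g ∘ re_j re A -> f ~ g.
Proof.
move=> fY e.
have n : hadd S f (hopp S g) ~ 0.
  by apply: (triv_cof_inj H (re_conf re A) (re_inC re A) (re_inW re A) fY); lc e.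
lc n.
Qed.

Definition rep (A B : {A | C A}) (f : hom (v A) (v B)) : hom (v (re_R re A)) (v (re_R re B)) :=
  @fmap (quot C sim) (quot CF sim) (repl S sim re) A B f.

Lemma re_F (A : {A | C A}) : F (v (re_R re A)).
Proof. exact: CF_F (proj2_sig _). Qed.

Lemma re_C (A : {A | C A}) : C (v (re_R re A)).
Proof. exact: CF_C (proj2_sig _). Qed.

Lemma rep_spec (A B : {A | C A}) (f : hom (v A) (v B)) :
  rep f ∘ re_j re A ≈ re_j re B ∘ f.
Proof.
refine (epsilon_spec (inhabits (hzero S _ _))
  (fun k : hom _ _ => k ∘ re_j re A ≈ re_j re B ∘ f) _).
exact: (re_ext _ (re_F B)).
 Qed.

Lemma rep_sim (A B : {A | C A}) (f g : hom (v A) (v B)) : f ~ g -> rep f ~ rep g.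
Proof.
move=> e; apply: (re_inj (re_F B)).
lc (! (rep_spec f) ⊕' ⊖' ! (rep_spec g) ⊕' re_j re B ▷' e).
Qed.

Lemma rep_id (A : {A | C A}) : rep (idm (v A)) ~ idm _.
Proof. by apply: (re_inj (re_F A)); lc (! (rep_spec (idm (v A)))). Qed.

Lemma rep_comp (A B D : {A | C A}) (g : hom (v B) (v D)) (f : hom (v A) (v B)) :
  rep (g ∘ f) ~ rep g ∘ rep f.
Proof.
apply: (re_inj (re_F D)).
lc (! (rep_spec (g ∘ f) ⊕ ⊖ (rep g ▷ rep_spec f) ⊕ ⊖ (rep_spec g ◁ f))).
Qed.

Lemma rep_add (A B : {A | C A}) (f g : hom (v A) (v B)) :
  rep (hadd S f g) ~ hadd S (rep f) (rep g).
Proof.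
apply: (re_inj (re_F B)).
lc (! (rep_spec (hadd S f g) ⊕ ⊖ rep_spec f ⊕ ⊖ rep_spec g)).
Qed.

Lemma shift_functor : additive_functor (quotS S C sim) (quotS S C sim) (shift S sim sh).
Proof.
split; first split.
- by move=> A B f g; exact (@kap_sim A B f g).
- by move=> A; exact (@ac_sym _ _ _ Hsim _ _ _ _ (kap_id A)).
- by move=> A B D g f; exact (@ac_sym _ _ _ Hsim _ _ _ _ (kap_comp g f)).
- by move=> A B f g; exact (@ac_sym _ _ _ Hsim _ _ _ _ (kap_add f g)).
Qed.

Lemma repl_functor : additive_functor (quotS S C sim) (quotS S CF sim) (repl S sim re).
Proof.
split; first split.
- by move=> A B f g; exact (@rep_sim A B f g).
- by move=> A; exact (rep_id A).
- by move=> A B D g f; exact (rep_comp g f).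
- by move=> A B f g; exact (rep_add f g).
Qed.

Lemma incl_functor : additive_functor (quotS S CF sim) (quotS S C sim) (incl sim hCF).
Proof.
split; first split.
- by [].
- by move=> A; exact (@heq_refl _ (preadd_cat (quot_preadditive C)) _ _ _).
- by move=> A B D g f; exact (@heq_refl _ (preadd_cat (quot_preadditive C)) _ _ _).
- by move=> A B f g; exact (@heq_refl _ (preadd_cat (quot_preadditive C)) _ _ _).
Qed.

Lemma subfactor_shift_functor :
  additive_functor (quotS S CF sim) (quotS S CF sim) (subfactor_shift S sim hCF sh re).
Proof.
have HC := quot_preadditive C; have HCF' := quot_preadditive CF.
apply: fcomp_additive repl_functor _.
exact: (fcomp_additive HC shift_functor incl_functor).
Qed.
Notation j := (re_j re).
Notation QC := (quot C sim).
Notation QCF := (quot CF sim).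
Notation Psi := (subfactor_shift S sim hCF sh re).
Notation "'ι' A" := (@fob QCF QC (incl sim hCF) A) (at level 9, A at level 9).

Let HQC : preadditive (quotS S C sim) := quot_preadditive C.
Let HQ : preadditive (quotS S CF sim) := quot_preadditive CF.
Let HPsi : additive_functor (quotS S CF sim) (quotS S CF sim) Psi :=
  subfactor_shift_functor.

Lemma rep_zero (A B : QC) : rep (A := A) (B := B) 0 ~ 0.
Proof. exact: (@fmap_zero QC QCF _ _ HQC HQ _ repl_functor A B). Qed.

Lemma rep_opp (A B : QC) (f : hom (v A) (v B)) : rep (hopp S f) ~ hopp S (rep f).
Proof. exact: (@fmap_opp QC QCF _ _ HQC HQ _ repl_functor A B f). Qed.

Definition local (A B : T) (f : hom A B) : Prop :=
  forall Y, F Y -> (forall a : hom A Y, exists b : hom B Y, b ∘ f ~ a) /\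
    (forall b : hom B Y, b ∘ f ~ 0 -> b ~ 0).

Lemma triv_cof_local (A B V : T) (i : hom A B) (d : hom B V) :
  E i d -> C V -> W V -> local i.
Proof.
move=> c cV wV Y fY; split.
- move=> a; have [|b e] := extend H a c cV fY; first by left.
  by exists b; apply: ac_sub.
- by move=> b; apply: (triv_cof_inj H c).
Qed.

Lemma local_comp (A B D : T) (g : hom B D) (f : hom A B) : local g -> local f -> local (g ∘ f).
Proof.
move=> lg lf Y fY; have [g1 g2] := lg Y fY; have [f1 f2] := lf Y fY; split.
- move=> a; have [b e] := f1 a; have [c e'] := g1 b; exists c; lc (e' ◁' f ⊕' e).
- move=> b e; apply: g2; apply: f2; lc e.
Qed.

(** Let [N] be a loop object of [Y]. Stable maps from the shift of [A] to [Y] are stable maps from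
    [A] to [N], naturally in [A], and [N] is again in [F]. *)
Lemma local_kap (A B : {A | C A}) (f : hom (v A) (v B)) : local f -> local (kap f).
Proof.
move=> lf Y fY; have [J [N [q [n [cn [xJ fN]]]]]] := loop_exists H fY.
have [s [e1 e2]] := kap_spec f; have [fJ wJ] := (X_F H xJ, X_W H xJ).
have [f1 f2] := lf N fN.
have tl A0 := adj_total_l H (sh_conf sh A0) cn (sh_C A0) fJ wJ.
have tr A0 := adj_total_r H (sh_conf sh A0) cn (X_C H (sh_inX sh A0)) (X_W H (sh_inX sh A0)) fN.
have ul A0 := adj_uniq_l H (sh_conf sh A0) cn (sh_C A0) fJ wJ.
have ur A0 := adj_uniq_r H (sh_conf sh A0) cn (X_C H (sh_inX sh A0)) (X_W H (sh_inX sh A0)) fN.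
split.
- move=> al; have [a ha] := tr A al; have [b eb] := f1 a; have [be hb] := tl B b.
  by exists be; apply: (ul _ _ _ _ _ (adj_comp_r H e1 e2 hb) ha eb).
- move=> be e; have [b hb] := tr B be.
  have z A0 : adj (sh_i sh A0) (sh_p sh A0) n q (hzero S _ _) (hzero S _ _).
    by exists (hzero S _ _); split; ncat.
  have bf : b ∘ f ~ 0 by apply: (ur _ _ _ _ _ (adj_comp_r H e1 e2 hb) (z A) e).
  exact: (ul _ _ _ _ _ hb (z B) (f2 _ bf)).
Qed.

(** Locality with target [R A] extends [j A] over [B] and hence over [R B], giving the candidate
    inverse; locality with target [R B] shows that it is two-sided. *)
Lemma local_rep (A B : {A | C A}) (f : hom (v A) (v B)) : local f ->
  @is_iso QCF (re_R re A) (re_R re B) (rep f).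
Proof.
move=> lf; have [f1 _] := lf _ (re_F A); have [_ f2] := lf _ (re_F B).
have [e ee] := f1 (j A); have [e' ee'] := re_ext e (re_F A).
exists e'; split.
- change (e' ∘ rep f ~ idm _); apply: (re_inj (re_F A)).
  lc (! (e' ▷ rep_spec f ⊕ ee' ◁ f) ⊕' ee).
- change (rep f ∘ e' ~ idm _); apply: (re_inj (re_F B)).
  have k : hadd S (rep f ∘ e) (hopp S (j B)) ~ 0.
    by apply: f2; lc (rep f ▷' ee ⊕' ! (rep_spec f)).
  lc (k ⊕' ! (rep f ▷ ee')).
Qed.

Lemma j_local (A : {A | C A}) : local (j A).
Proof. exact: (triv_cof_local (re_conf re A) (re_inC re A) (re_inW re A)). Qed.

Lemma j_iso (A : QCF) : @is_iso QCF A (re_R re (ι A)) (j (ι A)).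
Proof.
have fA : F (v A) := CF_F (proj2_sig A).
have [r er_] := re_ext (A := ι A) (idm (v A)) fA; exists r; split.
- exact: (@ac_sub _ _ _ Hsim _ _ _ _ er_).
- change (j (ι A) ∘ r ~ idm _); apply: (re_inj (re_F (ι A))); lc (! (j (ι A) ▷ er_)).
Qed.

(* The standard right triangles of [C/X], with maps of [T] instead of their classes. *)
Definition ctri (A B D : {A | C A}) (f : hom (v A) (v B)) (g : hom (v B) (v D))
    (xi : hom (v D) (v (sh_U sh A))) : Prop :=
  exists delta : hom (v B) (sh_X sh A),
    E f g /\ delta ∘ f ≈ sh_i sh A /\ xi ∘ g ≈ sh_p sh A ∘ delta.

Lemma ctri_exists (A B D : {A | C A}) (f : hom (v A) (v B)) (g : hom (v B) (v D)) :
  E f g -> exists xi, ctri f g xi.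
Proof.
move=> c; have xA := sh_inX sh A.
have [|delta ed] := extend H (sh_i sh A) c (proj2_sig D) (X_F H xA).
  by right; apply: (X_W H).
have [|xi ex_] := conf_desc HE (h := sh_p sh A ∘ delta) c.
  by lc (sh_p sh A ▷ ed ⊕ conf_zero HE (sh_conf sh A)).
by exists xi, delta.
Qed.

Lemma ctri_sq (A B D A' B' D' : {A | C A}) (f : hom (v A) (v B)) (g : hom (v B) (v D)) xi
    (f' : hom (v A') (v B')) (g' : hom (v B') (v D')) xi'
    (a : hom (v A) (v A')) (b : hom (v B) (v B')) (c : hom (v D) (v D')) :
  ctri f g xi -> ctri f' g' xi' -> b ∘ f ≈ f' ∘ a -> c ∘ g ≈ g' ∘ b ->
  kap a ∘ xi ~ xi' ∘ c.
Proof.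
move=> [d [cf [d1 d2]]] [d' [cf' [d1' d2']]] e1 e2.
have [s [s1 s2]] := kap_spec a; have xA := sh_inX sh A'.
have k : hadd S (kap a ∘ xi) (hopp S (xi' ∘ c)) ~ 0.
{ apply: (coker_null H cf (proj2_sig D) (sh_conf sh A') (X_F H xA) (X_W H xA)
    (x := hadd S (s ∘ d) (hopp S (d' ∘ b))) (a := hzero S _ _)).
  - lc (s ▷ d1 ⊕ s1 ⊕ ⊖ (d' ▷ e1) ⊕ ⊖ (d1' ◁ a)).
  - lc (kap a ▷ d2 ⊕ s2 ◁ d ⊕ ⊖ (xi' ▷ e2) ⊕ ⊖ (d2' ◁ b)).
  - sncat. }
lc k.
Qed.

(** The defect [b f - f' a] is [w u] through an object of [X]. As [u] extends to [u'] along [f],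
    replacing [b] by [b - w u'] makes the square strictly commutative without changing the stable
    class of [b]. *)
Lemma ctri_map (A B D A' B' D' : {A | C A}) (f : hom (v A) (v B)) (g : hom (v B) (v D)) xi
    (f' : hom (v A') (v B')) (g' : hom (v B') (v D')) xi'
    (a : hom (v A) (v A')) (b : hom (v B) (v B')) :
  ctri f g xi -> ctri f' g' xi' -> b ∘ f ~ f' ∘ a ->
  exists c : hom (v D) (v D'), c ∘ g ~ g' ∘ b /\ kap a ∘ xi ~ xi' ∘ c.
Proof.
move=> t t' e.
have [Y [u [w [xY ey]]]] := proj1 (hs_sim H _ _) e.
have [d [cf _]] := t; have [d' [cf' _]] := t'.
have [|u' eu] := extend H u cf (proj2_sig D) (X_F H xY); first by right; apply: (X_W H).
have eb : hadd S b (hopp S (w ∘ u')) ∘ f ≈ f' ∘ a by lc (ey ⊕ ⊖ (w ▷ eu)).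
have [|c ec] := conf_desc HE (h := g' ∘ hadd S b (hopp S (w ∘ u'))) cf.
  by lc (g' ▷ eb ⊕ conf_zero HE cf' ◁ a).
exists c; split; last exact: (ctri_sq t t' eb ec).
lc (! ec ⊕' ⊖' (sim_through H u' (g' ∘ w) xY)).
Qed.

Definition Std (A B : QCF) (D : QC) (f : hom (v A) (v B)) (g : hom (v B) (v D))
    (xi : hom (v D) (v (sh_U sh (ι A)))) : rseq Psi :=
  @RSeq QCF Psi A B (re_R re D) f (rep (A := ι B) g ∘ j (ι B)) (rep xi).

(** The image under [R] of a standard triangle with arbitrary terms in [C]. The extra factor
    identifies the [R]-image of the shift of [A] with that of the shift of [R A]. Rotations and
    octahedra produce such triangles. *)
Definition Rtri (A B D : QC) (f : hom (v A) (v B)) (g : hom (v B) (v D))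
    (xi : hom (v D) (v (sh_U sh A))) : rseq Psi :=
  @RSeq QCF Psi (re_R re A) (re_R re B) (re_R re D) (rep f) (rep g)
    (rep (kap (B := ι (re_R re A)) (j A)) ∘ rep xi).

Notation Tri := (@subfactor_triangles T S E C W X sim CF hCF sh re).

Lemma std_tri (A B : QCF) (D : QC) (f : hom (v A) (v B)) (g : hom (v B) (v D)) xi :
  ctri (A := ι A) (B := ι B) f g xi -> Tri (Std (A := A) f g xi).
Proof.
move=> [d [cf [d1 d2]]]; exists A, B, D, f, g, xi; split.
- exists (ι A), (ι B), D, f, g, d, xi; do 3!split=> //.
  exact: (@rseq_iso_refl QC (preadd_cat HQC) _ (proj1 (shift_functor))).
- exact: (@rseq_iso_refl QCF (preadd_cat HQ) _ (proj1 HPsi)).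
Qed.

(** Push [f] out along [j A] to [f1 : R A -> P], then compose with [j P]. On the second and third
    terms this changes the conflation by the trivial cofibrations [b], [j P] and [r], which become
    isomorphisms under [R]. *)
Lemma rtri_std (A B D : QC) (f : hom (v A) (v B)) (g : hom (v B) (v D)) xi :
  ctri f g xi -> exists (A1 B1 : QCF) (D1 : QC) (f1 : hom (v A1) (v B1)) (g1 : hom (v B1) (v D1))
    xi1, ctri (A := ι A1) (B := ι B1) f1 g1 xi1 /\ rseq_iso (Std f1 g1 xi1) (Rtri f g xi).
Proof.
move=> t; have [d [cf [d1 d2]]] := t.
have [P [b [f1 [g1 [po [c1 e1]]]]]] := push HE (j A) cf.
have [dw [cb ebw]] := pushout_conf HE (re_conf re A) (pushout_sym HE po).
have cP : C P := C_ext H cb (proj2_sig B) (re_inC re A).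
pose P' : QC := exist C P cP.
have cj := re_conf re P'.
have [D1 [u [r [s [cu [cr_ [er_ es_]]]]]]] := noether HE c1 cj.
have cD1 : C D1 := C_ext H cr_ (proj2_sig D) (re_inC re P').
pose D1' : QC := exist C D1 cD1.
have [xi1 t1] := @ctri_exists (ι (re_R re A)) (ι (re_R re P')) D1' _ _ cu.
exists (re_R re A), (re_R re P'), D1', (j P' ∘ f1), u, xi1; split; first exact: t1.
apply: (@rseq_iso_sym QCF (preadd_cat HQ) _ (proj1 HPsi)).
have lb := triv_cof_local cb (re_inC re A) (re_inW re A).
have lr := triv_cof_local cr_ (re_inC re P') (re_inW re P').
have eb : (j P' ∘ b) ∘ f ≈ (j P' ∘ f1) ∘ j A by lc (j P' ▷ proj1 po).
have eg : r ∘ g ≈ u ∘ (j P' ∘ b) by lc (⊖ (r ▷ e1) ⊕ er_ ◁ b).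
apply: (@riso_intro QCF Psi (re_R re A) (re_R re B) (re_R re D) _ _ _ (rep f) (rep g) _ _ _ _
  (idm _) (rep (A := B) (B := P') b) (rep (A := D) (B := D1') r)).
- exact: (@iso_id QCF (preadd_cat HQ)).
- exact: local_rep.
- exact: local_rep.
- change (rep (A := B) (B := P') b ∘ rep f ~ j P' ∘ f1 ∘ idm _).
  apply: (re_inj (re_F P')).
  lc (! (rep (A := B) (B := P') b ▷ rep_spec f ⊕ rep_spec (A := B) (B := P') b ◁ f ⊕ eb)).
- change (rep (A := D) (B := D1') r ∘ rep g ~
    (rep (A := ι (re_R re P')) (B := D1') u ∘ j (ι (re_R re P'))) ∘ rep (A := B) (B := P') b).
  apply: (re_inj (re_F D1')).
  lc (! (rep (A := D) (B := D1') r ▷ rep_spec g ⊕ rep_spec (A := D) (B := D1') r ◁ g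
      ⊕ j D1' ▷ eg
      ⊕ ⊖ (rep_spec (A := ι (re_R re P')) (B := D1') u ◁ (rep (A := B) (B := P') b ∘ j B))
      ⊕ ⊖ ((j D1' ∘ u) ▷ rep_spec (A := B) (B := P') b))).
- have k := rep_sim (ctri_sq (A' := ι (re_R re A)) (B' := ι (re_R re P')) (D' := D1')
    (a := j A) t t1 eb eg).
  change (rep (kap (A := ι (re_R re A)) (B := ι (re_R re A)) (idm _)) ∘
    (rep (kap (B := ι (re_R re A)) (j A)) ∘ rep xi) ~
    rep xi1 ∘ rep (A := D) (B := D1') r).
  pose proof (rep_sim (ac_sym (kap_id (ι (re_R re A))))) as k0.
  have k1 := rep_id (sh_U sh (ι (re_R re A))).
  lc ((k0 ⊕' k1) ◁' (rep (kap (B := ι (re_R re A)) (j A)) ∘ rep xi) ⊕' k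
     ⊕' ⊖' (rep_comp (kap (B := ι (re_R re A)) (j A)) xi)
     ⊕' rep_comp (A := D) (B := D1') xi1 r).
Qed.

Lemma rtri_tri (A B D : QC) (f : hom (v A) (v B)) (g : hom (v B) (v D)) xi :
  ctri f g xi -> Tri (Rtri f g xi).
Proof.
move=> /rtri_std [A1 [B1 [D1 [f1 [g1 [xi1 [t i]]]]]]].
have [A0 [B0 [D0 [f0 [g0 [h0 [t0 i0]]]]]]] := std_tri t.
exists A0, B0, D0, f0, g0, h0; split=> //.
exact: (@rseq_iso_trans QCF (preadd_cat HQ) _ (proj1 HPsi) _ _ _ i0 i).
Qed.

(** The conflation behind a right triangle may have its first two terms outside [F], being only
    stably isomorphic to [A] and [B]. These isomorphisms are transported by [R]. *)
Lemma tri_rtri (s : rseq Psi) : Tri s -> exists (A B D : QC) (f : hom (v A) (v B))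
  (g : hom (v B) (v D)) xi, ctri f g xi /\ rseq_iso (Rtri f g xi) s.
Proof.
move=> [A [B [D [f [g [h [[A' [B' [D' [f' [g' [d [xi [cf [d1 [d2 i]]]]]]]]]] i']]]]]]].
exists A', B', D', f', g', xi; split; first by exists d.
have is_ := @rseq_iso_sym QC (preadd_cat HQC) _ (proj1 (shift_functor)) _ _ i.
move: is_ => [a [b [c [ia [ib [ic [e1 [e2 e3]]]]]]]]; simpl in a, b, c.
change (@hom T (v A) (v B)) in f; change (@hom T (v B) (v D)) in g.
change (@hom T (v D) (v (sh_U sh (ι A)))) in h.
apply: (@rseq_iso_trans QCF (preadd_cat HQ) _ (proj1 HPsi)) i'.
apply: (@rseq_iso_sym QCF (preadd_cat HQ) _ (proj1 HPsi)).
have HR := proj1 (repl_functor).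
apply: (@riso_intro QCF Psi A B (re_R re D) _ _ _ f (rep (A := ι B) g ∘ j (ι B)) (rep h) _ _ _
  (rep (A := ι A) (B := A') a ∘ j (ι A)) (rep (A := ι B) (B := B') b ∘ j (ι B)) (rep c)).
- apply: (@iso_comp QCF (preadd_cat HQ) _ (re_R re (ι A))); last exact: j_iso.
  exact (@functor_iso QC QCF (preadd_cat HQ) _ HR (ι A) A' a ia).
- apply: (@iso_comp QCF (preadd_cat HQ) _ (re_R re (ι B))); last exact: j_iso.
  exact (@functor_iso QC QCF (preadd_cat HQ) _ HR (ι B) B' b ib).
- exact (@functor_iso QC QCF (preadd_cat HQ) _ HR D D' c ic).
- change (rep (A := ι B) (B := B') b ∘ j (ι B) ∘ f ~
    rep f' ∘ (rep (A := ι A) (B := A') a ∘ j (ι A))).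
  change (b ∘ f ~ f' ∘ a) in e1.
  lc (! (rep_spec (A := ι B) (B := B') b ◁ f) ⊕' j B' ▷' e1
     ⊕' ! (⊖ (rep f' ▷ rep_spec (A := ι A) (B := A') a) ⊕ ⊖ (rep_spec f' ◁ a))).
- change (rep c ∘ (rep (A := ι B) g ∘ j (ι B)) ~
    rep g' ∘ (rep (A := ι B) (B := B') b ∘ j (ι B))).
  change (c ∘ g ~ g' ∘ b) in e2.
  lc (! (rep c ▷ rep_spec (A := ι B) g ⊕ rep_spec c ◁ g) ⊕' j D' ▷' e2
     ⊕' ! (⊖ (rep g' ▷ rep_spec (A := ι B) (B := B') b) ⊕ ⊖ (rep_spec g' ◁ b))).
- change (rep (kap (A := ι A) (B := ι (re_R re A')) (rep (A := ι A) (B := A') a ∘ j (ι A))) ∘ rep h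
    ~ rep (kap (B := ι (re_R re A')) (j A')) ∘ rep xi ∘ rep c).
  change (kap (A := ι A) (B := A') a ∘ h ~ xi ∘ c) in e3.
  pose proof (kap_sim (A := ι A) (B := ι (re_R re A'))
    (ac_sub (rep_spec (A := ι A) (B := A') a))) as k1.
  have k2 := kap_comp (A := ι A) (B := A') (D := ι (re_R re A')) (j A') a.
  have k : kap (A := ι A) (B := ι (re_R re A')) (rep (A := ι A) (B := A') a ∘ j (ι A)) ∘ h ~
      kap (B := ι (re_R re A')) (j A') ∘ xi ∘ c.
    lc (k1 ◁' h ⊕' ⊖' (k2 ◁' h) ⊕' kap (B := ι (re_R re A')) (j A') ▷' e3).
  have k' := rep_sim k.
  lc (k' ⊕' ⊖' (rep_comp _ _) ⊕' rep_comp (kap (B := ι (re_R re A')) (j A') ∘ xi) c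
     ⊕' rep_comp (kap (B := ι (re_R re A')) (j A')) xi ◁' rep c).
Qed.

Lemma tri_iso (s t : rseq Psi) : rseq_iso s t -> Tri s -> Tri t.
Proof.
move=> i [A0 [B0 [D0 [f0 [g0 [h0 [t0 i0]]]]]]]; exists A0, B0, D0, f0, g0, h0; split=> //.
exact: (@rseq_iso_trans QCF (preadd_cat HQ) _ (proj1 HPsi) _ _ _ i0 i).
Qed.

Lemma tri_std (s : rseq Psi) : Tri s -> exists (A B : QCF) (D : QC) (f : hom (v A) (v B))
  (g : hom (v B) (v D)) xi,
  ctri (A := ι A) (B := ι B) f g xi /\ rseq_iso (Std (A := A) f g xi) s.
Proof.
move=> /tri_rtri [A [B [D [f [g [xi [/rtri_std [A1 [B1 [D1 [f1 [g1 [xi1 [t1 i1]]]]]]] i]]]]]]].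
exists A1, B1, D1, f1, g1, xi1; split=> //.
exact: (@rseq_iso_trans QCF (preadd_cat HQ) _ (proj1 HPsi) _ _ _ i1 i).
Qed.

(** Adding [X^A] to the target, with component [i^A], turns [f] into an inflation and does not
    change [B] stably. *)
Lemma cone (A B : QCF) (f : hom (v A) (v B)) :
  exists (B' : QCF) (D : QC) (b : hom (v B) (v B')) (f' : hom (v A) (v B'))
    (g : hom (v B') (v D)), E f' g /\ f' ~ b ∘ f /\ @is_iso QCF B B' b.
Proof.
have xA := sh_inX sh (ι A); have [P] := add_biprod HA (v B) (sh_X sh (ι A)).
have [Y [i' [f1 [d [po [c e]]]]]] := push HE f (sh_conf sh (ι A)).
have cY : C Y := C_ext H c (hCF (proj2_sig B)) (sh_C (ι A)).
exists (exist CF (bp P) (CF_biprod P (proj2_sig B) (X_CF xA))), (exist C Y cY), (in1 P).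
exists (hadd S (in1 P ∘ f) (in2 P ∘ sh_i sh (ι A))).
exists (hadd S (f1 ∘ pr1 P) (hopp S (i' ∘ pr2 P))); split.
  exact: (pushout_biprod_conf HE hw P (sh_conf sh (ι A)) po).
have n := sim_through H (pr2 P) (in2 P) xA.
split.
  have n' := sim_through H (sh_i sh (ι A)) (in2 P) xA; lc n'.
exists (pr1 P); split.
- exact: (@ac_sub _ _ _ Hsim _ _ _ _ (pr1_in1 P)).
- change (in1 P ∘ pr1 P ~ idm _); lc (! (in_pr P) ⊕' ⊖' n).
Qed.

Lemma tri_rt1 (A B : QCF) (f : hom (v A) (v B)) :
  exists (D : QCF) (g : hom (v B) (v D)) (h : hom (v D) (v (Psi A))),
    Tri (@RSeq QCF Psi A B D f g h).
Proof.
have [B' [D [b [f' [g [c [e ib]]]]]]] := cone f.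
have [xi t] := @ctri_exists (ι A) (ι B') D _ _ c.
exists (re_R re D), (rep (A := ι B') g ∘ j (ι B') ∘ b), (rep xi).
apply: (tri_iso _ (std_tri t)); apply: (@rseq_iso_sym QCF (preadd_cat HQ) _ (proj1 HPsi)).
apply: (@riso_intro QCF Psi A B (re_R re D) _ _ _ f (rep (A := ι B') g ∘ j (ι B') ∘ b) (rep xi)
  f' (rep (A := ι B') g ∘ j (ι B')) (rep xi) (idm _) b (idm _)).
- exact: (@iso_id QCF (preadd_cat HQ)).
- exact: ib.
- exact: (@iso_id QCF (preadd_cat HQ)).
- change (b ∘ f ~ f' ∘ idm _); lc (⊖' e).
- change (idm _ ∘ (rep (A := ι B') g ∘ j (ι B') ∘ b) ~ rep (A := ι B') g ∘ j (ι B') ∘ b).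
  sncat.
- change (rep (kap (A := ι A) (B := ι A) (idm _)) ∘ rep xi ~ rep xi ∘ idm _).
  pose proof (rep_sim (ac_sym (kap_id (ι A)))) as k0.
  have k1 := rep_id (sh_U sh (ι A)).
  lc ((k0 ⊕' k1) ◁' rep xi).
Qed.

Lemma tri_rt1_id (O A : QCF) : is_zero O ->
  Tri (@RSeq QCF Psi O A A (hzero S _ _) (idm _) (hzero S _ _)).
Proof.
(* [O] is zero only in the quotient, so a genuine zero object is used to write down a conflation. *)
move=> zO; have [O' zO'] := add_zero_ob HA.
have cO' : CF O'.
  by apply/(hs_CF H); split; [exact: (C_zero H zO') | exact: (C_zero Hop (op_is_zero zO'))].
pose O1 : QCF := exist CF O' cO'.
have t : ctri (A := ι O1) (B := ι A) (D := ι A) 0 (idm _) 0.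
  exists 0; split; first exact: (conf_of_zero' _ HE zO').
  by split; [apply: (proj1 zO') | ncat].
apply: (tri_iso _ (std_tri t)).
have [r [r1 r2]] := j_iso A.
have z1 : @is_zero QCF O1.
  apply: (zero_from HQ); apply: (@ac_sub _ _ _ Hsim); exact: (proj1 zO').
apply: (@riso_intro QCF Psi O1 A (re_R re (ι A)) O A A _ _ _ _ _ _ 0 (idm _) r).
- exists 0; split; [exact: (proj1 z1) | exact: (proj1 zO)].
- exact: (@iso_id QCF (preadd_cat HQ)).
- exact: (iso_inv r1 r2).
- exact: (proj1 z1).
- change (r ∘ (rep (A := ι A) (B := ι A) (idm _) ∘ j (ι A)) ~ idm _ ∘ idm _).
  change (@hom T (v (re_R re (ι A))) (v A)) in r.
  change (r ∘ j (ι A) ~ idm _) in r1; lc (r ▷' (rep_id (ι A)) ◁' j (ι A) ⊕' r1).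
- have n0 := rep_zero (ι A) (sh_U sh (ι O1)).
  have m : rep (kap (A := ι O1) (B := ι O) 0) ∘ rep (A := ι A) (B := sh_U sh (ι O1)) 0 ~ 0.
    lc (rep (kap (A := ι O1) (B := ι O) 0) ▷' n0).
  exact (@et QCF (preadd_cat HQ) _ _ _ _ _ m
    (@es QCF (preadd_cat HQ) _ _ _ _ (@comp0l QCF (quotS S CF sim) HQ _ _ _ r))).
Qed.

(** The rotated triangle comes from the conflation [B -> D ⊕ X^A -> U^A]. Its second map is stably
    [-xi] and its connecting map is the shift of [f]; the isomorphism [- rep kj] on the third term
    moves the sign to the last map. *)
Lemma tri_rt2 (s : rseq Psi) : Tri s -> Tri (rot (S := quotS S CF sim) s).
Proof.
move=> /tri_rtri [A [B [D [f [g [xi [t i]]]]]]].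
apply: (tri_iso (@rot_iso QCF (quotS S CF sim) HQ _ HPsi _ _ i)).
have [d [cf [d1 d2]]] := t; have [P] := add_biprod HA (v D) (sh_X sh A).
have cP := bicartesian_conf HE P cf (sh_conf sh A) d1 d2.
set k := hadd S _ _ in cP; set d' := hadd S _ _ in cP.
have xA := sh_inX sh A.
have cbP : C (bp P) := C_ext H (biprod_conf HE hw P) (proj2_sig D) (X_C H xA).
pose P' : QC := exist C (bp P) cbP.
have [ze tz] := @ctri_exists B P' (sh_U sh A) _ _ cP.
have [d3 [_ [z1 z2]]] := tz.
apply: (tri_iso _ (rtri_tri tz)).
(* The restriction of [d3] to the summand [X^A] is a map over [f] of the kind that computes the
   shift. *)
have kz : ze ~ kap f.
{ apply: (kap_uniq (s := d3 ∘ in2 P)).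
  - have gf := conf_zero HE cf.
    rewrite /k in z1; lc (z1 ◁ f ⊕ ⊖ ((d3 ∘ in2 P) ▷ d1) ⊕ ⊖ ((d3 ∘ in1 P) ▷ gf)).
  - rewrite /d' in z2; lc (z2 ◁ in2 P ⊕ (ze ∘ xi) ▷ pr1_in2 P ⊕ ⊖ (ze ∘ sh_p sh A ▷ pr2_in2 P)). }
have nP := sim_through H (pr2 P) (in2 P) xA.
pose kj := kap (B := ι (re_R re A)) (j A).
pose kjB := kap (B := ι (re_R re B)) (j B).
have ij : @is_iso QCF (re_R re (sh_U sh A)) (re_R re (sh_U sh (ι (re_R re A)))) (rep kj).
  by apply: local_rep; apply: (local_kap (B := ι (re_R re A))); apply: j_local.
refine (@riso_intro QCF Psi (re_R re B) (re_R re P') (re_R re (sh_U sh A)) (re_R re B) (re_R re D)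
  (re_R re (sh_U sh (ι (re_R re A)))) (rep (A := B) (B := P') k) (rep (A := P') (B := sh_U sh A) d')
  (rep kjB ∘ rep ze) (rep g) (rep kj ∘ rep xi)
  (hopp S (rep (kap (A := ι (re_R re A)) (B := ι (re_R re B)) (rep f))))
  (idm _) (rep (A := P') (B := D) (pr1 P)) (hopp S (rep kj)) _ _ _ _ _ _).
- exact: (@iso_id QCF (preadd_cat HQ)).
- have nP' : @is_iso QC P' D (pr1 P).
  { exists (in1 P); split.
    + change (in1 P ∘ pr1 P ~ idm _); lc (! (in_pr P) ⊕' ⊖' nP).
    + exact: (@ac_sub _ _ _ Hsim _ _ _ _ (pr1_in1 P)). }
  exact (@functor_iso QC QCF (preadd_cat HQ) _ (proj1 repl_functor) P' D (pr1 P) nP').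
- have [r [r1 r2]] := ij; exists (hopp S r).
  change (@hom T (v (re_R re (sh_U sh (ι (re_R re A))))) (v (re_R re (sh_U sh A)))) in r; split.
  + change (hopp S r ∘ hopp S (rep kj) ~ idm _); change (r ∘ rep kj ~ idm _) in r1; lc r1.
  + change (hopp S (rep kj) ∘ hopp S r ~ idm _); change (rep kj ∘ r ~ idm _) in r2; lc r2.
- change (rep (A := P') (B := D) (pr1 P) ∘ rep (A := B) (B := P') k ~ rep g ∘ idm _).
  have e : pr1 P ∘ k ≈ g by rewrite /k; lc (pr1_in1 P ◁ g ⊕ pr1_in2 P ◁ d).
  lc (⊖' (rep_comp (A := B) (B := P') (D := D) (pr1 P) k) ⊕' rep_sim (ac_sub e)).
- change (hopp S (rep kj) ∘ rep (A := P') (B := sh_U sh A) d' ~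
    rep kj ∘ rep xi ∘ rep (A := P') (B := D) (pr1 P)).
  have n' := sim_through H (pr2 P) (sh_p sh A) xA.
  have e : d' ~ hopp S (xi ∘ pr1 P) by rewrite /d'; lc n'.
  have e' := rep_sim (A := P') (B := sh_U sh A) e.
  have e2 := rep_opp (A := P') (B := sh_U sh A) (xi ∘ pr1 P).
  lc (⊖' (rep kj ▷' e') ⊕' ⊖' (rep kj ▷' e2)
      ⊕' rep kj ▷' (rep_comp (A := P') (B := D) xi (pr1 P))).
- change (rep (kap (A := ι (re_R re B)) (B := ι (re_R re B)) (idm _)) ∘ (rep kjB ∘ rep ze) ~
    hopp S (rep (kap (A := ι (re_R re A)) (B := ι (re_R re B)) (rep f))) ∘ hopp S (rep kj)).
  pose proof (rep_sim (ac_sym (kap_id (ι (re_R re B))))) as k0.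
  have k1 := rep_id (sh_U sh (ι (re_R re B))).
  have k2 := rep_sim (kap_sim (A := A) (B := ι (re_R re B))
    (@ac_sub _ _ _ Hsim _ _ _ _ (rep_spec f))).
  have k3 := rep_sim (kap_comp (A := A) (B := ι (re_R re A)) (D := ι (re_R re B)) (rep f) (j A)).
  have k4 := rep_sim (kap_comp (A := A) (B := B) (D := ι (re_R re B)) (j B) f).
  have k5 := rep_sim (A := sh_U sh A) (B := sh_U sh B) kz.
  have k6 := rep_comp (kap (A := ι (re_R re A)) (B := ι (re_R re B)) (rep f)) kj.
  have k7 := rep_comp (A := sh_U sh A) kjB (kap f).
  lc ((k0 ⊕' k1) ◁' (rep kjB ∘ rep ze) ⊕' rep kjB ▷' k5 ⊕' ⊖' k7 ⊕' k4 ⊕' ⊖' k2 ⊕' ⊖' k3 ⊕' k6).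
Qed.

Lemma std_fills (A B A' B' : QCF) (D D' : QC) (f : hom (v A) (v B)) (g : hom (v B) (v D)) xi
    (f' : hom (v A') (v B')) (g' : hom (v B') (v D')) xi' :
  ctri (A := ι A) (B := ι B) f g xi -> ctri (A := ι A') (B := ι B') f' g' xi' ->
  fills (Std (A := A) f g xi) (Std (A := A') f' g' xi').
Proof.
move=> t t' a b e.
change (@hom T (v A) (v A')) in a; change (@hom T (v B) (v B')) in b.
change (b ∘ f ~ f' ∘ a) in e.
have [c [c1 c2]] := ctri_map (A := ι A) (B := ι B) (A' := ι A') (B' := ι B') t t' e.
exists (rep c); split.
- change (rep c ∘ (rep (A := ι B) g ∘ j (ι B)) ~ rep (A := ι B') g' ∘ j (ι B') ∘ b).
  lc (! (rep c ▷ rep_spec (A := ι B) g ⊕ rep_spec c ◁ g) ⊕' j D' ▷' c1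
      ⊕' ! (⊖ (rep_spec (A := ι B') g' ◁ b))).
- change (rep (kap (A := ι A) (B := ι A') a) ∘ rep xi ~ rep xi' ∘ rep c).
  have k := rep_sim c2.
  lc (k ⊕' ⊖' (rep_comp (kap (A := ι A) (B := ι A') a) xi) ⊕' rep_comp xi' c).
Qed.

Lemma tri_fills (s s' : rseq Psi) : Tri s -> Tri s' -> fills s s'.
Proof.
move=> /tri_std [A [B [D [f [g [xi [t i]]]]]]] /tri_std [A' [B' [D' [f' [g' [xi' [t' i']]]]]]].
exact (@fills_iso QCF (quotS S CF sim) HQ Psi HPsi _ _ _ _ i i' (std_fills t t')).
Qed.

(** First [f] is made an inflation by [cone], then [g] composed with the stable inverse of [b]. For
    two composable inflations the octahedron is given by [noether], and its commutativities by
    [ctri_sq]. *)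
Lemma tri_rt4 (A B D : QCF) (f : @hom QCF A B) (g : @hom QCF B D) :
  exists (A0 B0 D0 D' A' B' : QCF) (a : @hom QCF A A0) (b : @hom QCF B B0) (c : @hom QCF D D0)
    (f0 : @hom QCF A0 B0) (g0 : @hom QCF B0 D0)
    (l : @hom QCF B0 D') (m : @hom QCF D' (Psi A0)) (h : @hom QCF D0 A') (k : @hom QCF A' (Psi B0))
    (u : @hom QCF D0 B') (w : @hom QCF B' (Psi A0)) (r : @hom QCF D' B') (s : @hom QCF B' A'),
  is_iso a /\ is_iso b /\ is_iso c /\ b ∘ f ≈ f0 ∘ a /\ c ∘ g ≈ g0 ∘ b /\
  Tri (RSeq Psi f0 l m) /\ Tri (RSeq Psi g0 h k) /\ Tri (RSeq Psi (g0 ∘ f0) u w) /\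
  r ∘ l ≈ u ∘ g0 /\ w ∘ r ≈ m /\ s ∘ u ≈ h /\ k ∘ s ≈ fmap Psi f0 ∘ w /\
  Tri (RSeq Psi r s (fmap Psi l ∘ k)).
Proof.
change (@hom T (v A) (v B)) in f; change (@hom T (v B) (v D)) in g.
have [B0 [D1 [b [f0 [l0 [c1 [e1 ib]]]]]]] := cone f.
have [b' [bl br]] := ib; change (@hom T (v B0) (v B)) in b'.
change (b' ∘ b ~ idm _) in bl; change (b ∘ b' ~ idm _) in br.
have [D0 [D2 [c [g0 [h0 [c2 [e2 ic]]]]]]] := cone (A := B0) (B := D) (g ∘ b').
have [P [u0 [r0 [s0 [c3 [c4 [q1 q2]]]]]]] := noether HE c1 c2.
have cP : C P := C_ext H c4 (proj2_sig D1) (proj2_sig D2).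
pose D3 : QC := exist C P cP.
have [x1 t1] := @ctri_exists (ι A) (ι B0) D1 _ _ c1.
have [x2 t2] := @ctri_exists (ι B0) (ι D0) D2 _ _ c2.
have [x3 t3] := @ctri_exists (ι A) (ι D0) D3 _ _ c3.
have [x4 t4] := @ctri_exists D1 D3 D2 _ _ c4.
have T1 := std_tri t1; have T2 := std_tri t2; have T3 := std_tri t3; have T4 := rtri_tri t4.
exists A, B0, D0, (re_R re D1), (re_R re D2), (re_R re D3), (idm _), b, c, f0, g0.
exists (rep (A := ι B0) (B := D1) l0 ∘ j (ι B0)), (rep (A := D1) (B := sh_U sh (ι A)) x1).
exists (rep (A := ι D0) (B := D2) h0 ∘ j (ι D0)), (rep (A := D2) (B := sh_U sh (ι B0)) x2).
exists (rep (A := ι D0) (B := D3) u0 ∘ j (ι D0)), (rep (A := D3) (B := sh_U sh (ι A)) x3).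
exists (rep (A := D1) (B := D3) r0), (rep (A := D3) (B := D2) s0).
split; first exact: (@iso_id QCF (preadd_cat HQ)).
split; first exact: ib.
split; first exact: ic.
split; first by (change (b ∘ f ~ f0 ∘ idm _); lc (⊖' e1)).
split; first by (change (c ∘ g ~ g0 ∘ b); lc (⊖' (e2 ◁' b) ⊕' ⊖' ((c ∘ g) ▷' bl))).
do 3!(split; first by []).
split.
  change (rep (A := D1) (B := D3) r0 ∘ (rep (A := ι B0) (B := D1) l0 ∘ j (ι B0)) ~
    rep (A := ι D0) (B := D3) u0 ∘ j (ι D0) ∘ g0).
  lc (! (rep (A := D1) (B := D3) r0 ▷ rep_spec (A := ι B0) (B := D1) l0
      ⊕ rep_spec (A := D1) (B := D3) r0 ◁ l0 ⊕ j D3 ▷ q1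
      ⊕ ⊖ (rep_spec (A := ι D0) (B := D3) u0 ◁ g0))).
split.
  have k := ctri_sq (A := ι A) (B := ι B0) (D := D1) (A' := ι A) (B' := ι D0) (D' := D3)
    (a := idm _) (b := g0) (c := r0) t1 t3 ltac:(ncat) q1.
  change (rep (A := D3) (B := sh_U sh (ι A)) x3 ∘ rep (A := D1) (B := D3) r0
    ~ rep (A := D1) (B := sh_U sh (ι A)) x1).
  have k' : x3 ∘ r0 ~ x1 by lc (⊖' k ⊕' ⊖' (kap_id (ι A) ◁' x1)).
  lc (rep_sim (A := D1) (B := sh_U sh (ι A)) k'
      ⊕' ⊖' (rep_comp (A := D1) (B := D3) (D := sh_U sh (ι A)) x3 r0)).
split.
  change (rep (A := D3) (B := D2) s0 ∘ (rep (A := ι D0) (B := D3) u0 ∘ j (ι D0)) ~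
    rep (A := ι D0) (B := D2) h0 ∘ j (ι D0)).
  lc (! (rep (A := D3) (B := D2) s0 ▷ rep_spec (A := ι D0) (B := D3) u0
      ⊕ rep_spec (A := D3) (B := D2) s0 ◁ u0 ⊕ j D2 ▷ q2
      ⊕ ⊖ (rep_spec (A := ι D0) (B := D2) h0))).
split.
  have k := ctri_sq (A := ι A) (B := ι D0) (D := D3) (A' := ι B0) (B' := ι D0) (D' := D2)
    (a := f0) (b := idm _) (c := s0) t3 t2 ltac:(ncat) ltac:(lc q2).
  change (rep (A := D2) (B := sh_U sh (ι B0)) x2 ∘ rep (A := D3) (B := D2) s0 ~
    rep (kap (A := ι A) (B := ι B0) f0) ∘ rep (A := D3) (B := sh_U sh (ι A)) x3).
  have k' := rep_sim (A := D3) (B := sh_U sh (ι B0)) k.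
  lc (⊖' k' ⊕' rep_comp (A := D3) (kap (A := ι A) (B := ι B0) f0) x3
      ⊕' ⊖' (rep_comp (A := D3) (B := D2) (D := sh_U sh (ι B0)) x2 s0)).
apply: (tri_iso _ T4).
refine (@riso_intro QCF Psi (re_R re D1) (re_R re D3) (re_R re D2) _ _ _ _ _ _ _ _ _
  (idm _) (idm _) (idm _) _ _ _ _ _ _); try exact: (@iso_id QCF (preadd_cat HQ)).
- change (idm _ ∘ rep (A := D1) (B := D3) r0 ~ rep (A := D1) (B := D3) r0 ∘ idm _).
  sncat.
- change (idm _ ∘ rep (A := D3) (B := D2) s0 ~ rep (A := D3) (B := D2) s0 ∘ idm _).
  sncat.
- have k := ctri_sq (A := ι B0) (B := ι D0) (D := D2) (A' := D1) (B' := D3) (D' := D2)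
    (a := l0) (b := u0) (c := idm _) t2 t4 ltac:(lc (⊖ q1)) ltac:(lc (⊖ q2)).
  change (rep (kap (A := ι (re_R re D1)) (B := ι (re_R re D1)) (idm _)) ∘
    (rep (kap (A := D1) (B := ι (re_R re D1)) (j D1)) ∘ rep (A := D2) x4) ~
    rep (kap (A := ι B0) (B := ι (re_R re D1)) (rep (A := ι B0) (B := D1) l0 ∘ j (ι B0)))
    ∘ rep (A := D2) (B := sh_U sh (ι B0)) x2 ∘ idm _).
  pose proof (rep_sim (ac_sym (kap_id (ι (re_R re D1))))) as k0.
  have k1 := rep_id (sh_U sh (ι (re_R re D1))).
  pose proof (rep_sim (kap_sim (A := ι B0) (B := ι (re_R re D1))
    (@ac_sub _ _ _ Hsim _ _ _ _ (rep_spec (A := ι B0) (B := D1) l0)))) as k2.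
  have k3 := rep_sim (kap_comp (A := ι B0) (B := D1) (D := ι (re_R re D1)) (j D1) l0).
  have k4 := rep_comp (kap (A := D1) (B := ι (re_R re D1)) (j D1)) (kap (A := ι B0) (B := D1) l0).
  have k5 := rep_sim (A := D2) (B := sh_U sh D1) k.
  have k6 := rep_comp (A := D2) (kap (A := ι B0) (B := D1) l0) x2.
  pose y := rep (A := D2) (B := sh_U sh D1) x4.
  have k7 : rep (A := D2) (B := sh_U sh D1) (x4 ∘ idm _) ~ y.
    apply: rep_sim; sncat.
  rewrite -/y; lc ((k0 ⊕' k1) ◁' (rep (kap (A := D1) (B := ι (re_R re D1)) (j D1)) ∘ y)
    ⊕' ⊖' (rep (kap (A := D1) (B := ι (re_R re D1)) (j D1)) ▷' (k7 ⊕' k5 ⊕' ⊖' k6))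
    ⊕' ⊖' ((k2 ⊕' ⊖' k3 ⊕' k4) ◁' rep (A := D2) (B := sh_U sh (ι B0)) x2)).
Qed.

Theorem subfactor_rt : right_triangulated (quotS S CF sim) Tri.
Proof.
apply: (rt_of_octahedra quot_additive HPsi tri_iso).
- by move=> A B f; apply: tri_rt1.
- by move=> O A; apply: tri_rt1_id.
- move=> A B D f g h; exact: (tri_rt2 (s := RSeq Psi f g h)).
- move=> A B D A' B' D' f g h f' g' h' a b t t' e.
  exact: (tri_fills t t' e).
- exact: tri_rt4.
Qed.
End Subfactor.

(** * Compatibility of right and left triangles *)

Section Compat.
Context {T : precat} {S : addstr T} {HS : preadditive S}.
Variables (Psi Phi : fdata T T) (HPsi : is_functor Psi).
Variable eps : forall X : T, hom (Psi (Phi X)) X.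
Hypothesis eps_nat : forall (X Y : T) (f : hom X Y),
  eps Y ∘ fmap Psi (fmap Phi f) ≈ f ∘ eps X.

(* Condition (b) for a right and a left triangle; condition (c) is this one in the
   opposite category. *)
Definition compat (A B C : T) (f : hom A B) (g : hom B C) (h : hom C (Psi A))
    (A' B' C' : T) (f' : hom (Phi C') A') (g' : hom A' B') (h' : hom B' C') : Prop :=
  forall (a : hom A (Phi C')) (b : hom B A'), b ∘ f ≈ f' ∘ a ->
    exists c : hom C B', c ∘ g ≈ g' ∘ b /\ h' ∘ c ≈ eps C' ∘ (fmap Psi a ∘ h).

Lemma compat_right (A B C A1 B1 C1 : T) (f : hom A B) (g : hom B C) (h : hom C (Psi A))
    (f1 : hom A1 B1) (g1 : hom B1 C1) (h1 : hom C1 (Psi A1))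
    (A' B' C' : T) (f' : hom (Phi C') A') (g' : hom A' B') (h' : hom B' C') :
  rseq_iso (RSeq Psi f g h) (RSeq Psi f1 g1 h1) -> compat f g h f' g' h' ->
  compat f1 g1 h1 f' g' h'.
Proof.
move=> [a0 [b0 [c0 [[a1 [al ar]] [[b1 [bl br]] [[c1 [cl_ cr_]] [e1 [e2 e3]]]]]]]].
simpl in *.
move=> k a b e.
have [c [k1 k2]] : exists c : hom C B', c ∘ g ≈ g' ∘ (b ∘ b0) /\
    h' ∘ c ≈ eps C' ∘ (fmap Psi (a ∘ a0) ∘ h).
  by apply: k; lc (b ▷ e1 ⊕ e ◁ a0).
exists (c ∘ c1); split.
- pose proof (sq_inv br cl_ e2) as e2'.
  lc (c ▷ e2' ⊕ k1 ◁ b1 ⊕ (g' ∘ b) ▷ br).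
- have p := fmap_comp HPsi a a0.
  lc (k2 ◁ c1 ⊕ eps C' ▷ p ◁ (h ∘ c1) ⊕ (eps C' ∘ fmap Psi a) ▷ e3 ◁ c1
     ⊕ (eps C' ∘ fmap Psi a ∘ h1) ▷ cr_).
Qed.

Lemma compat_left (A B C : T) (f : hom A B) (g : hom B C) (h : hom C (Psi A))
    (A' B' C' : T) (f' : hom (Phi C') A') (g' : hom A' B') (h' : hom B' C')
    (A1 B1 C1 : T) (f1 : hom (Phi C1) A1) (g1 : hom A1 B1) (h1 : hom B1 C1) :
  rseq_iso (LSeq f' g' h') (LSeq f1 g1 h1) -> compat f g h f' g' h' ->
  compat f g h f1 g1 h1.
Proof.
move=> [x [y [z [[x' [xl xr]] [[y' [yl yr]] [_ [e1 [e2 e3]]]]]]]].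
change (@hom T C1 C') in x; change (@hom T C' C1) in x'.
change (@hom T B1 B') in y; change (@hom T B' B1) in y'; change (@hom T A1 A') in z.
change (x ∘ x' ≈ idm C') in xl; change (x' ∘ x ≈ idm C1) in xr.
change (y ∘ y' ≈ idm B') in yl; change (y' ∘ y ≈ idm B1) in yr.
change (h' ∘ y ≈ x ∘ h1) in e1; change (g' ∘ z ≈ y ∘ g1) in e2.
change (f' ∘ fmap Phi x ≈ z ∘ f1) in e3.
move=> k a b e.
have [c [k1 k2]] : exists c : hom C B', c ∘ g ≈ g' ∘ (z ∘ b) /\
    h' ∘ c ≈ eps C' ∘ (fmap Psi (fmap Phi x ∘ a) ∘ h).
  by apply: k; lc (z ▷ e ⊕ ⊖ (e3 ◁ a)).
exists (y' ∘ c); split; first by lc (y' ▷ k1 ⊕ y' ▷ e2 ◁ b ⊕ yr ◁ (g1 ∘ b)).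
have p := fmap_comp HPsi (fmap Phi x) a; have n := eps_nat x.
lc (⊖ (xr ◁ (h1 ∘ y' ∘ c)) ⊕ ⊖ (x' ▷ e1 ◁ (y' ∘ c)) ⊕ (x' ∘ h') ▷ yl ◁ c ⊕ x' ▷ k2
    ⊕ (x' ∘ eps C') ▷ p ◁ h ⊕ x' ▷ n ◁ (fmap Psi a ∘ h) ⊕ xr ◁ (eps C1 ∘ fmap Psi a ∘ h)).
Qed.
End Compat.

(** * Transport of counit, unit and condition (b) *)

Section TransportCompat.
Context {T U : precat} {SU : addstr U} {HU : preadditive SU} {HT : category_laws T}.
Variables (Psi Phi : fdata T T) (Psi' Phi' : fdata U U).
Hypothesis HPsi : is_functor Psi'.
Variables (F : fdata T U) (HF : is_functor F).
Hypothesis full : forall X Y (g : hom (F X) (F Y)), exists f : hom X Y, fmap F f ≈ g.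
Hypothesis faithful : forall X Y (f g : hom X Y), fmap F f ≈ fmap F g -> f ≈ g.
Variable t : forall X : T, hom (F (Psi X)) (Psi' (F X)).
Variable w : forall X : T, hom (Phi' (F X)) (F (Phi X)).
Variables (w' : forall X : T, hom (F (Phi X)) (Phi' (F X))).
Variables (t' : forall X : T, hom (Psi' (F X)) (F (Psi X))).
Hypothesis tn : forall (X Y : T) (f : hom X Y),
  t Y ∘ fmap F (fmap Psi f) ≈ fmap Psi' (fmap F f) ∘ t X.
Hypothesis wn : forall (X Y : T) (f : hom X Y),
  w Y ∘ fmap Phi' (fmap F f) ≈ fmap F (fmap Phi f) ∘ w X.
Hypothesis wl : forall X, w' X ∘ w X ≈ idm _.
Hypothesis wr : forall X, w X ∘ w' X ≈ idm _.
Hypothesis tl : forall X, t' X ∘ t X ≈ idm _.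
Variable eps : forall X : U, hom (Psi' (Phi' X)) X.
Variable eta : forall X : U, hom X (Phi' (Psi' X)).
Hypothesis eps_nat : forall (X Y : U) (f : hom X Y),
  eps Y ∘ fmap Psi' (fmap Phi' f) ≈ f ∘ eps X.
Hypothesis triangle : forall X, eps (Psi' X) ∘ fmap Psi' (eta X) ≈ idm _.
Variable epsT : forall X : T, hom (Psi (Phi X)) X.
Variable etaT : forall X : T, hom X (Phi (Psi X)).
Hypothesis epsTE : forall X : T,
  fmap F (epsT X) ≈ eps (F X) ∘ fmap Psi' (w' X) ∘ t (Phi X).
Hypothesis etaTE : forall X : T,
  fmap F (etaT X) ≈ w (Psi X) ∘ (fmap Phi' (t' X) ∘ eta (F X)).

Lemma transport_eps_nat (X Y : T) (f : hom X Y) :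
  epsT Y ∘ fmap Psi (fmap Phi f) ≈ f ∘ epsT X.
Proof.
apply: faithful.
have n : w' Y ∘ fmap F (fmap Phi f) ≈ fmap Phi' (fmap F f) ∘ w' X.
  lc (⊖ ((w' Y ∘ fmap F (fmap Phi f)) ▷ wr X) ⊕ ⊖ (w' Y ▷ wn f ◁ w' X)
      ⊕ wl Y ◁ (fmap Phi' (fmap F f) ∘ w' X)).
have n' : fmap Psi' (w' Y) ∘ fmap Psi' (fmap F (fmap Phi f)) ≈
    fmap Psi' (fmap Phi' (fmap F f)) ∘ fmap Psi' (w' X).
  lc (fmap_heq HPsi n ⊕ ⊖ (fmap_comp HPsi (w' Y) (fmap F (fmap Phi f)))
      ⊕ fmap_comp HPsi (fmap Phi' (fmap F f)) (w' X)).
lc (fmap_comp HF (epsT Y) (fmap Psi (fmap Phi f)) ⊕ epsTE Y ◁ fmap F (fmap Psi (fmap Phi f))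
    ⊕ (eps (F Y) ∘ fmap Psi' (w' Y)) ▷ tn (fmap Phi f) ⊕ eps (F Y) ▷ n' ◁ t (Phi X)
    ⊕ eps_nat (fmap F f) ◁ (fmap Psi' (w' X) ∘ t (Phi X))
    ⊕ ⊖ (fmap F f ▷ epsTE X) ⊕ ⊖ (fmap_comp HF f (epsT X))).
Qed.

Lemma transport_triangle (X : T) : epsT (Psi X) ∘ fmap Psi (etaT X) ≈ idm _.
Proof.
apply: faithful; have k := fmap_heq HPsi (etaTE X).
have e : fmap Psi' (w' (Psi X)) ∘ fmap Psi' (fmap F (etaT X)) ≈
    fmap Psi' (fmap Phi' (t' X)) ∘ fmap Psi' (eta (F X)).
  have e0 : w' (Psi X) ∘ fmap F (etaT X) ≈ fmap Phi' (t' X) ∘ eta (F X).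
    lc (w' (Psi X) ▷ etaTE X ⊕ wl (Psi X) ◁ (fmap Phi' (t' X) ∘ eta (F X))).
  lc (fmap_heq HPsi e0 ⊕ ⊖ (fmap_comp HPsi (w' (Psi X)) (fmap F (etaT X)))
      ⊕ fmap_comp HPsi (fmap Phi' (t' X)) (eta (F X))).
lc (fmap_comp HF (epsT (Psi X)) (fmap Psi (etaT X)) ⊕ epsTE (Psi X) ◁ fmap F (fmap Psi (etaT X))
    ⊕ (eps (F (Psi X)) ∘ fmap Psi' (w' (Psi X))) ▷ tn (etaT X)
    ⊕ eps (F (Psi X)) ▷ e ◁ t X ⊕ eps_nat (t' X) ◁ (fmap Psi' (eta (F X)) ∘ t X)
    ⊕ t' X ▷ triangle (F X) ◁ t X ⊕ tl X ⊕ ⊖ (fmap_id HF (Psi X))).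
Qed.

Lemma transport_compat (A B C : T) (f : hom A B) (g : hom B C) (h : hom C (Psi A))
    (A' B' C' : T) (f' : hom (Phi C') A') (g' : hom A' B') (h' : hom B' C') :
  compat eps (fmap F f) (fmap F g) (t A ∘ fmap F h) (fmap F f' ∘ w C') (fmap F g') (fmap F h') ->
  compat epsT f g h f' g' h'.
Proof.
move=> k a b e.
have [c0 [k1 k2]] : exists c : hom (F C) (F B'), c ∘ fmap F g ≈ fmap F g' ∘ fmap F b /\
    fmap F h' ∘ c ≈ eps (F C') ∘ (fmap Psi' (w' C' ∘ fmap F a) ∘ (t A ∘ fmap F h)).
  apply: k; lc (⊖ (fmap_comp HF b f) ⊕ fmap_heq HF e ⊕ fmap_comp HF f' a
    ⊕ ⊖ (fmap F f' ▷ wr C' ◁ fmap F a)).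
have [c ec] := full (X := C) (Y := B') c0; exists c; split; apply: faithful.
- lc (fmap_comp HF c g ⊕ ec ◁ fmap F g ⊕ k1 ⊕ ⊖ (fmap_comp HF g' b)).
- lc (fmap_comp HF h' c ⊕ fmap F h' ▷ ec ⊕ k2
    ⊕ eps (F C') ▷ fmap_comp HPsi (w' C') (fmap F a) ◁ (t A ∘ fmap F h)
    ⊕ ⊖ ((eps (F C') ∘ fmap Psi' (w' C')) ▷ tn a ◁ fmap F h)
    ⊕ ⊖ (epsTE C' ◁ (fmap F (fmap Psi a) ∘ fmap F h))
    ⊕ ⊖ (fmap F (epsT C') ▷ fmap_comp HF (fmap Psi a) h)
    ⊕ ⊖ (fmap_comp HF (epsT C') (fmap Psi a ∘ h))).
Qed.
End TransportCompat.

(** * Adjunction between the shift and the loop functor *)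

Section LeftRight.
Context {T : precat} {S : addstr T} {E : conf_class T} {C W F X CF : T -> Prop}.
Context {sim : rel_class T}.
Hypothesis H : hovey_setup S E C W F X CF sim.
Variables (sh : shift_choice E C X) (hC : forall A, CF A -> C A) (re : repl_choice E C W CF).
Variables (shL : @shift_choice (op T) (opE E) F X) (hF : forall A, CF A -> F A).
Variables (reL : @repl_choice (op T) (opE E) F W CF).
Let HE : exact_category S E := hs_exact H.
Let HA : additive S := ex_additive HE.
Let HS : preadditive S := add_preadditive HA.
#[local] Existing Instance HS.
Let Hop := hovey_setup_op H.
Let Hsim := sim_cong H.
#[local] Existing Instance Hsim.

Notation "f ~ g" := (sim f g) (at level 70, no associativity).
Notation v A := (proj1_sig A).
Notation QC := (quot C sim).
Notation QCF := (quot CF sim).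
Notation "'ι' A" := (@fob QCF QC (incl sim hC) A) (at level 9, A at level 9).
Notation j := (re_j re).
Notation kp A B := (@kap T S E C X sim sh A B).
Notation rp A B := (@rep T S E C W CF sim re A B).

(* The data of [(F, W, C)] in [op T], read in [T]. *)
Definition ιF (A : {A | CF A}) : {A | F A} := exist F (v A) (hF (proj2_sig A)).

Definition Om (A : {A | F A}) : {A | F A} := sh_U shL A.
Definition LX (A : {A | F A}) : T := sh_X shL A.
Definition Lpi (A : {A | F A}) : hom (LX A) (v A) := sh_i shL A.
Definition Liota (A : {A | F A}) : hom (v (Om A)) (LX A) := sh_p shL A.
Definition Lconf (A : {A | F A}) : E (Liota A) (Lpi A) := sh_conf shL A.
Definition LQ (A : {A | F A}) : {A | CF A} := re_R reL A.
Definition Lr (A : {A | F A}) : hom (v (LQ A)) (v A) := re_j reL A.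

Definition omg (A B : {A | F A}) (f : hom (v A) (v B)) : hom (v (Om A)) (v (Om B)) :=
  @kap (op T) (opS S) (opE E) F X (op_rel sim) shL B A f.
Definition que (A B : {A | F A}) (f : hom (v A) (v B)) : hom (v (LQ A)) (v (LQ B)) :=
  @rep (op T) (opS S) (opE E) F W CF (op_rel sim) reL B A f.

Lemma omg_spec (A B : {A | F A}) (f : hom (v A) (v B)) : exists s : hom (LX A) (LX B),
  Lpi B ∘ s ≈ f ∘ Lpi A /\ Liota B ∘ omg f ≈ s ∘ Liota A.
Proof. exact: (@kap_spec (op T) _ _ _ _ _ _ _ _ Hop shL B A f). Qed.

Lemma que_spec (A B : {A | F A}) (f : hom (v A) (v B)) : Lr B ∘ que f ≈ f ∘ Lr A.
Proof. exact: (@rep_spec (op T) _ _ _ _ _ _ _ _ Hop reL B A f). Qed.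

Lemma LX_F (A : {A | F A}) : F (LX A). Proof. exact: (X_F H (sh_inX shL A)). Qed.
Lemma LX_W (A : {A | F A}) : W (LX A). Proof. exact: (X_W H (sh_inX shL A)). Qed.

Definition radj (A : {A | C A}) (B : {A | F A}) (al : hom (v (sh_U sh A)) (v B))
    (a : hom (v A) (v (Om B))) : Prop :=
  adj (sh_i sh A) (sh_p sh A) (Liota B) (Lpi B) al a.

Lemma radj_l (A : {A | C A}) (B : {A | F A}) a : exists al, @radj A B al a.
Proof.
exact: (adj_total_l H (sh_conf sh A) (Lconf B) (sh_C sh A) (LX_F B) (LX_W B)).
Qed.

Lemma radj_uniq (A : {A | C A}) (B : {A | F A}) al al' a a' :
  @radj A B al a -> radj al' a' -> a ~ a' -> al ~ al'.
Proof.
exact: (adj_uniq_l H (sh_conf sh A) (Lconf B) (sh_C sh A) (LX_F B) (LX_W B)).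
Qed.

Lemma radj_pre (A A' : {A | C A}) (B : {A | F A}) al a (f : hom (v A') (v A)) :
  @radj A B al a -> @radj A' B (al ∘ kp _ _ f) (a ∘ f).
Proof. have [s [e1 e2]] := kap_spec H sh f; exact: (adj_comp_r H e1 e2). Qed.

Lemma radj_post (A : {A | C A}) (B B' : {A | F A}) al a (f : hom (v B) (v B')) :
  @radj A B al a -> @radj A B' (f ∘ al) (omg f ∘ a).
Proof.
move=> [s [s1 s2]]; have [s' [e1 e2]] := omg_spec f; exists (s' ∘ s); split.
- lc (s' ▷ s1 ⊕ ⊖ (e2 ◁ a)).
- lc (e1 ◁ s ⊕ f ▷ s2).
Qed.

Definition LR (A : {A | CF A}) : {A | CF A} := LQ (Om (ιF A)).
Definition RS (A : {A | CF A}) : {A | CF A} := re_R re (sh_U sh (ι A)).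

(** The counit before the sign: its restriction along [j] is adjoint to the replacement map [Lr] of
    the loop object. In [is_eta] the roles of [j] and [Lr] are exchanged. *)
Definition is_eps (A : {A | CF A}) (e : hom (v (RS (LR A))) (v A)) : Prop :=
  exists e0, @radj (ι (LR A)) (ιF A) e0 (Lr (Om (ιF A))) /\ e ∘ j (sh_U sh (ι (LR A))) ~ e0.

Definition is_eta (A : {A | CF A}) (e : hom (v A) (v (LR (RS A)))) : Prop :=
  exists e0, @radj (ι A) (ιF (RS A)) (j (sh_U sh (ι A))) e0 /\ Lr (Om (ιF (RS A))) ∘ e ~ e0.

Lemma eps_exists (A : {A | CF A}) : exists e, @is_eps A e.
Proof.
have [e0 h] := radj_l (A := ι (LR A)) (B := ιF A) (Lr (Om (ιF A))).
have [e ee] := re_ext H re (A := sh_U sh (ι (LR A))) e0 (hF (proj2_sig A)).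
by exists e, e0; split=> //; apply: ac_sub.
Qed.

Lemma eps_natural (A B : {A | CF A}) (f : hom (v A) (v B)) e e' :
  is_eps e -> is_eps e' ->
  e' ∘ rp _ _ (kp (ι (LR A)) (ι (LR B))
    (que (A := Om (ιF A)) (B := Om (ιF B)) (omg (A := ιF A) (B := ιF B) f))) ~ f ∘ e.
Proof.
move=> [e0 [r0 k0]] [e1 [r1 k1]].
pose q := que (A := Om (ιF A)) (B := Om (ιF B)) (omg (A := ιF A) (B := ιF B) f).
rewrite -/q.
apply: (re_inj H (hF (proj2_sig B))).
have s := rep_spec H re (kp (ι (LR A)) (ι (LR B)) q).
have a1 := radj_pre (A := ι (LR B)) (A' := ι (LR A)) (B := ιF B) q r1.
have a2 := radj_post (A := ι (LR A)) (B := ιF A) (B' := ιF B) f r0.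
have qs := que_spec (A := Om (ιF A)) (B := Om (ιF B)) (omg (A := ιF A) (B := ιF B) f).
have k := radj_uniq a1 a2 (@ac_sub _ _ _ Hsim _ _ _ _ qs).
lc (! (e' ▷ s) ⊕' k1 ◁' kp (ι (LR A)) (ι (LR B)) q ⊕' k ⊕' ⊖' (f ▷' k0)).
Qed.

(** After restriction along [j], both sides are adjoint to stably equal maps, by naturality of the
    adjunction in its first variable; adjoints are stably unique. *)
Lemma eps_eta (A : {A | CF A}) e n : @is_eps (RS A) e -> @is_eta A n ->
  e ∘ rp _ _ (kp (ι A) (ι (LR (RS A))) n) ~ idm _.
Proof.
move=> [e0 [r0 k0]] [n0 [r1 k1]].
apply: (re_inj H (hF (proj2_sig (RS A)))).
have s := rep_spec H re (kp (ι A) (ι (LR (RS A))) n).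
have a1 := radj_pre (A := ι (LR (RS A))) (A' := ι A) (B := ιF (RS A)) n r0.
have k := radj_uniq a1 r1 k1.
lc (! (e ▷ s) ⊕' k0 ◁' kp (ι A) (ι (LR (RS A))) n ⊕' k).
Qed.

(** The map [c0] out of [D] is induced by [g' b1] with two corrections: [w u'] makes the square
    strict, and [d' s d] cancels the remaining value on [A]. Both are stably zero, but [h' d' s d]
    survives as the connecting term, with a minus sign. *)
Lemma std_compat (A B : {A | CF A}) (D : {A | C A}) (f : hom (v A) (v B)) (g : hom (v B) (v D))
    (xi : hom (v D) (v (sh_U sh (ι A)))) (K : {A | F A}) (B' C' : {A | CF A})
    (h' : hom (v B') (v C')) (g' : hom (v K) (v B')) (ze : hom (v (Om (ιF C'))) (v K))
    (d' : hom (LX (ιF C')) (v B')) (e : hom (v (RS (LR C'))) (v C'))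
    (a : hom (v A) (v (LR C'))) (b : hom (v B) (v (LQ K))) :
  ctri (sh := sh) (A := ι A) (B := ι B) f g xi ->
  E g' h' -> h' ∘ d' ≈ Lpi (ιF C') -> g' ∘ ze ≈ d' ∘ Liota (ιF C') ->
  @is_eps C' e -> b ∘ f ~ que (A := Om (ιF C')) ze ∘ a ->
  exists c : hom (v (re_R re D)) (v B'),
    c ∘ (rp (ι B) _ g ∘ j (ι B)) ~ Lr (ιF B') ∘ que (B := ιF B') g' ∘ b /\
    h' ∘ c ~ hopp S e ∘ (rp _ _ (kp (ι A) (ι (LR C')) a) ∘ rp _ _ xi).
Proof.
move=> [d [cf [d1 d2]]] cg e1 e2 [e0 [r0 k0]] eb.
have qz := que_spec (A := Om (ιF C')) ze.
have qg := que_spec (B := ιF B') g'.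
pose b1 := Lr K ∘ b; pose a1 := Lr (Om (ιF C')) ∘ a.
have eb1 : b1 ∘ f ~ ze ∘ a1 by rewrite /b1 /a1; lc (Lr K ▷' eb ⊕' ! (qz ◁ a)).
have [Y [u [w [xY ew]]]] := proj1 (hs_sim H _ _) eb1.
have [|u' eu] := extend H u cf (proj2_sig D) (X_F H xY); first by right; apply: (X_W H).
have [s [s1 s2]] := radj_pre (A := ι (LR C')) (A' := ι A) (B := ιF C') a r0.
have [|c0 ec] := conf_desc HE (h := hadd S (g' ∘ hadd S b1 (hopp S (w ∘ u')))
    (hopp S (d' ∘ s ∘ d))) cf.
  rewrite /a1 in ew; lc (g' ▷ ew ⊕ ⊖ ((g' ∘ w) ▷ eu) ⊕ e2 ◁ (Lr (Om (ιF C')) ∘ a)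
    ⊕ ⊖ (d' ▷ s1) ⊕ ⊖ ((d' ∘ s) ▷ d1)).
have hc : h' ∘ c0 ≈ hopp S (e0 ∘ kp (ι A) (ι (LR C')) a ∘ xi).
  apply: (conf_epi HE cf).
  lc (h' ▷ ec ⊕ conf_zero HE cg ◁ hadd S b1 (hopp S (w ∘ u')) ⊕ ⊖ (e1 ◁ (s ∘ d)) ⊕ ⊖ (s2 ◁ d)
      ⊕ (e0 ∘ kp (ι A) (ι (LR C')) a) ▷ d2).
have [c cc] := re_ext H re (A := D) c0 (hF (proj2_sig B')).
have n1 := sim_through H u' (g' ∘ w) xY.
have n2 := sim_through H (s ∘ d) d' (sh_inX shL (ιF C')).
exists c; split.
- have rg := rep_spec H re (A := ι B) g.
  rewrite /b1 in ec; lc (! (c ▷ rg ⊕ cc ◁ g ⊕ ec ⊕ ⊖ (qg ◁ b)) ⊕' ⊖' n1 ⊕' ⊖' n2).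
- apply: (re_inj H (hF (proj2_sig C'))).
  have r1 := rep_spec H re xi.
  have r2 := rep_spec H re (kp (ι A) (ι (LR C')) a).
  lc (! (h' ▷ cc ⊕ hc ⊕ (e ∘ rp _ _ (kp (ι A) (ι (LR C')) a)) ▷ r1
      ⊕ e ▷ r2 ◁ xi) ⊕' k0 ◁' (kp (ι A) (ι (LR C')) a ∘ xi)).
Qed.
End LeftRight.

Section Eps.
Context {T : precat} {S : addstr T} {E : conf_class T} {C W F X CF : T -> Prop}.
Context {sim : rel_class T}.
Hypothesis H : hovey_setup S E C W F X CF sim.
Variables (sh : shift_choice E C X) (hC : forall A, CF A -> C A) (re : repl_choice E C W CF).
Variables (shL : @shift_choice (op T) (opE E) F X) (hF : forall A, CF A -> F A).
Variables (reL : @repl_choice (op T) (opE E) F W CF).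
Let HE : exact_category S E := hs_exact H.
Let HA : additive S := ex_additive HE.
Let HS : preadditive S := add_preadditive HA.
#[local] Existing Instance HS.
Let Hop := hovey_setup_op H.
Let Hsim := sim_cong H.
#[local] Existing Instance Hsim.

Notation v A := (proj1_sig A).
Notation QC := (quot C sim).
Notation QCF := (quot CF sim).
Notation "'ι' A" := (@fob QCF QC (incl sim hC) A) (at level 9, A at level 9).
Notation Psi := (subfactor_shift S sim hC sh re).
Notation Phi := (opF (subfactor_shift (opS S) (op_rel sim) hF shL reL)).
Notation isE A e := (@is_eps T E C W F X CF sim sh hC re shL hF reL A e).
Notation isN A e := (@is_eta T E C W F X CF sim sh hC re shL hF reL A e).

Let HQ : preadditive (quotS S CF sim) := quot_preadditive H CF.

Lemma PsiE (A B : QCF) (f : hom (v A) (v B)) :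
  @fmap QCF QCF Psi A B f = @rep T S E C W CF sim re _ _ (@kap T S E C X sim sh (ι A) (ι B) f).
Proof. reflexivity. Qed.

Lemma PhiE (A B : QCF) (f : hom (v A) (v B)) :
  @fmap QCF QCF Phi A B f = que (S := S) (sim := sim) reL (A := Om shL (ιF hF A))
    (B := Om shL (ιF hF B))
    (omg (S := S) (sim := sim) shL (A := ιF hF A) (B := ιF hF B) f).
Proof. reflexivity. Qed.

(* Condition (b) forces the sign. *)
Definition eps_ (A : QCF) : @hom QCF (Psi (Phi A)) A :=
  hopp S (proj1_sig (constructive_indefinite_description _
    (eps_exists H sh hC re shL hF reL A))).

Lemma eps_spec (A : QCF) : exists e, isE A e /\ eps_ A = hopp S e.
Proof.
rewrite /eps_; case: constructive_indefinite_description => e he /=; by exists e.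
Qed.

Lemma eps_nat (A B : QCF) (f : @hom QCF A B) :
  eps_ B ∘ fmap Psi (fmap Phi f) ≈ f ∘ eps_ A.
Proof.
have [e [he ->]] := eps_spec A; have [e' [he' ->]] := eps_spec B.
have k := eps_natural H f he he'.
change (@hom T (v A) (v B)) in f.
have k' : @sim _ _ (hopp S e' ∘ @rep T S E C W CF sim re _ _ (@kap T S E C X sim sh
   (ι (LR shL hF reL A)) (ι (LR shL hF reL B)) (que (S := S) (sim := sim) reL
   (A := Om shL (ιF hF A)) (B := Om shL (ιF hF B))
    (omg (S := S) (sim := sim) shL (A := ιF hF A) (B := ιF hF B) f))))
   (f ∘ hopp S e) by lc (⊖' k).
rewrite (PsiE (A := Phi A) (B := Phi B) (fmap Phi f)) (PhiE f).
exact k'.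
Qed.

(** The relation [adj] keeps its meaning when the category is reversed and its two conflations are
    exchanged, so a counit of the opposite data is a unit. *)
Lemma is_eta_op (A : QCF) (e : hom (v A) (v (LR shL hF reL (RS (sim := sim) sh hC re A)))) :
  @is_eps (op T) (opE E) F W C X CF (op_rel sim) shL hF reL sh hC re A e ->
  isN A e.
Proof. by move=> [e0 [[s [s1 s2]] k]]; exists e0; split=> //; exists s. Qed.

Lemma is_eps_op' (A : QCF) (e : hom (v (RS (sim := sim) sh hC re (LR shL hF reL A))) (v A)) :
  isE A e ->
  @is_eta (op T) (opE E) F W C X CF (op_rel sim) shL hF reL sh hC re A e.
Proof. by move=> [e0 [[s [s1 s2]] k]]; exists e0; split=> //; exists s. Qed.

(** The signs of the counit and the unit cancel. *)
Lemma eps_eta_ (A : QCF) (n : hom (v A) (v (LR shL hF reL (RS (sim := sim) sh hC re A)))) :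
  isN A n ->
  eps_ (Psi A) ∘ fmap Psi (hopp S n : @hom QCF A (Phi (Psi A))) ≈ idm (Psi A).
Proof.
have [e [he ->]] := eps_spec (Psi A) => hn.
have k := eps_eta H he hn.
have o := @fmap_opp QCF QCF _ _ HQ HQ _ (subfactor_shift_functor H sh hC re)
   _ _ (n : @hom QCF A (Phi (Psi A))).
have k' := @cl QCF (preadd_cat HQ) _ _ _ (hopp S e : @hom QCF (Psi (Phi (Psi A))) (Psi A)) _ _ o.
apply: (@et QCF (preadd_cat HQ) _ _ _ _ _ k').
have k2 : @sim _ _ (hopp S e ∘ hopp S (@rep T S E C W CF sim re _ _ (@kap T S E C X sim sh
  (ι A) (ι (LR shL hF reL (RS (sim := sim) sh hC re A))) n))) (idm _) by lc k.
exact k2.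
Qed.

Notation Tri := (@subfactor_triangles T S E C W X sim CF hC sh re).
Notation TriL := (@subfactor_triangles (op T) (opS S) (opE E) F W X (op_rel sim) CF hF shL reL).

Lemma tri_compat (A B D : QCF) (f : @hom QCF A B) (g : @hom QCF B D) (h : @hom QCF D (Psi A))
    (A' B' C' : QCF) (f' : @hom QCF (Phi C') A') (g' : @hom QCF A' B') (h' : @hom QCF B' C') :
  Tri (RSeq Psi f g h) -> TriL (LSeq f' g' h') -> compat eps_ f g h f' g' h'.
Proof.
move=> /(tri_std H) [A0 [B0 [D0 [f0 [g0 [xi [t i]]]]]]].
move=> /(tri_std Hop) [C1 [B1 [K1 [h1 [g1 [ze [[d1 [c1 [q1 q2]]] i']]]]]]].
have HP := proj1 (subfactor_shift_functor H sh hC re).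
have HP' := proj1 (subfactor_shift_functor Hop shL hF reL).
apply: (@compat_right QCF (quotS S CF sim) HQ _ _ HP _ _ _ _ _ _ _ _ _ _ _ _ _ _ _ _ _ _ _ i).
apply: (@compat_left QCF (quotS S CF sim) HQ Psi Phi HP _ eps_nat _ _ _ _ _ _ _ _ _ _ _ _ _ _ _
  _ _ _ i').
move=> a b e; have [e0 [he ->]] := eps_spec C1.
exact: (std_compat H t c1 q1 q2 he e).
Qed.
End Eps.

(** * The pre-triangulated subfactor category *)

Section SubfactorPretri.
Context {T : precat} {S : addstr T} {E : conf_class T} {C W F X CF : T -> Prop}.
Context {sim : rel_class T}.
Hypothesis H : hovey_setup S E C W F X CF sim.
Variables (sh : shift_choice E C X) (hC : forall A, CF A -> C A) (re : repl_choice E C W CF).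
Variables (shL : @shift_choice (op T) (opE E) F X) (hF : forall A, CF A -> F A).
Variables (reL : @repl_choice (op T) (opE E) F W CF).
Let Hop := hovey_setup_op H.
Let HQ : preadditive (quotS S CF sim) := quot_preadditive H CF.

Notation QCF := (quot CF sim).
Notation Psi := (subfactor_shift S sim hC sh re).
Notation Phi := (opF (subfactor_shift (opS S) (op_rel sim) hF shL reL)).
Notation Tri := (@subfactor_triangles T S E C W X sim CF hC sh re).
Notation TriL := (@subfactor_triangles (op T) (opS S) (opE E) F W X (op_rel sim) CF hF shL reL).

Definition eps0 (A : QCF) : @hom QCF (Psi (Phi A)) A := eps_ H sh hC re shL hF reL A.

Definition eta0 (A : QCF) : @hom QCF A (Phi (Psi A)) :=
  @eps_ (op T) (opS S) (opE E) F W C X CF (op_rel sim) Hop shL hF reL sh hC re A.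

Lemma eps0_nat (A B : QCF) (f : @hom QCF A B) :
  eps0 B ∘ fmap Psi (fmap Phi f) ≈ f ∘ eps0 A.
Proof. exact: eps_nat. Qed.

Lemma eta0_nat (A B : QCF) (f : @hom QCF A B) :
  fmap Phi (fmap Psi f) ∘ eta0 A ≈ eta0 B ∘ f.
Proof.
exact: (@eps_nat (op T) (opS S) (opE E) F W C X CF (op_rel sim) Hop shL hF reL sh hC re B A f).
Qed.

Lemma eps0_eta0 (A : QCF) : eps0 (Psi A) ∘ fmap Psi (eta0 A) ≈ idm (Psi A).
Proof.
have [n [hn e]] :=
  @eps_spec (op T) (opS S) (opE E) F W C X CF (op_rel sim) Hop shL hF reL sh hC re A.
rewrite /eta0 e; exact: (eps_eta_ H (is_eta_op hn)).
Qed.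

Lemma eta0_eps0 (A : QCF) : fmap Phi (eps0 A) ∘ eta0 (Phi A) ≈ idm (Phi A).
Proof.
have [n [hn e]] := eps_spec H sh hC re shL hF reL A.
rewrite /eps0 e.
exact: (@eps_eta_ (op T) (opS S) (opE E) F W C X CF (op_rel sim) Hop shL hF reL sh hC re A n
  (is_eps_op' hn)).
Qed.

Lemma eta0_compat (A B D : QCF) (f : @hom QCF A B) (g : @hom QCF B D) (h : @hom QCF D (Psi A))
    (A' B' C' : QCF) (f' : @hom QCF (Phi C') A') (g' : @hom QCF A' B') (h' : @hom QCF B' C') :
  Tri (RSeq Psi f g h) -> TriL (LSeq f' g' h') ->
  @compat (op QCF) (opF Phi) (opF Psi) eta0 C' B' A' h' g' f' D B A h g f.
Proof.
move=> t t'.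
exact: (@tri_compat (op T) (opS S) (opE E) F W C X CF (op_rel sim) Hop shL hF reL sh hC re
  C' B' A' h' g' f' D B A h g f t' t).
Qed.

Lemma subfactor_pretriangulated :
  pretriangulated (@Pretri QCF (quotS S CF sim) Psi Phi Tri TriL).
Proof.
split.
- exact: (subfactor_rt H sh hC re).
- exact: (subfactor_rt Hop shL hF reL).
- exists eta0, eps0; split.
    split; first by move=> A B f; apply: (@es QCF (preadd_cat HQ)); apply: eta0_nat.
    split; first by move=> A B f; apply: eps0_nat.
    by split=> A; [apply: eps0_eta0 | apply: eta0_eps0].
  move=> A B D f g h A' B' C' f' g' h' t t'; split.
  + move=> a b; exact: (tri_compat H t t').
  + move=> b a e; have [c [c1 c2]] := eta0_compat t t' (a := a) (b := b) e.
    exists c; split; first exact: c1.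
    apply: (@et QCF (preadd_cat HQ) _ _ _ _ _ c2).
    exact: (@es QCF (preadd_cat HQ) _ _ _ _
      (@comp_assoc QCF (preadd_cat HQ) _ _ _ _ f' (fmap Phi a) (eta0 A))).
Qed.
End SubfactorPretri.

(** * Bifibrant replacement *)

Section HoFunctor.
Context {T : precat} {S : addstr T} {E : conf_class T} {C W F X CF : T -> Prop}.
Context {sim : rel_class T}.
Hypothesis H : hovey_setup S E C W F X CF sim.
Variable (re : repl_choice E C W CF).
Variables (M : model_data T).
Hypothesis HM : forall (X Y : T) (f : hom X Y),
    weq M f <-> exists (B : T) (i : hom X B) (p : hom B Y), f ≈ p ∘ i /\
      (exists (Z : T) (d : hom B Z), E i d /\ C Z /\ W Z) /\
      (exists (K : T) (k : hom K B), E k p /\ F K /\ W K).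
Let HE : exact_category S E := hs_exact H.
Let hw : weakly_idempotent_complete E := hs_wic H.
Let HA : additive S := ex_additive HE.
Let HS : preadditive S := add_preadditive HA.
#[local] Existing Instance HS.
Let Hop := hovey_setup_op H.
Let Hsim := sim_cong H.
#[local] Existing Instance Hsim.

Notation "f ~ g" := (sim f g) (at level 70, no associativity).
Notation "0" := (hzero S _ _).
Notation v A := (proj1_sig A).
Notation j := (re_j re).
Notation QCF := (quot CF sim).
Notation local := (@local T S F sim).
Let HQ : preadditive (quotS S CF sim) := quot_preadditive H CF.

Lemma sim_refl (A B : T) (f : hom A B) : f ~ f.
Proof. sncat. Qed.

Definition triv_fib (A B : T) (p : hom A B) : Prop :=
  exists (K : T) (k : hom K A), E k p /\ F K /\ W K.

Lemma triv_fib_comp (A B D : T) (p : hom A B) (q : hom B D) :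
  triv_fib p -> triv_fib q -> triv_fib (q ∘ p).
Proof.
move=> [K [k [ck [fK wK]]]] [L [l [cl_ [fL wL]]]].
have [P [m [n' [p' [c1 [c2 _]]]]]] := noether_ker HE ck cl_.
exists P, m; split=> //; split; first exact: (F_ext H c2 fK fL).
exact: (proj1 (proj2 (W_2of3 H c2))).
Qed.

Lemma triv_fib_lift (A B Q : T) (p : hom A B) (f : hom Q B) : triv_fib p -> C Q ->
  exists f' : hom Q A, p ∘ f' ≈ f.
Proof. by move=> [K [k [ck [fK wK]]]] cQ; apply: (lift_ H f ck cQ fK); right. Qed.

Lemma triv_fib_inj' (A B Q : T) (p : hom A B) (f g : hom Q A) : triv_fib p -> C Q ->
  p ∘ f ~ p ∘ g -> f ~ g.
Proof.
move=> [K [k [ck [fK wK]]]] cQ e.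
have n : hadd S f (hopp S g) ~ 0 by apply: (triv_fib_inj H ck fK wK cQ); lc e.
lc n.
Qed.

Lemma stable_iso_local (A B : T) (f : hom A B) (g : hom B A) :
  g ∘ f ~ idm A -> f ∘ g ~ idm B -> local f.
Proof.
move=> l r Y fY; split.
- by move=> a; exists (a ∘ g); lc (a ▷' l).
- by move=> b e; lc (⊖' (b ▷' r) ⊕' e ◁' g).
Qed.

(** Lifting [p1] through [p2] and back gives maps that are stably inverse, because trivial
    fibrations are stably injective on maps out of objects of [C]. *)
Lemma triv_fib_compare (B Q1 Q2 : T) (p1 : hom Q1 B) (p2 : hom Q2 B) (l : hom Q1 Q2) :
  triv_fib p1 -> triv_fib p2 -> C Q1 -> C Q2 -> p2 ∘ l ≈ p1 -> local l.
Proof.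
move=> t1 t2 c1 c2 e; have [g eg] := triv_fib_lift p2 t1 c2.
apply: (stable_iso_local (g := g)).
- apply: (triv_fib_inj' t1 c1); lc (! (eg ◁ l ⊕ e)).
- apply: (triv_fib_inj' t2 c2); lc (! (e ◁ g ⊕ eg)).
Qed.

Lemma local_sim (A B : T) (f g : hom A B) : f ~ g -> local f -> local g.
Proof.
move=> e lf Y fY; have [f1 f2] := lf Y fY; split.
- by move=> a; have [b eb] := f1 a; exists b; lc (eb ⊕' ⊖' (b ▷' e)).
- by move=> b eb; apply: f2; lc (eb ⊕' b ▷' e).
Qed.

Lemma cof_choice (A : T) : {Q : {Q : T | C Q} & {q : hom (v Q) A | triv_fib q}}.
Proof.
have k : exists x : {Q : {Q : T | C Q} & {q : hom (v Q) A | triv_fib q}}, True.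
  have [N [Q [i [q [c [wN [fN cQ]]]]]]] := hs_cof_repl H A.
  have t : triv_fib q by exists N, i.
  by exists (existT _ (exist C Q cQ) (exist _ q t)).
exact: (proj1_sig (constructive_indefinite_description _ k)).
Qed.

Definition Qo (A : T) : {Q : T | C Q} := projT1 (cof_choice A).
Definition qo (A : T) : hom (v (Qo A)) A := v (projT2 (cof_choice A)).
Lemma qo_fib (A : T) : triv_fib (qo A). Proof. exact: (proj2_sig (projT2 (cof_choice A))). Qed.
Lemma Qo_C (A : T) : C (v (Qo A)). Proof. exact: proj2_sig. Qed.

Definition bif (A : T) : {B : T | CF B} := re_R re (Qo A).

(* [h] is the image of [f] under bifibrant replacement. *)
Definition hrep (A B : T) (f : hom A B) (h : hom (v (bif A)) (v (bif B))) : Prop :=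
  exists f' : hom (v (Qo A)) (v (Qo B)), qo B ∘ f' ≈ f ∘ qo A /\ h ∘ j (Qo A) ≈ j (Qo B) ∘ f'.

Lemma hrep_exists (A B : T) (f : hom A B) : exists h, hrep f h.
Proof.
have [f' e] := triv_fib_lift (f ∘ qo A) (qo_fib B) (Qo_C A).
have [h eh] := re_ext H re (A := Qo A) (j (Qo B) ∘ f') (re_F H re (Qo B)).
by exists h, f'.
Qed.

Lemma hrep_sim (A B : T) (f g : hom A B) h k : hrep f h -> hrep g k -> f ~ g -> h ~ k.
Proof.
move=> [f' [e1 e2]] [g' [e1' e2']] e.
have n : f' ~ g'.
  apply: (triv_fib_inj' (qo_fib B) (Qo_C A)); lc (! e1 ⊕' ! (⊖ e1') ⊕' e ◁' qo A).
apply: (re_inj H (re_F H re (Qo B))); lc (! (e2 ⊕ ⊖ e2') ⊕' j (Qo B) ▷' n).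
Qed.

Lemma hrep_id (A : T) : hrep (idm A) (idm _).
Proof. by exists (idm _); split; ncat. Qed.

Lemma hrep_comp (A B D : T) (g : hom B D) (f : hom A B) h k :
  hrep g k -> hrep f h -> hrep (g ∘ f) (k ∘ h).
Proof.
move=> [g' [e1 e2]] [f' [e1' e2']]; exists (g' ∘ f'); split.
- lc (e1 ◁ f' ⊕ g ▷ e1').
- lc (k ▷ e2' ⊕ e2 ◁ f').
Qed.

Lemma hrep_add (A B : T) (f g : hom A B) h k :
  hrep f h -> hrep g k -> hrep (hadd S f g) (hadd S h k).
Proof.
move=> [f' [e1 e2]] [g' [e1' e2']]; exists (hadd S f' g'); split.
- lc (e1 ⊕ e1').
- lc (e2 ⊕ e2').
Qed.

Lemma hrep_local (A B : T) (f : hom A B) h (f' : hom (v (Qo A)) (v (Qo B))) :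
  hrep f h -> qo B ∘ f' ≈ f ∘ qo A -> local f' -> @is_iso QCF (bif A) (bif B) h.
Proof.
move=> [f1 [e1 e2]] e lf.
have n : f' ~ f1.
  by apply: (triv_fib_inj' (qo_fib B) (Qo_C A)); lc (! (e ⊕ ⊖ e1)).
have i := local_rep H re (local_sim n lf).
apply: (@iso_heq QCF (preadd_cat HQ) _ _ _ _ _ i).
apply: (re_inj H (re_F H re (Qo B))); have s := rep_spec H re f1.
lc (! (s ⊕ ⊖ e2)).
Qed.

(** Composed with [w], the replacement [qo A] becomes a second cofibrant replacement of [B]. *)
Lemma hrep_triv_fib (A B : T) (w : hom A B) h : triv_fib w -> hrep w h ->
  @is_iso QCF (bif A) (bif B) h.
Proof.
move=> t r; have [f' [e _]] := r; apply: (hrep_local r e).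
exact: (triv_fib_compare (triv_fib_comp (qo_fib A) t) (qo_fib B) (Qo_C A) (Qo_C B) e).
Qed.

(* [w ∘ qo A] is refactored as a trivial cofibration followed by a trivial fibration:
   the kernel [U] of [Q A ⊕ G -> B], with [G] trivially cofibrant over [B], lies in [W]
   because [A ×_B G] does, and is then pushed out into [W ∩ F]. *)
Lemma triv_cof_refactor (A B V : T) (w : hom A B) (d : hom B V) :
  E w d -> C V -> W V -> exists (Z Z' : T) (i : hom (v (Qo A)) Z) (d' : hom Z Z') (p : hom Z B),
    E i d' /\ C Z' /\ W Z' /\ C Z /\ triv_fib p /\ p ∘ i ≈ w ∘ qo A.
Proof.
move=> cw cV wV; have [NA [nA [cA [fNA wNA]]]] := qo_fib A.
have [N0 [G [n0 [g [cg [wG [cG fN0]]]]]]] := hs_cof_triv H B.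
have [Z0 [m [n' [p' [c1 [c2 [e1 e2]]]]]]] := noether_ker HE cg cw.
(* [Z0] is the fibre product of [A] and [G] over [B]; it is the kernel of a deflation from [G] onto
   [V], both in [W]. *)
have wZ0 : W Z0 by apply: (proj2 (proj2 (W_2of3 H c1))).
have [U [b [p2 [n2 [[po1 po2] [c3 e3]]]]]] := pull HE p' cA.
have wU : W U by apply: (proj1 (proj2 (W_2of3 H c3))).
rewrite /= in po1.
have [P] := add_biprod HA (v (Qo A)) G.
(* [U], obtained by pulling back over [A], is also the fibre product of [Q A] and [G] over [B], as
   [w] is a monomorphism with cokernel [d]. *)
have po : @is_pushout (op T) B G (v (Qo A)) U g (w ∘ qo A) (m ∘ p2) b.
{ apply: pullback_intro; first by lc (⊖ (e2 ◁ p2) ⊕ ⊖ (w ▷ po1)).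
  move=> Y x y e.
  have [|x1 ex1] := conf_lift HE (h := x) c1; first by lc (d ▷ e ⊕ conf_zero HE cw ◁ (qo A ∘ y)).
  have e5 : qo A ∘ y ≈ p' ∘ x1.
    by apply: (conf_mono HE cw); lc (⊖ e ⊕ ⊖ (g ▷ ex1) ⊕ ⊖ (e2 ◁ x1)).
  have [u [u1 [u2 ku]]] := po2 Y y x1 e5.
  change (@hom T Y U) in u; change (b ∘ u ≈ y) in u1; change (p2 ∘ u ≈ x1) in u2.
  exists u; split; first by lc (m ▷ u2 ⊕ ex1).
  split; first exact: u1.
  move=> u' k1 k2; apply: ku; first exact: k2.
  have k3 : p2 ∘ u' ≈ x1 by apply: (conf_mono HE c1); lc (k1 ⊕ ⊖ ex1).
  exact: k3. }
have [u0 cP] : exists u0 : hom U P, E u0 (hadd S (w ∘ qo A ∘ pr1 P) (g ∘ pr2 P)).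
  by eexists; exact: (pushout_biprod_conf (op_exact HE) (op_wic HE hw) (op_biprod P)
    (cg : opE E g n0) po).
have [C0 [F0 [dF [iF [cF [wF [fF cC]]]]]]] := hs_fib_triv H U.
have wC : W C0 by apply: (proj1 (W_2of3 H cF)).
have [Z [k [l [p [pz [cz ez]]]]]] := push HE iF cP.
have [dk [ck _]] := pushout_conf HE cF (pushout_sym HE pz).
have [Z' [d' [r [s [c4 [c5 _]]]]]] := noether HE (biprod_conf HE hw P) ck.
exists Z, Z', (k ∘ in1 P), d', p; split=> //.
split; first exact: (C_ext H c5).
split; first by apply: (proj1 (proj2 (W_2of3 H c5))).
split.
  apply: (C_ext H ck) cC.
  exact: (C_ext H (biprod_conf HE hw P) (Qo_C A) cG).
split; first by exists F0, l.
lc (ez ◁ in1 P ⊕ (w ∘ qo A) ▷ pr1_in1 P ⊕ g ▷ pr2_in1 P).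
Qed.

(** A lift of [w] to the cofibrant replacements need not be a trivial cofibration. One such lift is
    a trivial cofibration followed by a comparison of two replacements of [B], and both factors are
    local. *)
Lemma hrep_triv_cof (A B V : T) (w : hom A B) (d : hom B V) h :
  E w d -> C V -> W V -> hrep w h -> @is_iso QCF (bif A) (bif B) h.
Proof.
move=> cw cV wV r; have [f' [e _]] := r.
have [Z [Z' [i [d' [p [ci [cZ' [wZ' [cZ [tp ep]]]]]]]]]] := triv_cof_refactor cw cV wV.
have [l el] := triv_fib_lift p (qo_fib B) cZ.
have ll := triv_fib_compare tp (qo_fib B) cZ (Qo_C B) el.
have li := triv_cof_local H ci cZ' wZ'.
apply: (hrep_local r (f' := l ∘ i)); first by lc (el ◁ i ⊕ ep).
exact: (local_comp H ll li).
Qed.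

Lemma hrep_weq (A B : T) (w : hom A B) h : weq M w -> hrep w h ->
  @is_iso QCF (bif A) (bif B) h.
Proof.
move=> /HM [D [i [p [e [[Z [d [ci [cZ wZ]]]] t]]]]] r.
have [hi ri] := hrep_exists i; have [hp rp] := hrep_exists p.
pose proof (hrep_sim (hrep_comp rp ri) r (@ac_sub _ _ _ Hsim _ _ _ _ (es e))) as n.
have i1 := hrep_triv_cof ci cZ wZ ri; have i2 := hrep_triv_fib t rp.
exact (@iso_heq QCF (preadd_cat HQ) (bif A) (bif B) (hp ∘ hi) h n
  (@iso_comp QCF (preadd_cat HQ) (bif A) (bif D) (bif B) hp hi i2 i1)).
Qed.

Notation V := (weq M).

(** Recursion on formal composites; a formal inverse is sent to a chosen stable inverse of some
    replacement of [w]. Compatibility with the generated congruence is checked separately in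
    [bmap_eq]. *)
Fixpoint bmap (A B : T) (f : loc_hom V A B) : hom (v (bif A)) (v (bif B)) :=
  match f with
  | @lmap _ _ _ _ f => epsilon (inhabits (hzero S _ _)) (hrep f)
  | @linv _ _ _ _ w _ => epsilon (inhabits (hzero S _ _)) (fun g : hom (v (bif _)) (v (bif _)) =>
      exists h, hrep w h /\ g ∘ h ~ idm _ /\ h ∘ g ~ idm _)
  | @lcomp _ _ _ _ _ g f => bmap g ∘ bmap f
  end.

Lemma bmap_lmap (A B : T) (f : hom A B) : hrep f (bmap (lmap V f)).
Proof. exact: (epsilon_spec (inhabits (hzero S _ _)) (hrep f) (hrep_exists f)). Qed.

Lemma bmap_linv (A B : T) (w : hom A B) (h : V w) :
  bmap (linv h) ∘ bmap (lmap V w) ~ idm _ /\ bmap (lmap V w) ∘ bmap (linv h) ~ idm _.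
Proof.
have [k [r [k1 k2]]] : exists k, hrep w k /\ bmap (linv h) ∘ k ~ idm _ /\ k ∘ bmap (linv h) ~ idm _.
  apply: (epsilon_spec (inhabits (hzero S _ _)) (fun g : hom (v (bif B)) (v (bif A)) =>
    exists k, hrep w k /\ g ∘ k ~ idm _ /\ k ∘ g ~ idm _)).
  have [k r] := hrep_exists w; have [g [g1 g2]] := hrep_weq h r; by exists g, k.
have n := hrep_sim (bmap_lmap w) r (sim_refl w).
split.
- lc (bmap (linv h) ▷' n ⊕' k1).
- lc (n ◁' bmap (linv h) ⊕' k2).
Qed.

Lemma bmap_eq (A B : T) (f g : loc_hom V A B) : loc_eq f g -> bmap f ~ bmap g.
Proof.
elim=> {A B f g}.
- by move=> A B f; sncat.
- by move=> A B f g _ e; lc (⊖' e).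
- by move=> A B f g h _ e1 _ e2; lc (e1 ⊕' e2).
- move=> A B D g g' f f' _ e1 _ e2; change (bmap g ∘ bmap f ~ bmap g' ∘ bmap f').
  lc (e1 ◁' bmap f ⊕' bmap g' ▷' e2).
- move=> A B f; have n := hrep_sim (bmap_lmap (idm B)) (hrep_id B) (sim_refl _).
  change (bmap (lmap V (idm B)) ∘ bmap f ~ bmap f); lc (n ◁' bmap f).
- move=> A B f; have n := hrep_sim (bmap_lmap (idm A)) (hrep_id A) (sim_refl _).
  change (bmap f ∘ bmap (lmap V (idm A)) ~ bmap f); lc (bmap f ▷' n).
- move=> A B D D' h g f.
  change (bmap h ∘ (bmap g ∘ bmap f) ~ bmap h ∘ bmap g ∘ bmap f); sncat.
- move=> A B f g e.
  exact: (hrep_sim (bmap_lmap f) (bmap_lmap g) (@ac_sub _ _ _ Hsim _ _ _ _ e)).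
- move=> A B D g f.
  exact: (hrep_sim (bmap_lmap (g ∘ f)) (hrep_comp (bmap_lmap g) (bmap_lmap f))
    (sim_refl _)).
- move=> A B w h; have [e _] := bmap_linv h.
  have n := hrep_sim (bmap_lmap (idm A)) (hrep_id A) (sim_refl _).
  exact: (ac_trans e (ac_sym n)).
- move=> A B w h; have [_ e] := bmap_linv h.
  have n := hrep_sim (bmap_lmap (idm B)) (hrep_id B) (sim_refl _).
  exact: (ac_trans e (ac_sym n)).
Qed.

Definition bifun : fdata (Ho M) QCF := @Fdata (Ho M) QCF bif bmap.

Lemma bifun_functor : is_functor bifun.
Proof.
split.
- exact: bmap_eq.
- move=> A; exact (hrep_sim (bmap_lmap (@idm T A)) (hrep_id A) (sim_refl _)).
- move=> A B D g f; exact: (@er QCF (preadd_cat HQ)).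
Qed.

(** * The localization functor on stable maps *)

Let HH : category_laws (Ho M).
Proof.
split; [exact (@le_refl T V) | exact (@le_sym T V) | exact (@le_trans T V) | exact (@le_comp T V)
  | exact (@le_id_l T V) | exact (@le_id_r T V) | exact (@le_assoc T V)].
Qed.
#[local] Existing Instance HH.

Notation L := (loc_functor M).
Notation "[ f ]" := (@fmap T (Ho M) L _ _ f) (at level 0).

Lemma L_comp (A B D : T) (g : hom B D) (f : hom A B) : [g ∘ f] ≈ [g] ∘ [f].
Proof. exact: le_map_comp. Qed.

Lemma L_heq (A B : T) (f g : hom A B) : f ≈ g -> [f] ≈ [g].
Proof. exact: le_map. Qed.

Lemma L_heq_id (A : T) (f : hom A A) : f ≈ idm A -> [f] ≈ idm (L A).
Proof. exact: le_map. Qed.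

Definition Linv (A B : T) (w : hom A B) (h : weq M w) : @hom (Ho M) B A := linv h.

Lemma L_inv_l (A B : T) (w : hom A B) (h : weq M w) : Linv h ∘ [w] ≈ idm (L A).
Proof. exact: le_inv_l. Qed.

Lemma L_inv_r (A B : T) (w : hom A B) (h : weq M w) : [w] ∘ Linv h ≈ idm (L B).
Proof. exact: le_inv_r. Qed.

Lemma L_weq (A B : T) (f : hom A B) : weq M f -> is_iso [f].
Proof. by move=> h; exists (linv h); split; [apply: le_inv_l | apply: le_inv_r]. Qed.

Lemma zero_W_C_F : exists O : T, is_zero O /\ C O /\ W O /\ F O.
Proof.
have [O zO] := add_zero_ob HA; exists O; split=> //; split; first exact: (C_zero H zO).
by split; [exact: (W_zero H zO) | exact: (C_zero Hop (op_is_zero zO))].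
Qed.

Lemma triv_fib_weq (A B : T) (p : hom A B) : triv_fib p -> weq M p.
Proof.
move=> t; have [O [zO [cO [wO fO]]]] := zero_W_C_F.
apply/HM; exists A, (idm A), p; split; first ncat; split=> //.
by exists O, (hzero S A O); split=> //; apply: conf_of_zero.
Qed.

Lemma triv_cof_weq (A B V : T) (i : hom A B) (d : hom B V) : E i d -> C V -> W V -> weq M i.
Proof.
move=> c cV wV; have [O [zO [cO [wO fO]]]] := zero_W_C_F.
apply/HM; exists B, i, (idm B); split; first ncat; split; first by exists V, d.
by exists O, (hzero S O B); split=> //; apply: conf_of_zero'.
Qed.

(* [f] and [f + v u], with [u] into an object [Y] of [X], are both composites of
   [(f, u) : A -> B ⊕ Y] with a retraction of the weak equivalence [B -> B ⊕ Y]. *)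
Lemma L_sim (A B : T) (f g : hom A B) : f ~ g -> [f] ≈ [g].
Proof.
move=> /(hs_sim H) [Y [u [w [xY e]]]]; have [P] := add_biprod HA B Y.
have c := biprod_conf HE hw P.
have hw1 : weq M (in1 P) := triv_cof_weq c (X_C H xY) (X_W H xY).
have [k [kl kr]] := L_weq hw1.
have r1 : [pr1 P] ≈ k.
  mstep ([pr1 P] ▷ es kr); mstep (es (L_comp _ _) ◁ k); mc (L_heq_id (pr1_in1 P) ◁ k).
have r2 : [hadd S (pr1 P) (w ∘ pr2 P)] ≈ k.
  have e2 : hadd S (pr1 P) (w ∘ pr2 P) ∘ in1 P ≈ idm _ by lc (pr1_in1 P ⊕ w ▷ pr2_in1 P).
  mstep ([hadd S (pr1 P) (w ∘ pr2 P)] ▷ es kr); mstep (es (L_comp _ _) ◁ k).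
  mc (L_heq_id e2 ◁ k).
pose m := hadd S (in1 P ∘ g) (in2 P ∘ u).
have e1 : [f] ≈ [hadd S (pr1 P) (w ∘ pr2 P)] ∘ [m].
  apply: (@et _ HH _ _ _ _ _ _ (L_comp _ _)); apply: L_heq; rewrite /m.
  lc (e ⊕ ⊖ (pr1_in1 P ◁ g) ⊕ ⊖ (pr1_in2 P ◁ u) ⊕ ⊖ (w ▷ pr2_in1 P ◁ g) ⊕ ⊖ (w ▷ pr2_in2 P ◁ u)).
have e2 : [g] ≈ [pr1 P] ∘ [m].
  apply: (@et _ HH _ _ _ _ _ _ (L_comp _ _)); apply: L_heq; rewrite /m.
  lc (⊖ (pr1_in1 P ◁ g) ⊕ ⊖ (pr1_in2 P ◁ u)).
mstep e1; mstep (r2 ◁ [m]); mstep (es r1 ◁ [m]); mc (es e2).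
Qed.

Lemma qo_weq (A : T) : weq M (qo A). Proof. exact: (triv_fib_weq (qo_fib A)). Qed.

Lemma j_weq (A : {A | C A}) : weq M (j A).
Proof. exact: (triv_cof_weq (re_conf re A) (re_inC re A) (re_inW re A)). Qed.

(** The zigzag from [A] back to [Q A] and on to [R (Q A)], read in the homotopy category; [ho_e'] is
    its inverse. *)
Definition ho_e (A : T) : @hom (Ho M) A (v (bif A)) := [j (Qo A)] ∘ Linv (qo_weq A).
Definition ho_e' (A : T) : @hom (Ho M) (v (bif A)) A := [qo A] ∘ Linv (j_weq (Qo A)).

Lemma ho_el (A : T) : ho_e' A ∘ ho_e A ≈ idm _.
Proof.
rewrite /ho_e /ho_e'.
mstep ([qo A] ▷ L_inv_l (j_weq (Qo A)) ◁ Linv (qo_weq A)).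
mc (L_inv_r (qo_weq A)).
Qed.

Lemma ho_er (A : T) : ho_e A ∘ ho_e' A ≈ idm _.
Proof.
rewrite /ho_e /ho_e'.
mstep ([j (Qo A)] ▷ L_inv_l (qo_weq A) ◁ Linv (j_weq (Qo A))).
mc (L_inv_r (j_weq (Qo A))).
Qed.

Lemma ho_e_rep (A B : T) (f : hom A B) h : hrep f h -> [h] ∘ ho_e A ≈ ho_e B ∘ [f].
Proof.
move=> [f' [e1 e2]].
have k1 : [h] ∘ [j (Qo A)] ≈ [j (Qo B)] ∘ [f'].
  mstep (es (L_comp _ _)); mstep (L_heq e2); mc (L_comp _ _).
have k2 : [qo B] ∘ [f'] ≈ [f] ∘ [qo A].
  mstep (es (L_comp _ _)); mstep (L_heq e1); mc (L_comp _ _).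
rewrite /ho_e; mstep (k1 ◁ Linv (qo_weq A)).
mstep ([j (Qo B)] ▷ es (L_inv_l (qo_weq B)) ◁ ([f'] ∘ Linv (qo_weq A))).
mstep (([j (Qo B)] ∘ Linv (qo_weq B)) ▷ k2 ◁ Linv (qo_weq A)).
mc (([j (Qo B)] ∘ Linv (qo_weq B) ∘ [f]) ▷ L_inv_r (qo_weq A)).
Qed.

(** By induction on the formal composite. The case of a formal inverse follows from that of [w] by
    cancelling, since [L] identifies stably equal maps. *)
Lemma ho_e_nat (A B : T) (f : @hom (Ho M) A B) :
  [bmap f : @hom T (v (bif A)) (v (bif B))] ∘ ho_e A ≈ ho_e B ∘ f.
Proof.
change (loc_hom V A B) in f; elim: f => {A B}.
- move=> A B f; exact: (ho_e_rep (bmap_lmap f)).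
- move=> A B w h; have [e _] := bmap_linv h.
  have k : [bmap (linv h) ∘ bmap (lmap V w)] ≈ idm (L (v (bif A))) by exact: (L_sim e).
  change ([bmap (linv h)] ∘ ho_e B ≈ ho_e A ∘ Linv h).
  have k1 := ho_e_rep (bmap_lmap w).
  mstep (([bmap (linv h)] ∘ ho_e B) ▷ es (L_inv_r h)).
  mstep ([bmap (linv h)] ▷ es k1 ◁ Linv h).
  mstep (es (L_comp _ _) ◁ (ho_e A ∘ Linv h)).
  mc (k ◁ (ho_e A ∘ Linv h)).
- move=> A B D g ihg f ihf.
  have k : [bmap (lcomp g f) : @hom T (v (bif A)) (v (bif D))] ≈ [bmap g] ∘ [bmap f].
    exact: L_comp.
  change ([bmap (lcomp g f) : @hom T (v (bif A)) (v (bif D))] ∘ ho_e A ≈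
    ho_e D ∘ ((g : @hom (Ho M) B D) ∘ (f : @hom (Ho M) A B))).
  mstep (k ◁ ho_e A); mstep ([bmap g] ▷ ihf);
  exact (et (comp_assoc _ _ _ _) (et (@cr (Ho M) HH _ _ _ _ _ f ihg)
    (es (comp_assoc _ _ _ _)))).
Qed.

(** Naturality of the isomorphism [ho_e] recovers [f] from the class of [bmap f]. *)
Lemma bifun_faithful (A B : T) (f g : @hom (Ho M) A B) : bmap f ~ bmap g -> f ≈ g.
Proof.
move=> e; mstep (es (ho_el B) ◁ f); mstep (ho_e' B ▷ es (ho_e_nat f)).
mstep (ho_e' B ▷ L_sim e ◁ ho_e A); mstep (ho_e' B ▷ ho_e_nat g); mc (ho_el B ◁ g).
Qed.

Lemma cof_section (A : T) : C A -> exists s : hom A (v (Qo A)), qo A ∘ s ≈ idm A.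
Proof. exact: (triv_fib_lift (idm A) (qo_fib A)). Qed.

Lemma fib_retract (B : T) : F B -> exists t : hom (v (bif B)) B, t ∘ j (Qo B) ≈ qo B.
Proof. exact: (re_ext H re (A := Qo B) (qo B)). Qed.

(** For [A] in [C] the map [qo A] has a section [s], and for [B] in [F] the map [qo B] extends along
    [j] to [t]; then [f] is stably [t ∘ bmap [f] ∘ j ∘ s]. *)
Lemma L_faithful (A B : T) (f g : hom A B) : C A -> F B -> [f] ≈ [g] -> f ~ g.
Proof.
move=> cA fB /bmap_eq e; change (bmap (lmap V f) ~ bmap (lmap V g)) in e.
have [s es_] := cof_section cA; have [t et_] := fib_retract fB.
have [f' [a1 a2]] := bmap_lmap f; have [g' [b1 b2]] := bmap_lmap g.
lc (⊖' ! (f ▷ es_) ⊕' ⊖' ! (a1 ◁ s) ⊕' ⊖' ! (et_ ◁ (f' ∘ s)) ⊕' ⊖' ! (t ▷ a2 ◁ s)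
    ⊕' t ▷' e ◁' (j (Qo A) ∘ s)
    ⊕' ! (g ▷ es_) ⊕' ! (b1 ◁ s) ⊕' ! (et_ ◁ (g' ∘ s)) ⊕' ! (t ▷ b2 ◁ s)).
Qed.

Lemma L_full (A B : T) (phi : @hom (Ho M) A B) : C A -> F B -> exists f : hom A B, [f] ≈ phi.
Proof.
move=> cA fB; have [s es_] := cof_section cA; have [t et_] := fib_retract fB.
(* In the homotopy category [s] inverts [qo A] and [t] inverts [ho_e B], so this map represents the
   conjugate of [bmap phi] by [ho_e]. *)
exists (t ∘ (bmap phi ∘ (j (Qo A) ∘ s))).
have k1 : [s] ≈ Linv (qo_weq A).
  mstep (es (L_inv_l (qo_weq A)) ◁ [s]); mstep (Linv (qo_weq A) ▷ es (L_comp (qo A) s)).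
  mc (Linv (qo_weq A) ▷ L_heq_id es_).
have k2 : [t] ∘ ho_e B ≈ idm _.
  rewrite /ho_e; mstep (es (L_comp t (j (Qo B))) ◁ Linv (qo_weq B)).
  mstep (L_heq et_ ◁ Linv (qo_weq B)); mc (L_inv_r (qo_weq B)).
have k3 : [bmap phi ∘ (j (Qo A) ∘ s)] ≈ [bmap phi] ∘ ho_e A.
  rewrite /ho_e; mstep (L_comp _ _); mstep ([bmap phi] ▷ L_comp _ _).
  mc (([bmap phi] ∘ [j (Qo A)]) ▷ k1).
mstep (L_comp t _); mstep ([t] ▷ k3); mstep ([t] ▷ ho_e_nat phi); mc (k2 ◁ phi).
Qed.

Lemma bmap_pre (A B : T) (g : hom (v (bif A)) (v (bif B))) :
  bmap (ho_e' B ∘ ([g] ∘ ho_e A)) ~ g.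
Proof.
set f := ho_e' B ∘ ([g] ∘ ho_e A).
have k : [bmap f] ∘ ho_e A ≈ ho_e B ∘ (ho_e' B ∘ ([g] ∘ ho_e A)) := ho_e_nat f.
apply: L_faithful; [exact: (CF_C H (proj2_sig (bif A))) | exact: (CF_F H (proj2_sig (bif B))) |].
mstep ([bmap f] ▷ es (ho_er A)); mstep (k ◁ ho_e' A).
mstep (ho_er B ◁ ([g] ∘ ho_e A ∘ ho_e' A)); mc ([g] ▷ ho_er A).
Qed.

Lemma bifun_full (A B : T) (g : hom (v (bif A)) (v (bif B))) :
  exists f : @hom (Ho M) A B, bmap f ~ g.
Proof. exists (ho_e' B ∘ ([g] ∘ ho_e A)); exact: bmap_pre. Qed.

Lemma retract_iso (B : QCF) : exists t : @hom QCF (bif (v B)) B,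
  is_iso t /\ [t : @hom T (v (bif (v B))) (v B)] ∘ ho_e (v B) ≈ idm _.
Proof.
have cB := CF_C H (proj2_sig B); have fB := CF_F H (proj2_sig B).
have [t et_] := fib_retract fB; have [s es_] := cof_section cB.
exists t; split.
{ exists (j (Qo (v B)) ∘ s); split.
  - change (j (Qo (v B)) ∘ s ∘ t ~ idm _); apply: (re_inj H (re_F H re (Qo (v B)))).
    have n : s ∘ qo (v B) ~ idm _.
      apply: (triv_fib_inj' (qo_fib (v B)) (Qo_C (v B))); lc (! (es_ ◁ qo (v B))).
    lc (! ((j (Qo (v B)) ∘ s) ▷ et_) ⊕' j (Qo (v B)) ▷' n).
  - change (t ∘ (j (Qo (v B)) ∘ s) ~ idm _); lc (! (et_ ◁ s ⊕ es_)). }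
rewrite /ho_e; mstep (es (L_comp t (j (Qo (v B)))) ◁ Linv (qo_weq (v B))).
mstep (L_heq et_ ◁ Linv (qo_weq (v B))); mc (L_inv_r (qo_weq (v B))).
Qed.

Lemma bifun_surj (B : QCF) : exists (A : Ho M) (f : @hom QCF (bifun A) B), is_iso f.
Proof. by have [t [it _]] := retract_iso B; exists (v B), t. Qed.

(** The operations of the subfactor category, conjugated back by [ho_e]. The functor [bifun] is
    additive by construction, and [L_additive] shows that so is the localization functor. *)
Definition ho_add : addstr (Ho M) :=
  @AddStr (Ho M) (fun A B => ho_e' B ∘ ([hzero S (v (bif A)) (v (bif B))] ∘ ho_e A))
    (fun A B f g => ho_e' B ∘ ([hadd S (bmap f) (bmap g)] ∘ ho_e A))
    (fun A B f => ho_e' B ∘ ([hopp S (bmap f)] ∘ ho_e A)).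

Lemma ho_preadditive : preadditive ho_add.
Proof.
apply: (@transport_preadditive (Ho M) QCF ho_add (quotS S CF sim) HH bifun bifun_functor) => //.
- by move=> A B f g; apply: bifun_faithful.
- by move=> A B f g; apply: bmap_pre.
- by move=> A B; apply: bmap_pre.
- by move=> A B f; apply: bmap_pre.
Qed.

Lemma L_additive : additive_functor S ho_add L.
Proof.
split; first split.
- exact: L_heq.
- by move=> A; apply: er.
- by move=> A B D g f; apply: L_comp.
- move=> A B f g; apply: bifun_faithful.
  have k := bmap_pre (hadd S (bmap (lmap V f)) (bmap (lmap V g))).
  have k' := hrep_sim (bmap_lmap (hadd S f g)) (hrep_add (bmap_lmap f) (bmap_lmap g)) (sim_refl _).
  exact: (ac_trans k' (ac_sym k)).
Qed.

(** The quasi-inverse is the localization functor restricted to [C ∩ F]. *)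
Lemma bifun_equivalence : equivalence bifun.
Proof.
split; first exact: bifun_functor.
exists (@Fdata QCF (Ho M) (fun B => v B) (fun A B f => [f : @hom T (v A) (v B)])); split.
{ split.
  - by move=> A B f g e; apply: L_sim.
  - by move=> A; apply: er.
  - by move=> A B D g f; apply: L_comp. }
split.
- exists ho_e; split; last by move=> A; exists (ho_e' A); split; [apply: ho_el | apply: ho_er].
  by move=> A B f; apply: es; apply: ho_e_nat.
- have [t ht] : exists t : forall B : QCF, @hom T (v (bif (v B))) (v B),
    forall B, @is_iso QCF (bif (v B)) B (t B) /\ [t B] ∘ ho_e (v B) ≈ idm _.
    exists (fun B => proj1_sig (constructive_indefinite_description _ (retract_iso B))) => B.
    exact: (proj2_sig (constructive_indefinite_description _ (retract_iso B))).
  exists t; split; last by move=> B; apply: (proj1 (ht B)).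
  move=> A B f; change (@hom T (v A) (v B)) in f.
  change (t B ∘ bmap [f] ~ f ∘ t A).
  apply: L_faithful; [exact: (CF_C H (proj2_sig _)) | exact: (CF_F H (proj2_sig B)) |].
  have hA := proj2 (ht A); have hB := proj2 (ht B).
  mstep (L_comp (t B) (bmap [f])).
  mstep (([t B] ∘ [bmap [f]]) ▷ es (ho_er (v A))).
  mstep ([t B] ▷ ho_e_nat [f] ◁ ho_e' (v A)).
  mstep (hB ◁ ([f] ∘ ho_e' (v A))).
  mstep ([f] ▷ es hA ◁ ho_e' (v A)).
  mstep (([f] ∘ [t A]) ▷ ho_er (v A)).
  mc (es (L_comp f (t A))).
Qed.
End HoFunctor.

(** * Suspensions and cofibre sequences *)

(* What is used of the localization [L : T -> Hc] and of its equivalence [K] with the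
   subfactor category; it is again self-dual. *)
Record ho_setup (T : precat) (S : addstr T) (E : conf_class T) (C W F CF : T -> Prop)
    (sim : rel_class T) (M : model_data T) (Hc : precat) (SH : addstr Hc) (L : fdata T Hc)
    (K : fdata (img L) (quot CF sim))
    (e : forall A : T, hom (L A) (L (proj1_sig (K A))))
    (e' : forall A : T, hom (L (proj1_sig (K A))) (L A)) : Prop := {
  hl_cof : forall (A B : T) (f : hom A B),
    cof M f <-> exists (Z : T) (d : hom B Z), E _ _ _ f d /\ C Z;
  hl_fib : forall (A B : T) (f : hom A B),
    fib M f <-> exists (N : T) (n : hom N A), E _ _ _ n f /\ F N;
  hl_weqE : forall (A B : T) (f : hom A B),
    weq M f <-> exists (D : T) (i : hom A D) (p : hom D B), f ≈ p ∘ i /\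
      (exists (Z : T) (d : hom D Z), E _ _ _ i d /\ C Z /\ W Z) /\
      (exists (N : T) (n : hom N D), E _ _ _ n p /\ F N /\ W N);
  hl_pre : preadditive SH;
  hl_add : additive_functor S SH L;
  hl_sim : forall (A B : T) (f g : hom A B), sim _ _ f g -> fmap L f ≈ fmap L g;
  hl_weq : forall (A B : T) (f : hom A B), weq M f -> is_iso (fmap L f);
  hl_full : forall (A B : T) (phi : hom (L A) (L B)), C A -> F B ->
    exists f : hom A B, fmap L f ≈ phi;
  hl_faith : forall (A B : T) (f g : hom A B), C A -> F B -> fmap L f ≈ fmap L g -> sim _ _ f g;
  hl_K : is_functor K;
  hl_el : forall A, e' A ∘ e A ≈ idm _;
  hl_er : forall A, e A ∘ e' A ≈ idm _;
  hl_nat : forall (A B : T) (phi : hom (L A) (L B)),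
    fmap L (@fmap (img L) (quot CF sim) K A B phi :
      @hom T (proj1_sig (K A)) (proj1_sig (K B))) ∘ e A ≈ e B ∘ phi }.

Section Susp.
Context {T : precat} {S : addstr T} {E : conf_class T} {C W F X CF : T -> Prop}.
Context {sim : rel_class T}.
Hypothesis H : hovey_setup S E C W F X CF sim.
Variables (sh : shift_choice E C X) (re : repl_choice E C W CF).
Variables (M : model_data T) (Hc : precat) (SH : addstr Hc) (L : fdata T Hc).
Variables (K : fdata (img L) (quot CF sim)).
Variables (e : forall A : T, hom (L A) (L (proj1_sig (K A)))).
Variables (e' : forall A : T, hom (L (proj1_sig (K A))) (L A)).
Hypothesis HH : ho_setup S E C W F M SH e e'.
Let HE : exact_category S E := hs_exact H.
Let hw : weakly_idempotent_complete E := hs_wic H.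
Let HA : additive S := ex_additive HE.
Let HS : preadditive S := add_preadditive HA.
#[local] Existing Instance HS.
Let Hsim := sim_cong H.
#[local] Existing Instance Hsim.
Let HSH : preadditive SH := hl_pre HH.
#[local] Existing Instance HSH.

Notation "f ~ g" := (sim f g) (at level 70, no associativity).
Notation "0" := (hzero S _ _).
Notation v A := (proj1_sig A).
Notation j := (re_j re).
Notation QC := (quot C sim).
Notation QCF := (quot CF sim).
Notation kp A B := (@kap T S E C X sim sh A B).
Notation rp A B := (@rep T S E C W CF sim re A B).
Notation local := (@local T S F sim).
Notation triv_fib := (@triv_fib T E W F).
Notation cyl := (cylobj S M).
Notation "[ f ]" := (@fmap T Hc L _ _ f) (at level 0).

Lemma Lc (A B D : T) (g : hom B D) (f : hom A B) : [g ∘ f] ≈ [g] ∘ [f].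
Proof. exact: (fmap_comp (proj1 (hl_add HH))). Qed.

Lemma Lid (A : T) : [idm A] ≈ idm _.
Proof. exact: (fmap_id (proj1 (hl_add HH))). Qed.

Lemma Le (A B : T) (f g : hom A B) : f ≈ g -> [f] ≈ [g].
Proof. exact: (fmap_heq (proj1 (hl_add HH))). Qed.

Lemma La (A B : T) (f g : hom A B) : [hadd S f g] ≈ hadd SH [f] [g].
Proof. exact: (proj2 (hl_add HH)). Qed.

Lemma Ls (A B : T) (f g : hom A B) : f ~ g -> [f] ≈ [g].
Proof. exact: (hl_sim HH). Qed.

(** Stable maps from objects of [C] to [Y] in [F] are maps in [Hc], where [f] is invertible. *)
Lemma Liso_local (A B : T) (f : hom A B) : C A -> C B -> is_iso [f] -> local f.
Proof.
move=> cA cB [g [gl gr]] Y fY; split.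
- move=> a; have [b eb] := hl_full HH ([a] ∘ g) cB fY; exists b.
  apply: (hl_faith HH cA fY); lc (Lc b f ⊕ eb ◁ [f] ⊕ [a] ▷ gl).
- move=> b eb; apply: (hl_faith HH cB fY); pose proof (Ls eb) as k.
  have z : [hzero S A Y] ≈ [hzero S B Y] ∘ [f].
    by apply: (@et _ (preadd_cat HSH) _ _ _ _ _ _ (Lc _ _)); apply: Le; ncat.
  lc (⊖ ([b] ▷ gr) ⊕ ⊖ (Lc b f ◁ g) ⊕ k ◁ g ⊕ z ◁ g ⊕ [hzero S B Y] ▷ gr).
Qed.

Lemma QCF_iso (A B : QCF) (f : hom (v A) (v B)) : is_iso [f] -> @is_iso QCF A B f.
Proof.
have cA := CF_C H (proj2_sig A); have cB := CF_C H (proj2_sig B).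
have fA := CF_F H (proj2_sig A); have fB := CF_F H (proj2_sig B).
move=> [g [gl gr]]; have [h eh] := hl_full HH g cB fA; exists h; split.
- change (h ∘ f ~ idm _); apply: (hl_faith HH cA fA).
  lc (Lc h f ⊕ eh ◁ [f] ⊕ gl ⊕ ⊖ (Lid (v A))).
- change (f ∘ h ~ idm _); apply: (hl_faith HH cB fB).
  lc (Lc f h ⊕ [f] ▷ eh ⊕ gr ⊕ ⊖ (Lid (v B))).
Qed.

Lemma L_QCF_iso (A B : QCF) (f : hom (v A) (v B)) : @is_iso QCF A B f -> is_iso [f].
Proof.
move=> [g [gl gr]]; change (@hom T (v B) (v A)) in g.
have k1 : [g ∘ f] ≈ [idm (v A)] := Ls gl; have k2 : [f ∘ g] ≈ [idm (v B)] := Ls gr.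
exists [g]; split.
- lc (⊖ (Lc g f) ⊕ k1 ⊕ Lid (v A)).
- lc (⊖ (Lc f g) ⊕ k2 ⊕ Lid (v B)).
Qed.

Lemma j_weq' (A : QC) : weq M (j A).
Proof. exact: (triv_cof_weq H (hl_weqE HH) (re_conf re A) (re_inC re A) (re_inW re A)). Qed.

(** [R f] is a stable isomorphism, and the two maps [j] are inverted by [L]. *)
Lemma local_Liso (A B : QC) (f : hom (v A) (v B)) : local f -> is_iso [f].
Proof.
move=> lf; have i := L_QCF_iso (local_rep H re lf); have [g [gl gr]] := i.
have [k [kl kr]] := hl_weq HH (j_weq' B); have [k' [kl' kr']] := hl_weq HH (j_weq' A).
have s := Le (rep_spec H re f).
have s' : [rp A B f] ∘ [j A] ≈ [j B] ∘ [f].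
  lc (⊖ (Lc (rp A B f) (j A)) ⊕ s ⊕ Lc (j B) f).
exists (k' ∘ (g ∘ [j B])); split.
- lc (⊖ ((k' ∘ g) ▷ s') ⊕ k' ▷ gl ◁ [j A] ⊕ kl').
- lc (⊖ (kl ◁ ([f] ∘ k' ∘ g ∘ [j B])) ⊕ ⊖ (k ▷ s' ◁ (k' ∘ g ∘ [j B]))
     ⊕ (k ∘ [rp A B f]) ▷ kr' ◁ (g ∘ [j B]) ⊕ k ▷ gr ◁ [j B] ⊕ kl).
Qed.

Lemma coker_C (A B D : T) (f : hom A B) (g : hom B D) : cof M f -> is_cokernel S f g ->
  E f g /\ C D.
Proof.
move=> /(hl_cof HH) [Z [d [c cZ]]] k; have c' := conf_coker HE c k; split=> //.
have [u [iu _]] := coker_iso HE (proj2 (ex_ker_coker HE c)) k.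
exact: (C_iso H iu cZ).
Qed.

Lemma cofibrant_C (A : T) : cofibrant S M A -> C A.
Proof.
move=> [O [zO c]]; apply: (proj2 (coker_C (D := A) (g := idm A) c _)); split; first ncat.
move=> V h _; exists h; split; first ncat.
by move=> u' eu; lc eu.
Qed.

Lemma C_cofibrant (A : T) : C A -> cofibrant S M A.
Proof.
move=> cA; have [O zO] := add_zero_ob HA; exists O; split=> //.
apply/(hl_cof HH); exists A, (idm A); split=> //; exact: conf_of_zero'.
Qed.

(** * Cylinders and cosyzygies *)

Section Cylinder.
Variable c : cyl.
Notation c0 := (cy_0 c).
Notation c1 := (cy_1 c).

Lemma cy_ob_C : C (cy_ob c). Proof. exact: (cofibrant_C (cy_cofibrant c)). Qed.

Lemma cy_conf : E (copair (cy_sum c) c0 c1) (cy_quo c).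
Proof. exact: (proj1 (coker_C (cy_cof c) (cy_coker c))). Qed.

Lemma cy_susp_C : C (cy_susp c).
Proof. exact: (proj2 (coker_C (cy_cof c) (cy_coker c))). Qed.

Definition cyA : QC := exist C (cy_ob c) cy_ob_C.
Definition cyU : QC := exist C (cy_susp c) cy_susp_C.

Lemma copair_in1 (V : T) (x y : hom (cy_ob c) V) : copair (cy_sum c) x y ∘ in1 (cy_sum c) ≈ x.
Proof. lc (x ▷ pr1_in1 (cy_sum c) ⊕ y ▷ pr2_in1 (cy_sum c)). Qed.

Lemma copair_in2 (V : T) (x y : hom (cy_ob c) V) : copair (cy_sum c) x y ∘ in2 (cy_sum c) ≈ y.
Proof. lc (x ▷ pr1_in2 (cy_sum c) ⊕ y ▷ pr2_in2 (cy_sum c)). Qed.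

(* [K0] is the cone [cy_cyl / cy_0]. *)
Lemma cone_conf : exists (K0 : T) (k0 : hom (cy_cyl c) K0) (s : hom K0 (cy_susp c)),
  E c0 k0 /\ E (k0 ∘ c1) s /\ s ∘ k0 ≈ cy_quo c /\ C K0 /\ W K0.
Proof.
have cs := biprod_conf HE hw (cy_sum c).
have [K0 [k0 [r [s [ck [cr_ [e1 e2]]]]]]] := noether HE cs cy_conf.
have ck0 : E c0 k0 by apply: (conf_heq HE _ (er _) ck); exact: copair_in1.
have er_ : r ≈ k0 ∘ c1.
  lc (⊖ (r ▷ pr2_in2 (cy_sum c)) ⊕ e1 ◁ in2 (cy_sum c) ⊕ k0 ▷ copair_in2 c0 c1).
exists K0, k0, s; split=> //; split; first exact: (conf_heq HE er_ (er _) cr_).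
split=> //; split; first exact: (C_ext H cr_ cy_ob_C cy_susp_C).
(* For [K0] in [W]: factor [cy_pr] as [p i]. Then [i c0] is a section of [p], so its cokernel is the
   kernel [N] of [p], and the isomorphism theorem gives a conflation [K0 -> N -> V] with [N] and [V]
   in [W]. *)
have [D [i [p [ep [[V [d [ci [cV wV]]]] [N [n [cn [fN wN]]]]]]]]] :=
  proj1 (hl_weqE HH _) (cy_weq c).
have sp : p ∘ (i ∘ c0) ≈ idm _ by lc (⊖ (ep ◁ c0) ⊕ cy_pr0 c).
have [rr [_ crr]] := split_conf HE hw cn sp.
have [x [y [cxy _]]] := noether_given HE ck0 ci crr.
exact: (proj2 (proj2 (W_2of3 H cxy)) wN wV).
Qed.

Lemma cy_extend (Y : T) (x y : hom (cy_ob c) Y) : F Y -> W Y ->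
  exists l : hom (cy_cyl c) Y, l ∘ c0 ≈ x /\ l ∘ c1 ≈ y.
Proof.
move=> fY wY; have [|l el] := extend H (copair (cy_sum c) x y) cy_conf cy_susp_C fY.
  by right.
exists l; split.
- lc (⊖ (l ▷ copair_in1 c0 c1) ⊕ el ◁ in1 (cy_sum c) ⊕ copair_in1 x y).
- lc (⊖ (l ▷ copair_in2 c0 c1) ⊕ el ◁ in2 (cy_sum c) ⊕ copair_in2 x y).
Qed.

(* Comparison of the suspension computed with a cylinder with the cosyzygy. *)
Definition theta (th : hom (cy_susp c) (v (sh_U sh cyA))) : Prop :=
  exists l : hom (cy_cyl c) (sh_X sh cyA),
    l ∘ c0 ≈ hzero S _ _ /\ l ∘ c1 ≈ sh_i sh cyA /\ th ∘ cy_quo c ≈ sh_p sh cyA ∘ l.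

Lemma theta_exists : exists th, theta th.
Proof.
have xA := sh_inX sh cyA.
have [l [l0 l1]] := cy_extend (hzero S _ _) (sh_i sh cyA) (X_F H xA) (X_W H xA).
have [|th eth] := conf_desc HE (h := sh_p sh cyA ∘ l) cy_conf.
  lc (sh_p sh cyA ▷ l0 ◁ pr1 (cy_sum c) ⊕ sh_p sh cyA ▷ l1 ◁ pr2 (cy_sum c)
      ⊕ conf_zero HE (sh_conf sh cyA) ◁ pr2 (cy_sum c)).
by exists th, l.
Qed.

(** The conflations of the cone [K0] and of [X^A] both start at [A] and have middle term in [C ∩ W].
    Through [adj], stable maps from either cokernel to [Y] are the stable maps from [A] to a loop
    object of [Y]. *)
Lemma theta_local (th : hom (cy_susp c) (v (sh_U sh cyA))) : theta th -> local th.
Proof.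
move=> [l [l0 [l1 lt]]] Y fY.
have [K0 [k0 [s [ck [cs [es_ [cK wK]]]]]]] := cone_conf.
have [lb elb] := conf_desc HE ck l0.
have e1 : lb ∘ (k0 ∘ c1) ≈ sh_i sh cyA ∘ idm _ by lc (elb ◁ c1 ⊕ l1).
have e2 : th ∘ s ≈ sh_p sh cyA ∘ lb.
  by apply: (conf_epi HE ck); lc (th ▷ es_ ⊕ lt ⊕ ⊖ (sh_p sh cyA ▷ elb)).
have [J [N [q [n [cn [xJ fN]]]]]] := loop_exists H fY.
have [fJ wJ] := (X_F H xJ, X_W H xJ); have xA := sh_inX sh cyA.
have cA := sh_conf sh cyA; have cU := sh_C sh cyA.
split.
- move=> al; have [a ha] := adj_total_r H cs cn cK wK fN al.
  have [be hb] := adj_total_l H cA cn cU fJ wJ a; exists be.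
  have hb' := adj_comp_r H e1 e2 hb.
  apply: (adj_uniq_l H cs cn cy_susp_C fJ wJ hb' ha); sncat.
- move=> be eb; have [a ha] := adj_total_r H cA cn (X_C H xA) (X_W H xA) fN be.
  have ha' := adj_comp_r H e1 e2 ha.
  have z : adj (k0 ∘ c1) s n q (hzero S _ _) (hzero S _ _).
    by exists (hzero S _ _); split; ncat.
  have z' : adj (sh_i sh cyA) (sh_p sh cyA) n q (hzero S _ _) (hzero S _ _).
    by exists (hzero S _ _); split; ncat.
  have n0 := adj_uniq_r H cs cn cK wK fN ha' z eb.
  apply: (adj_uniq_l H cA cn cU fJ wJ ha z'); lc n0.
Qed.
End Cylinder.
#[local] Hint Transparent cyA cyU : object_conv.

Lemma theta_nat (c d : cyl) (f : hom (cy_ob c) (cy_ob d)) s th th' :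
  cyl_susp_map f s -> theta th -> theta th' -> th' ∘ s ~ kp (cyA c) (cyA d) f ∘ th.
Proof.
move=> [k [[k1 [k2 _]] ks]] [l [l0 [l1 lt]]] [l' [l0' [l1' lt']]].
have [sg [s1 s2]] := kap_spec H sh (A := cyA c) (B := cyA d) f.
have xA := sh_inX sh (cyA d).
have n : hadd S (th' ∘ s) (hopp S (kp (cyA c) (cyA d) f ∘ th)) ~ 0.
{ apply: (coker_null H (cy_conf c) (cy_susp_C c) (sh_conf sh (cyA d)) (X_F H xA) (X_W H xA)
    (x := hadd S (l' ∘ k) (hopp S (sg ∘ l))) (a := hzero S _ _)).
  - lc (l' ▷ k1 ◁ pr1 (cy_sum c) ⊕ l' ▷ k2 ◁ pr2 (cy_sum c) ⊕ l0' ◁ (f ∘ pr1 (cy_sum c))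
      ⊕ l1' ◁ (f ∘ pr2 (cy_sum c)) ⊕ ⊖ (sg ▷ l0 ◁ pr1 (cy_sum c))
      ⊕ ⊖ (sg ▷ l1 ◁ pr2 (cy_sum c)) ⊕ ⊖ (s1 ◁ pr2 (cy_sum c))).
  - lc (th' ▷ ks ⊕ lt' ◁ k ⊕ ⊖ (kp (cyA c) (cyA d) f ▷ lt) ⊕ ⊖ (s2 ◁ l)).
  - sncat. }
lc n.
Qed.

(** Translates [susp_rel] into shifts. If [phi] is [j^-1 f], extending [b] along the weak
    equivalence [j] gives [b'] with [b' f] stably [a]; naturality of [theta] along [f] and [j] does
    the rest. *)
Lemma susp_theta (c c' : cyl) (phi : hom (L (cy_ob c)) (L (cy_ob c'))) psi
    (Y : QC) (a : hom (cy_ob c) (v Y)) (b : hom (cy_ob c') (v Y)) th th' :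
  F (v Y) -> susp_rel phi psi -> theta th -> theta th' -> [a] ≈ [b] ∘ phi ->
  [kp (cyA c') Y b ∘ th'] ∘ psi ≈ [kp (cyA c) Y a ∘ th].
Proof.
move=> fY [d [f [jj [s [t [wj [ms [mt [ephi epsi]]]]]]]]] hth hth' eab.
have [thd hthd] := theta_exists d.
have lj := Liso_local (cy_ob_C c') (cy_ob_C d) (hl_weq HH wj).
have [b' eb'] := proj1 (lj _ fY) b.
have n1 := theta_nat ms hth hthd; have n2 := theta_nat mt hth' hthd.
have q1 := kap_sim H sh (A := cyA c') (B := Y) eb'.
have q2 := kap_comp H sh (A := cyA c') (B := cyA d) (D := Y) b' jj.
have ea : b' ∘ f ~ a.
  apply: (hl_faith HH (cy_ob_C c) fY); pose proof (Ls eb') as k.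
  lc (Lc b' f ⊕ ⊖ ([b'] ▷ ephi) ⊕ ⊖ (Lc b' jj ◁ phi) ⊕ k ◁ phi ⊕ ⊖ eab).
have q3 := kap_sim H sh (A := cyA c) (B := Y) ea.
have q4 := kap_comp H sh (A := cyA c) (B := cyA d) (D := Y) b' f.
have r1 : kp (cyA c') Y b ∘ th' ~ (kp (cyA d) Y b' ∘ thd) ∘ t.
  lc (⊖' (q1 ◁' th') ⊕' ⊖' (q2 ◁' th') ⊕' ⊖' (kp (cyA d) Y b' ▷' n2)).
have r2 : kp (cyA c) Y a ∘ th ~ (kp (cyA d) Y b' ∘ thd) ∘ s.
  lc (⊖' (q3 ◁' th) ⊕' ⊖' (q4 ◁' th) ⊕' ⊖' (kp (cyA d) Y b' ▷' n1)).
pose proof (Ls r1) as k1; pose proof (Ls r2) as k2.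
lc (k1 ◁ psi ⊕ Lc (kp (cyA d) Y b' ∘ thd) t ◁ psi ⊕ [kp (cyA d) Y b' ∘ thd] ▷ epsi
    ⊕ ⊖ (Lc (kp (cyA d) Y b' ∘ thd) s) ⊕ ⊖ k2).
Qed.

(** The kernel [U] of the deflation [A ⊕ Q -> B] is embedded into an object of [W ∩ F] with cokernel
    in [C]. The pushout turns the deflation into a trivial fibration, and [A -> Z] has cokernel an
    extension of objects of [C]. *)
Lemma factorization (A B : T) (f : hom A B) : exists (Z : T) (i : hom A Z) (p : hom Z B),
  cof M i /\ triv_fib p /\ p ∘ i ≈ f.
Proof.
have [N [Q [n [q [cn [wN [fN cQ]]]]]]] := hs_cof_repl H B.
have [P] := add_biprod HA A Q.
have [U [b [p2 [n2 [po [_ _]]]]]] := pull HE f cn.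
have [u0 cP] : exists u0 : hom U P, E u0 (hadd S (f ∘ pr1 P) (q ∘ pr2 P)).
  by eexists; exact: (pushout_biprod_conf (op_exact HE) (op_wic HE hw) (op_biprod P)
    (cn : opE E q n) po).
have [C0 [F0 [dF [iF [cF [wF [fF cC]]]]]]] := hs_fib_triv H U.
have [Z [k [l [p [pz [cz ez]]]]]] := push HE iF cP.
have [dk [ck _]] := pushout_conf HE cF (pushout_sym HE pz).
have [Z' [d' [r [s [c4 [c5 _]]]]]] := noether HE (biprod_conf HE hw P) ck.
exists Z, (k ∘ in1 P), p; split.
  by apply/(hl_cof HH); exists Z', d'; split=> //; exact: (C_ext H c5 cQ cC).
split; first by exists F0, l.
lc (ez ◁ in1 P ⊕ f ▷ pr1_in1 P ⊕ q ▷ pr2_in1 P).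
Qed.

Lemma triv_fib_weq' (A B : T) (p : hom A B) : triv_fib p -> weq M p.
Proof. exact: (triv_fib_weq H (hl_weqE HH)). Qed.

Lemma cyl_susp_map_exists (c d : cyl) (f : hom (cy_ob c) (cy_ob d)) :
  triv_fib (cy_pr d) -> exists s, cyl_susp_map f s.
Proof.
move=> [N [n [cn [fN wN]]]].
have [|k [k1 k2]] := lifting HE (a := copair (cy_sum c) (cy_0 d ∘ f) (cy_1 d ∘ f))
    (b := f ∘ cy_pr c) (cy_conf c) cn (hs_ext H (cy_susp_C c) fN (or_intror wN)).
  lc (cy_pr0 d ◁ (f ∘ pr1 (cy_sum c)) ⊕ cy_pr1 d ◁ (f ∘ pr2 (cy_sum c))
      ⊕ ⊖ (f ▷ cy_pr0 c ◁ pr1 (cy_sum c)) ⊕ ⊖ (f ▷ cy_pr1 c ◁ pr2 (cy_sum c))).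
have [|s es_] := conf_desc HE (h := cy_quo d ∘ k) (cy_conf c).
  have z := conf_zero HE (cy_conf d).
  have z1 := copair_in1 (cy_0 d) (cy_1 d); have z2 := copair_in2 (cy_0 d) (cy_1 d).
  lc (cy_quo d ▷ k1 ⊕ ⊖ (cy_quo d ▷ z1 ◁ (f ∘ pr1 (cy_sum c)))
     ⊕ ⊖ (cy_quo d ▷ z2 ◁ (f ∘ pr2 (cy_sum c))) ⊕ z ◁ (in1 (cy_sum d) ∘ f ∘ pr1 (cy_sum c))
     ⊕ z ◁ (in2 (cy_sum d) ∘ f ∘ pr2 (cy_sum c))).
exists s, k; split=> //; split.
  lc (⊖ (k ▷ copair_in1 (cy_0 c) (cy_1 c)) ⊕ k1 ◁ in1 (cy_sum c)
      ⊕ copair_in1 (cy_0 d ∘ f) (cy_1 d ∘ f)).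
split=> //.
  lc (⊖ (k ▷ copair_in2 (cy_0 c) (cy_1 c)) ⊕ k1 ◁ in2 (cy_sum c)
      ⊕ copair_in2 (cy_0 d ∘ f) (cy_1 d ∘ f)).
Qed.

(** Factoring the codiagonal gives a cylinder whose projection is a trivial fibration, so that maps
    of cylinders into it can be constructed by lifting. *)
Lemma cyl_exists (B : T) : C B -> exists d : cyl, cy_ob d = B /\ triv_fib (cy_pr d).
Proof.
move=> cB; have [P] := add_biprod HA B B.
have [Z [i [p [ci [tp ep]]]]] := factorization (hadd S (pr1 P) (pr2 P)).
have [Q [q [cq cQ]]] := proj1 (hl_cof HH _) ci.
have ei : i ≈ copair P (i ∘ in1 P) (i ∘ in2 P) by lc (⊖ (i ▷ in_pr P)).
pose proof (conf_heq HE ei (er q) cq) as cq'.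
have p0 : p ∘ (i ∘ in1 P) ≈ idm _ by lc (ep ◁ in1 P ⊕ pr1_in1 P ⊕ pr2_in1 P).
have p1 : p ∘ (i ∘ in2 P) ≈ idm _ by lc (ep ◁ in2 P ⊕ pr1_in2 P ⊕ pr2_in2 P).
have cc : cof M (copair P (i ∘ in1 P) (i ∘ in2 P)) by apply/(hl_cof HH); exists Q, q.
by exists (Build_cylobj (C_cofibrant cB) p0 p1 cc (triv_fib_weq' tp)
  (proj2 (ex_ker_coker HE cq'))).
Qed.

(** The suspension [t] of [w] is inverted by [L], since [theta] compares it with the shift of [w];
    this lets the equation for [psi] be solved. *)
Lemma susp_exists_via (c c' : cyl) (phi : hom (L (cy_ob c)) (L (cy_ob c'))) (B : T)
    (f : hom (cy_ob c) B) (w : hom (cy_ob c') B) :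
  C B -> weq M w -> [w] ∘ phi ≈ [f] -> exists psi, susp_rel phi psi.
Proof.
move=> cB ww ef; have [d [e_ tp]] := cyl_exists cB; subst B.
have [s ms] := @cyl_susp_map_exists c d f tp.
have [t mt] := @cyl_susp_map_exists c' d w tp.
have [th hth] := theta_exists c'; have [thd hthd] := theta_exists d.
have n := theta_nat mt hth hthd; pose proof (Ls n) as k.
have [x [xl xr]] := local_Liso (A := cyU d) (B := sh_U sh (cyA d)) (theta_local hthd).
have [y [yl yr]] := local_Liso (A := cyU c') (B := sh_U sh (cyA c')) (theta_local hth).
have lw := Liso_local (cy_ob_C c') (cy_ob_C d) (hl_weq HH ww).
have [z [zl zr]] := local_Liso (A := sh_U sh (cyA c')) (B := sh_U sh (cyA d))
  (local_kap H sh (A := cyA c') (B := cyA d) lw).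
have k' : [thd] ∘ [t] ≈ [kp (cyA c') (cyA d) w] ∘ [th].
  lc (⊖ (Lc thd t) ⊕ k ⊕ Lc (kp (cyA c') (cyA d) w) th).
exists (y ∘ (z ∘ ([thd] ∘ [s]))).
exists d, f, w, s, t; split=> //; split=> //; split=> //; split=> //.
lc (⊖ (xl ◁ ([t] ∘ y ∘ z ∘ [thd] ∘ [s])) ⊕ x ▷ k' ◁ (y ∘ z ∘ [thd] ∘ [s])
   ⊕ (x ∘ [kp (cyA c') (cyA d) w]) ▷ yr ◁ (z ∘ [thd] ∘ [s])
   ⊕ x ▷ zr ◁ ([thd] ∘ [s]) ⊕ xl ◁ [s]).
Qed.

Lemma susp_exists (c c' : cyl) (phi : hom (L (cy_ob c)) (L (cy_ob c'))) :
  exists psi, susp_rel phi psi.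
Proof.
have [f ef] := hl_full HH ([j (cyA c')] ∘ phi) (cy_ob_C c) (re_F H re (cyA c')).
exact: (susp_exists_via (re_C H re (cyA c')) (j_weq' (cyA c')) (es ef)).
Qed.
End Susp.

(** * Cofibre sequences and right triangles *)

Section Compare.
Context {T : precat} {S : addstr T} {E : conf_class T} {C W F X CF : T -> Prop}.
Context {sim : rel_class T}.
Hypothesis H : hovey_setup S E C W F X CF sim.
Variables (sh : shift_choice E C X) (hCF : forall A, CF A -> C A) (re : repl_choice E C W CF).
Variables (M : model_data T) (Hc : precat) (SH : addstr Hc) (L : fdata T Hc).
Variables (K : fdata (img L) (quot CF sim)).
Variables (e : forall A : T, hom (L A) (L (proj1_sig (K A)))).
Variables (e' : forall A : T, hom (L (proj1_sig (K A))) (L A)).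
Hypothesis HH : ho_setup S E C W F M SH e e'.
Variable su : susp_choice S M.
Let HE : exact_category S E := hs_exact H.
Let HA : additive S := ex_additive HE.
Let HS : preadditive S := add_preadditive HA.
#[local] Existing Instance HS.
Let Hsim := sim_cong H.
#[local] Existing Instance Hsim.
Let HSH : preadditive SH := hl_pre HH.
#[local] Existing Instance HSH.
Let HQ : preadditive (quotS S CF sim) := quot_preadditive H CF.

Notation "f ~ g" := (sim f g) (at level 70, no associativity).
Notation "0" := (hzero S _ _).
Notation v A := (proj1_sig A).
Notation j := (re_j re).
Notation QC := (quot C sim).
Notation QCF := (quot CF sim).
Notation "'ι' A" := (@fob QCF QC (incl sim hCF) A) (at level 9, A at level 9).
Notation Psi := (subfactor_shift S sim hCF sh re).
Notation Tri := (@subfactor_triangles T S E C W X sim CF hCF sh re).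
Notation kp A B := (@kap T S E C X sim sh A B).
Notation rp A B := (@rep T S E C W CF sim re A B).
Notation cyl := (cylobj S M).
Notation "[ f ]" := (@fmap T Hc L _ _ f) (at level 0).
Notation Km phi := (@fmap (img L) (quot CF sim) K _ _ phi).
Notation Sg := (@suspension T S M Hc L su).
Notation cc A := (su_cyl su A).
#[local] Hint Transparent cyA cyU : object_conv.
Notation cyA c := (cyA H HH c).
Notation cyU c := (cyU H HH c).
Notation theta := (@theta T S E C W F X CF sim H sh M Hc SH L K e e' HH).
Let Lc := Lc HH.
Let Ls := Ls HH.
Let Le := Le HH.

Lemma K_C (A : T) : C (v (K A)). Proof. exact: (CF_C H (proj2_sig _)). Qed.
Lemma K_F (A : T) : F (v (K A)). Proof. exact: (CF_F H (proj2_sig _)). Qed.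

Lemma e_cancel (A : T) (D : Hc) (x y : hom (L (v (K A))) D) : x ∘ e A ≈ y ∘ e A -> x ≈ y.
Proof. by move=> k; lc (⊖ (x ▷ hl_er HH A) ⊕ k ◁ e' A ⊕ y ▷ hl_er HH A). Qed.

Lemma e_nat (A B : T) (phi : hom (L A) (L B)) :
  [Km phi : @hom T (v (K A)) (v (K B))] ∘ e A ≈ e B ∘ phi.
Proof. exact: (hl_nat HH). Qed.

(* [t] compares the suspension, computed with the chosen cylinder of [A], with the
   shift of the bifibrant object [K A]. *)
Definition t_spec (A : T)
    (t : hom (v (K (susp_ob su A))) (v (re_R re (sh_U sh (ι (K A)))))) : Prop :=
  exists (a : hom (cy_ob (cc A)) (v (K A))) (th : hom (cy_susp (cc A)) _),
    [a] ≈ e A ∘ [su_rep su A] /\ theta th /\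
    [t] ∘ e (susp_ob su A) ≈ [j (sh_U sh (ι (K A))) ∘ (kp (cyA (cc A)) (ι (K A)) a ∘ th)].

Lemma t_exists (A : T) : exists t, @t_spec A t.
Proof.
have [a ha] := hl_full HH (e A ∘ [su_rep su A]) (cy_ob_C H HH (cc A)) (K_F A).
have [th hth] := theta_exists H sh HH (cc A).
have [t ht] := hl_full HH
  ([j (sh_U sh (ι (K A))) ∘ (kp (cyA (cc A)) (ι (K A)) a ∘ th)] ∘ e' (susp_ob su A))
  (K_C (susp_ob su A)) (re_F H re (sh_U sh (ι (K A)))).
exists t, a, th; split=> //; split=> //.
lc (ht ◁ e (susp_ob su A)
  ⊕ [j (sh_U sh (ι (K A))) ∘ (kp (cyA (cc A)) (ι (K A)) a ∘ th)] ▷ hl_el HH (susp_ob su A)).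
Qed.

Lemma t_iso (A : T) t : @t_spec A t ->
  @is_iso QCF (K (susp_ob su A)) (re_R re (sh_U sh (ι (K A)))) t.
Proof.
move=> [a [th [ha [hth ht]]]]; apply: (QCF_iso H HH).
have ie : is_iso (e' (susp_ob su A)).
  by exists (e (susp_ob su A)); split; [exact: (hl_er HH) | exact: (hl_el HH)].
have ia : is_iso [a].
  apply: (iso_heq (es ha)); apply: iso_comp; last exact: (hl_weq HH (su_weq su A)).
  by exists (e' A); split; [exact: (hl_el HH) | exact: (hl_er HH)].
have la := Liso_local H HH (cy_ob_C H HH (cc A)) (K_C A) ia.
have i1 := local_Liso H re HH (A := cyU (cc A)) (B := sh_U sh (cyA (cc A)))
  (theta_local hth).
have i2 := local_Liso H re HH (A := sh_U sh (cyA (cc A))) (B := sh_U sh (ι (K A)))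
  (local_kap H sh (A := cyA (cc A)) (B := ι (K A)) la).
have i3 := hl_weq HH (j_weq' H re HH (sh_U sh (ι (K A)))).
apply: (iso_heq (f := [j (sh_U sh (ι (K A)))] ∘ ([kp (cyA (cc A)) (ι (K A)) a] ∘ [th])
  ∘ e' (susp_ob su A))).
  have k1 := Lc (j (sh_U sh (ι (K A)))) (kp (cyA (cc A)) (ι (K A)) a ∘ th).
  have k2 := Lc (kp (cyA (cc A)) (ι (K A)) a) th.
  lc (⊖ (k1 ◁ e' (susp_ob su A)) ⊕ ⊖ ([j (sh_U sh (ι (K A)))] ▷ k2 ◁ e' (susp_ob su A))
     ⊕ ⊖ (ht ◁ e' (susp_ob su A)) ⊕ [t] ▷ hl_er HH (susp_ob su A)).
apply: iso_comp ie; apply: iso_comp i3 _; exact: iso_comp i2 i1.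
Qed.

Lemma Sg_spec (A B : T) (phi : hom (L A) (L B)) :
  exists phi' : hom (L (cy_ob (cc A))) (L (cy_ob (cc B))),
    [su_rep su B] ∘ phi' ≈ phi ∘ [su_rep su A] /\ susp_rel phi' (fmap Sg phi : hom (L _) (L _)).
Proof.
have [psi [phi' k]] : exists psi, exists phi' : hom (L (cy_ob (cc A))) (L (cy_ob (cc B))),
    [su_rep su B] ∘ phi' ≈ phi ∘ [su_rep su A] /\ susp_rel phi' psi.
  have [r [rl rr]] := hl_weq HH (su_weq su B).
  have [psi k] := susp_exists H sh re HH (r ∘ (phi ∘ [su_rep su A])).
  exists psi, (r ∘ (phi ∘ [su_rep su A])); split=> //; lc (rr ◁ (phi ∘ [su_rep su A])).
exact: (epsilon_spec (inhabits [hzero S (susp_ob su A) (susp_ob su B)])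
  (fun psi => exists phi' : hom (L (cy_ob (cc A))) (L (cy_ob (cc B))),
    [su_rep su B] ∘ phi' ≈ phi ∘ [su_rep su A] /\ susp_rel phi' psi)
  (ex_intro _ psi (ex_intro _ phi' k))).
Qed.

Lemma t_nat (A B : T) (phi : hom (L A) (L B)) t t' : @t_spec A t -> @t_spec B t' ->
  t' ∘ Km (fmap Sg phi) ~
    rp (sh_U sh (ι (K A))) (sh_U sh (ι (K B))) (kp (ι (K A)) (ι (K B)) (Km phi)) ∘ t.
Proof.
move=> [a [th [ha [hth ht]]]] [b [th' [hb [hth' ht']]]].
have [phi' [k1 k2]] := Sg_spec phi.
pose psi : hom (L (susp_ob su A)) (L (susp_ob su B)) := fmap Sg phi.
change (susp_rel phi' psi) in k2.
pose f : hom (v (K A)) (v (K B)) := Km phi.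
have q := susp_theta (Y := ι (K B)) (a := f ∘ a) (b := b) (K_F B) k2 hth hth'.
have {}q : [kp (cyA (cc B)) (ι (K B)) b ∘ th'] ∘ psi ≈
    [kp (cyA (cc A)) (ι (K B)) (f ∘ a) ∘ th].
  apply: q; have n := e_nat phi.
  lc (Lc f a ⊕ [f] ▷ ha ⊕ n ◁ [su_rep su A] ⊕ ⊖ (e B ▷ k1) ⊕ ⊖ (hb ◁ phi')).
pose kf := kp (ι (K A)) (ι (K B)) f.
pose rf := rp (sh_U sh (ι (K A))) (sh_U sh (ι (K B))) kf.
pose m : hom (v (K (susp_ob su A))) (v (K (susp_ob su B))) := Km psi.
change (t' ∘ m ~ rf ∘ t).
apply: (hl_faith HH (K_C _) (re_F H re (sh_U sh (ι (K B))))); apply: (e_cancel (A := susp_ob su A)).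
have n : [m] ∘ e (susp_ob su A) ≈ e (susp_ob su B) ∘ psi := e_nat psi.
have s1 := Lc (j (sh_U sh (ι (K B)))) (kp (cyA (cc B)) (ι (K B)) b ∘ th').
have s2 : j (sh_U sh (ι (K B))) ∘ (kp (cyA (cc A)) (ι (K B)) (f ∘ a) ∘ th) ~
    rf ∘ (j (sh_U sh (ι (K A))) ∘ (kp (cyA (cc A)) (ι (K A)) a ∘ th)).
  have r := rep_spec H re kf; have kc := kap_comp H sh (A := cyA (cc A)) (B := ι (K A))
    (D := ι (K B)) f a.
  lc (! (⊖ (r ◁ (kp (cyA (cc A)) (ι (K A)) a ∘ th))) ⊕' ⊖' (j (sh_U sh (ι (K B))) ▷' kc ◁' th)).
have s3 := Ls s2.
have s4 := Lc (j (sh_U sh (ι (K B)))) (kp (cyA (cc A)) (ι (K B)) (f ∘ a) ∘ th).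
have s5 := Lc rf (j (sh_U sh (ι (K A))) ∘ (kp (cyA (cc A)) (ι (K A)) a ∘ th)).
have s6 := Lc t' m; have s7 := Lc rf t.
lc (s6 ◁ e (susp_ob su A) ⊕ [t'] ▷ n ⊕ ht' ◁ psi ⊕ s1 ◁ psi
    ⊕ [j (sh_U sh (ι (K B)))] ▷ q ⊕ ⊖ s4 ⊕ s3 ⊕ s5 ⊕ ⊖ ([rf] ▷ ht) ⊕ ⊖ (s7 ◁ e (susp_ob su A))).
Qed.

(** Take [mu : Cyl B -> X^A] that is zero on one end and [delta] on the other. Then [p^A mu]
    descends to [rho : Z -> U^A], which is zero on [n0], equals [xi] on [n1], and gives a [theta]
    map on the suspension of [A]. Applying [rho] to the coaction yields the claim. *)
Lemma boundary_theta (cA cB : cyl) (D : QC) (f : hom (cy_ob cA) (cy_ob cB))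
    (g : hom (cy_ob cB) (v D)) xi (d : hom (L (v D)) (L (cy_susp cA))) :
  cofibre_boundary f g d -> ctri (sh := sh) (A := cyA cA) (B := cyA cB) f g xi ->
  exists th, theta th /\ [th] ∘ d ≈ [xi].
Proof.
move=> [_ [_ [k [[k0 [k1 _]] [_ [Z [z [n0 [n1 [t [kz [z0 [z1 [zt [P [m [em ed]]]]]]]]]]]]]]]]].
move=> [delta [cf [d1 d2]]]; have xA := sh_inX sh (cyA cA).
have [mu [m0 m1]] := cy_extend H HH (hzero S (cy_ob cB) _) delta (X_F H xA) (X_W H xA).
have [|rho er_] := proj2 kz _ (sh_p sh (cyA cA) ∘ mu).
  have z2 := conf_zero HE (sh_conf sh (cyA cA)).
  lc (sh_p sh (cyA cA) ▷ m0 ◁ (f ∘ pr1 (cy_sum cA)) ⊕ sh_p sh (cyA cA) ▷ m1 ◁ (f ∘ pr2 (cy_sum cA))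
     ⊕ sh_p sh (cyA cA) ▷ d1 ◁ pr2 (cy_sum cA) ⊕ z2 ◁ pr2 (cy_sum cA)).
have {}er_ := proj1 er_.
exists (rho ∘ t); split.
  exists (mu ∘ k); split; first by lc (mu ▷ k0 ⊕ m0 ◁ f).
  split; first by lc (mu ▷ k1 ⊕ m1 ◁ f ⊕ d1).
  lc (rho ▷ zt ⊕ er_ ◁ k).
have r0 : rho ∘ n0 ≈ 0.
  by apply: (conf_epi HE cf); lc (rho ▷ z0 ⊕ er_ ◁ cy_0 cB ⊕ sh_p sh (cyA cA) ▷ m0).
have r1 : rho ∘ n1 ≈ xi.
  apply: (conf_epi HE cf); lc (rho ▷ z1 ⊕ er_ ◁ cy_1 cB ⊕ sh_p sh (cyA cA) ▷ m1 ⊕ ⊖ d2).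
have s1 : [rho ∘ copair P n0 t] ≈ [rho ∘ t ∘ pr2 P] by apply: Le; lc (r0 ◁ pr1 P).
lc ([rho ∘ t] ▷ ed ⊕ ⊖ (Lc (rho ∘ t) (pr2 P) ◁ m) ⊕ ⊖ (s1 ◁ m) ⊕ Lc rho (copair P n0 t) ◁ m
   ⊕ [rho] ▷ em ⊕ ⊖ (Lc rho n1) ⊕ Le r1).
Qed.

Definition rel_cyl (cA cB : cyl) (f : hom (cy_ob cA) (cy_ob cB)) : Prop :=
  exists k : hom (cy_cyl cA) (cy_cyl cB), cyl_map f k /\
  exists (P : T) (u : hom (cy_sum cB) P) (w : hom (cy_cyl cA) P) (e : hom P (cy_cyl cB)),
     is_pushout (copair (cy_sum cA) (in1 (cy_sum cB) ∘ f) (in2 (cy_sum cB) ∘ f))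
       (copair (cy_sum cA) (cy_0 cA) (cy_1 cA)) u w /\
     e ∘ u ≈ copair (cy_sum cB) (cy_0 cB) (cy_1 cB) /\ e ∘ w ≈ k /\ cof M e.

(* [R] transports whatever is known of [f] and [g] along [cy_ob cB = B]. *)
Lemma rel_cyl_exists (cA : cyl) (B D : T) (f : hom (cy_ob cA) B) (g : hom B D)
    (R : forall B' : T, hom (cy_ob cA) B' -> hom B' D -> Prop) : C B -> R B f g ->
  exists (cB : cyl) (f' : hom (cy_ob cA) (cy_ob cB)) (g' : hom (cy_ob cB) D),
    R (cy_ob cB) f' g' /\ rel_cyl f'.
Proof.
move=> cB r; have [PB] := add_biprod HA B B.
pose ff := copair (cy_sum cA) (in1 PB ∘ f) (in2 PB ∘ f).
have [P [w [u [dP [po [cu _]]]]]] := push HE ff (cy_conf H HH cA).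
have po' := pushout_sym HE po.
have [|l [l1 [l2 _]]] := proj2 po' B (hadd S (pr1 PB) (pr2 PB)) (f ∘ cy_pr cA).
  rewrite /ff; lc ((pr1_in1 PB ⊕ pr2_in1 PB) ◁ (f ∘ pr1 (cy_sum cA))
     ⊕ (pr1_in2 PB ⊕ pr2_in2 PB) ◁ (f ∘ pr2 (cy_sum cA))
     ⊕ ⊖ (f ▷ cy_pr0 cA ◁ pr1 (cy_sum cA)) ⊕ ⊖ (f ▷ cy_pr1 cA ◁ pr2 (cy_sum cA))).
(* Factoring the map [l] on the gluing of [B ⊕ B] with [Cyl A], rather than the codiagonal of [B],
   makes the relative map [e] a cofibration. *)
have [Z [i [p [ci [tp ep]]]]] := factorization H HH l.
have [Q1 [q1 [cq1 cQ1]]] := proj1 (hl_cof HH _) ci.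
have [Q [q [r0 [s0 [cq [c0 _]]]]]] := noether HE cu cq1.
have cQ : C Q := C_ext H c0 (cy_susp_C H HH cA) cQ1.
have ei : i ∘ u ≈ copair PB (i ∘ u ∘ in1 PB) (i ∘ u ∘ in2 PB) by lc (⊖ ((i ∘ u) ▷ in_pr PB)).
pose proof (conf_heq HE ei (er q) cq) as cq'.
have p0 : p ∘ (i ∘ u ∘ in1 PB) ≈ idm _.
  lc (ep ◁ (u ∘ in1 PB) ⊕ l1 ◁ in1 PB ⊕ pr1_in1 PB ⊕ pr2_in1 PB).
have p1 : p ∘ (i ∘ u ∘ in2 PB) ≈ idm _.
  lc (ep ◁ (u ∘ in2 PB) ⊕ l1 ◁ in2 PB ⊕ pr1_in2 PB ⊕ pr2_in2 PB).
have ccof : cof M (copair PB (i ∘ u ∘ in1 PB) (i ∘ u ∘ in2 PB)).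
  by apply/(hl_cof HH); exists Q, q.
exists (Build_cylobj (C_cofibrant H HH cB) p0 p1 ccof (triv_fib_weq' H HH tp)
  (proj2 (ex_ker_coker HE cq'))), f, g; split; first exact: r.
exists (i ∘ w); split.
  have e1 := proj1 po'; rewrite /ff in e1.
  have a1 := pr1_in1 (cy_sum cA); have a2 := pr2_in1 (cy_sum cA).
  have b1 := pr1_in2 (cy_sum cA); have b2 := pr2_in2 (cy_sum cA).
  split=> /=.
    lc (⊖ (i ▷ e1 ◁ in1 (cy_sum cA)) ⊕ ⊖ ((i ∘ w ∘ cy_0 cA) ▷ a1) ⊕ ⊖ ((i ∘ w ∘ cy_1 cA) ▷ a2)
       ⊕ (i ∘ u ∘ in1 PB ∘ f) ▷ a1 ⊕ (i ∘ u ∘ in2 PB ∘ f) ▷ a2).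
  split; last by lc (ep ◁ w ⊕ l2).
  lc (⊖ (i ▷ e1 ◁ in2 (cy_sum cA)) ⊕ ⊖ ((i ∘ w ∘ cy_0 cA) ▷ b1) ⊕ ⊖ ((i ∘ w ∘ cy_1 cA) ▷ b2)
     ⊕ (i ∘ u ∘ in1 PB ∘ f) ▷ b1 ⊕ (i ∘ u ∘ in2 PB ∘ f) ▷ b2).
exists P, u, w, i; split; first exact: po'.
by split; [exact: ei | split; [exact: er | exact: ci]].
Qed.

(* The coaction is [in1 + in2 d], where [d] corresponds to [xi]; as [Z] is tested on a
   fibrant replacement [Y], this is a statement on the adjoints in the loop object [N] of [Y]. *)
Lemma boundary_exists (cA cB : cyl) (D : QC) (f : hom (cy_ob cA) (cy_ob cB))
    (g : hom (cy_ob cB) (v D)) xi :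
  ctri (sh := sh) (A := cyA cA) (B := cyA cB) f g xi -> rel_cyl f ->
  exists d : hom (L (v D)) (L (cy_susp cA)), cofibre_boundary f g d.
Proof.
move=> [delta [cf [d1 d2]]] [k [mk relk]]; have [k0 [k1 kp_]] := mk.
have cD : C (v D) := proj2_sig D; have xA := sh_inX sh (cyA cA).
(* Collapsing both copies of [A] in [Cyl B] is possible because [A ⊕ A -> B ⊕ B -> Cyl B] is a
   composite of inflations. *)
have [Z [z cz0]] := infl_comp (ex_infl HE) (double_inflation HE (cy_sum cA) (cy_sum cB) cf)
  (ex_intro _ _ (ex_intro _ _ (cy_conf H HH cB))).
have cz : E (copair (cy_sum cA) (cy_0 cB ∘ f) (cy_1 cB ∘ f)) z.
  apply: (conf_heq HE _ (er z) cz0).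
  lc ((cy_0 cB ▷ pr1_in1 (cy_sum cB) ⊕ cy_1 cB ▷ pr2_in1 (cy_sum cB)) ◁ (f ∘ pr1 (cy_sum cA))
     ⊕ (cy_0 cB ▷ pr1_in2 (cy_sum cB) ⊕ cy_1 cB ▷ pr2_in2 (cy_sum cB)) ◁ (f ∘ pr2 (cy_sum cA))).
have zz := conf_zero HE cz.
have zf0 : z ∘ cy_0 cB ∘ f ≈ 0.
  lc (zz ◁ in1 (cy_sum cA) ⊕ ⊖ (z ∘ cy_0 cB ∘ f ▷ pr1_in1 (cy_sum cA))
    ⊕ ⊖ (z ∘ cy_1 cB ∘ f ▷ pr2_in1 (cy_sum cA))).
have zf1 : z ∘ cy_1 cB ∘ f ≈ 0.
  lc (zz ◁ in2 (cy_sum cA) ⊕ ⊖ (z ∘ cy_0 cB ∘ f ▷ pr1_in2 (cy_sum cA))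
    ⊕ ⊖ (z ∘ cy_1 cB ∘ f ▷ pr2_in2 (cy_sum cA))).
have [n0 en0] := conf_desc HE cf zf0; have [n1 en1] := conf_desc HE cf zf1.
have [|t et_] := conf_desc HE (h := z ∘ k) (cy_conf H HH cA).
  lc (z ▷ k0 ◁ pr1 (cy_sum cA) ⊕ z ▷ k1 ◁ pr2 (cy_sum cA) ⊕ zf0 ◁ pr1 (cy_sum cA)
     ⊕ zf1 ◁ pr2 (cy_sum cA)).
have [P] := add_biprod HA (v D) (cy_susp cA).
have [th hth] := theta_exists H sh HH cA.
have [th' [tl tr]] := local_Liso H re HH (A := cyU cA) (B := sh_U sh (cyA cA)) (theta_local hth).
have [d ed] : exists d, [th] ∘ d ≈ [xi] by exists (th' ∘ [xi]); lc (tr ◁ [xi]).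
suff key : [n1] ≈ hadd SH [n0] ([t] ∘ d).
  exists d; split; first by apply/(hl_cof HH); exists (v D), g.
  split; first exact: (proj2 (ex_ker_coker HE cf)).
  exists k; split=> //; split=> //; exists Z, z, n0, n1, t.
  split; first exact: (proj2 (ex_ker_coker HE cz)).
  split=> //; split=> //; split=> //; exists P, (hadd SH [in1 P] ([in2 P] ∘ d)).
  have f1 : [copair P n0 t ∘ in1 P] ≈ [n0].
    by apply: Le; lc (n0 ▷ pr1_in1 P ⊕ t ▷ pr2_in1 P).
  have f2 : [copair P n0 t ∘ in2 P] ≈ [t].
    by apply: Le; lc (n0 ▷ pr1_in2 P ⊕ t ▷ pr2_in2 P).
  have f3 := Le (pr2_in2 P); have f4 := Le (pr2_in1 P).
  have f5 := Lid HH (cy_susp cA).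
  have f6 : [hzero S (v D) (cy_susp cA)] ≈ hzero SH _ _.
    exact: (@fmap_zero T Hc S SH HS HSH L (hl_add HH)).
  split.
    lc (⊖ (Lc (copair P n0 t) (in1 P)) ⊕ f1 ⊕ ⊖ (Lc (copair P n0 t) (in2 P) ◁ d) ⊕ f2 ◁ d ⊕ ⊖ key).
  lc (Lc (pr2 P) (in1 P) ⊕ ⊖ f4 ⊕ ⊖ f6 ⊕ Lc (pr2 P) (in2 P) ◁ d ⊕ ⊖ (f3 ◁ d) ⊕ ⊖ (f5 ◁ d)).
(* [be] is a fibrant replacement of [Z]. As [L] inverts it, [key] may be checked after composing
   with [be], where it becomes a stable equality. *)
have [V [Y [dV [be [cbe [wV [cV fY]]]]]]] := hs_fib_repl H Z.
have [be' [bl br]] := hl_weq HH (triv_cof_weq H (hl_weqE HH) cbe cV wV).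
have [J [N [q [n [cn [xJ fN]]]]]] := loop_exists H fY.
have [fJ wJ] := (X_F H xJ, X_W H xJ).
have [ze eze] := proj1 (theta_local hth fY) (be ∘ t).
have [KA [kA [sA [ckA [csA [esA [cKA wKA]]]]]]] := cone_conf H HH cA.
have [KB [kB [sB [ckB [csB [esB [cKB wKB]]]]]]] := cone_conf H HH cB.
(* The map [be z (1 - c0 pr)] vanishes on the end [cy_0] and hence lives on the cone [KB]; at the
   other end it gives the difference of [n1] and [n0]. *)
have [|ka eka] := conf_desc HE (h := hadd S (be ∘ z) (hopp S (be ∘ z ∘ cy_0 cB ∘ cy_pr cB))) ckB.
  lc (⊖ (be ∘ z ∘ cy_0 cB ▷ cy_pr0 cB)).
have [|sg esg] := lift_ H ka cn cKB fN; first by left.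
have [|s es_] := lift_ H (ze ∘ sh_p sh (cyA cA)) cn (X_C H xA) fN.
  by left; exact: (X_W H xA).
have [|kk ekk] := conf_desc HE (h := kB ∘ k) ckA.
  have zB := conf_zero HE ckB; lc (kB ▷ k0 ⊕ zB ◁ f).
have al : q ∘ (sg ∘ kk) ≈ (be ∘ t) ∘ sA.
  apply: (conf_epi HE ckA).
  lc (esg ◁ (kk ∘ kA) ⊕ ka ▷ ekk ⊕ eka ◁ k ⊕ ⊖ ((be ∘ z ∘ cy_0 cB) ▷ kp_)
     ⊕ ⊖ (be ▷ zf0 ◁ cy_pr cA) ⊕ ⊖ (be ▷ et_) ⊕ ⊖ ((be ∘ t) ▷ esA)).
have [|a1 ea1] := conf_lift HE (h := sg ∘ kk ∘ (kA ∘ cy_1 cA)) cn.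
  have zA := conf_zero HE csA; lc (al ◁ (kA ∘ cy_1 cA) ⊕ (be ∘ t) ▷ zA).
have [|a2 ea2] := conf_lift HE (h := s ∘ sh_i sh (cyA cA)) cn.
  have zA := conf_zero HE (sh_conf sh (cyA cA)); lc (es_ ◁ sh_i sh (cyA cA) ⊕ ze ▷ zA).
have ha1 : adj (kA ∘ cy_1 cA) sA n q (be ∘ t) a1.
  by exists (sg ∘ kk); split; [exact: es | exact: al].
have ha2 : adj (sh_i sh (cyA cA)) (sh_p sh (cyA cA)) n q ze a2.
  by exists s; split; [exact: es | exact: es_].
have [l [l0 [l1 lt]]] := hth.
have [lb elb] := conf_desc HE ckA l0.
have e1 : lb ∘ (kA ∘ cy_1 cA) ≈ sh_i sh (cyA cA) ∘ idm _ by lc (elb ◁ cy_1 cA ⊕ l1).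
have e2 : th ∘ sA ≈ sh_p sh (cyA cA) ∘ lb.
  by apply: (conf_epi HE ckA); lc (th ▷ esA ⊕ lt ⊕ ⊖ (sh_p sh (cyA cA) ▷ elb)).
have ha2' := adj_comp_r H e1 e2 ha2.
pose proof (adj_uniq_r H csA cn cKA wKA fN ha1 ha2' (ac_sym eze)) as na.
(* The combination is induced on [D] by a map into the loop conflation of [Y]. On [A] that map is
   [a1 - a2], stably zero because both are adjoint to [be t], through the cone of [A] and through
   [X^A]. *)
have ny : hadd S (be ∘ n1) (hadd S (hopp S (be ∘ n0)) (hopp S (ze ∘ xi))) ~ 0.
{ apply: (coker_null H cf cD cn fJ wJ (x := hadd S (sg ∘ kB ∘ cy_1 cB) (hopp S (s ∘ delta)))
    (a := hadd S a1 (hopp S a2))).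
  - lc (⊖ ((sg ∘ kB) ▷ k1) ⊕ ⊖ (sg ▷ ekk ◁ cy_1 cA) ⊕ ⊖ (s ▷ d1) ⊕ ⊖ ea1 ⊕ ea2).
  - lc (be ▷ en1 ⊕ ⊖ (be ▷ en0) ⊕ ⊖ (ze ▷ d2) ⊕ es_ ◁ delta ⊕ ⊖ (esg ◁ (kB ∘ cy_1 cB))
       ⊕ ⊖ (eka ◁ cy_1 cB) ⊕ (be ∘ z ∘ cy_0 cB) ▷ cy_pr1 cB).
  - lc na. }
have ny' : be ∘ n1 ~ hadd S (be ∘ n0) (ze ∘ xi) by lc ny.
have m1 := Ls ny'; have m2 := Ls eze.
lc (⊖ (bl ◁ [n1]) ⊕ ⊖ (be' ▷ Lc be n1) ⊕ be' ▷ m1 ⊕ be' ▷ La HH (be ∘ n0) (ze ∘ xi)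
   ⊕ be' ▷ Lc be n0 ⊕ bl ◁ [n0] ⊕ be' ▷ Lc ze xi ⊕ ⊖ ((be' ∘ [ze]) ▷ ed)
   ⊕ ⊖ (be' ▷ Lc ze th ◁ d) ⊕ be' ▷ m2 ◁ d ⊕ be' ▷ Lc be t ◁ d ⊕ bl ◁ ([t] ∘ d)).
Qed.

Section Triangles.
Variable t : forall A : T, hom (v (K (susp_ob su A))) (v (re_R re (sh_U sh (ι (K A))))).
Hypothesis ht : forall A, t_spec (t A).
Let tq (A : img L) : @hom QCF (K (Sg A)) (Psi (K A)) := t A.

Lemma t_nat_iso : nat_iso (F := fcomp K Sg) (G := fcomp Psi K) tq.
Proof.
split; last by move=> A; exact: (t_iso (ht A)).
by move=> A B phi; exact: (t_nat phi (ht A) (ht B)).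
Qed.

Lemma std_cofibre (cA cB : cyl) (D : QC) (f : hom (cy_ob cA) (cy_ob cB))
    (g : hom (cy_ob cB) (v D)) xi (d : hom (L (v D)) (L (cy_susp cA)))
    (phi : hom (L (cy_ob cA)) (L (cy_ob (cc (cy_ob cA))))) psi :
  cofibre_boundary f g d -> ctri (sh := sh) (A := cyA cA) (B := cyA cB) f g xi ->
  [su_rep su (cy_ob cA)] ∘ phi ≈ idm _ -> susp_rel phi psi ->
  rseq_iso (@map_rseq (img L) QCF Sg Psi K tq
    (@RSeq (img L) Sg (cy_ob cA) (cy_ob cB) (v D) [f] [g] (psi ∘ d)))
    (Rtri hCF re (sh := sh) (A := cyA cA) (B := cyA cB) f g xi).
Proof.
move=> b tr e1 sp; have [th [hth eth]] := boundary_theta b tr.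
(* For [A] in [C], both [K A] and [R A] are bifibrant replacements of [A]; [x] is the comparison
   under [A]. *)
have X1 (A : QC) : exists x : hom (v (K (v A))) (v (re_R re A)), [x] ∘ e (v A) ≈ [j A].
  have [x ex_] := hl_full HH ([j A] ∘ e' (v A)) (K_C (v A)) (re_F H re A).
  by exists x; lc (ex_ ◁ e (v A) ⊕ [j A] ▷ hl_el HH (v A)).
have X2 (A : QC) (x : hom (v (K (v A))) (v (re_R re A))) : [x] ∘ e (v A) ≈ [j A] ->
    @is_iso QCF (K (v A)) (re_R re A) x.
  move=> ex_; apply: (QCF_iso H HH).
  apply: (iso_heq (f := [j A] ∘ e' (v A))).
    lc (⊖ (ex_ ◁ e' (v A)) ⊕ [x] ▷ hl_er HH (v A)).
  apply: iso_comp; first exact: (hl_weq HH (j_weq' H re HH A)).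
  by exists (e (v A)); split; [exact: (hl_er HH) | exact: (hl_el HH)].
have [xA hA] := X1 (cyA cA); have [xB hB] := X1 (cyA cB); have [xD hD] := X1 D.
have X3 (A B : QC) (h : hom (v A) (v B)) xa xb (kh : hom (v (K (v A))) (v (K (v B)))) :
    [xa] ∘ e (v A) ≈ [j A] -> [xb] ∘ e (v B) ≈ [j B] -> [kh] ∘ e (v A) ≈ e (v B) ∘ [h] ->
    xb ∘ kh ~ rp A B h ∘ xa.
  move=> ha hb hk; apply: (hl_faith HH (K_C _) (re_F H re B)); apply: (e_cancel (A := v A)).
  have r := Le (rep_spec H re h).
  lc (Lc xb kh ◁ e (v A) ⊕ [xb] ▷ hk ⊕ hb ◁ [h] ⊕ ⊖ (Lc (j B) h) ⊕ ⊖ r ⊕ Lc (rp A B h) (j A)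
     ⊕ ⊖ ([rp A B h] ▷ ha) ⊕ ⊖ (Lc (rp A B h) xa ◁ e (v A))).
refine (@riso_intro QCF Psi (K (cy_ob cA)) (K (cy_ob cB)) (K (v D)) (re_R re (cyA cA))
  (re_R re (cyA cB)) (re_R re D) _ _ _ _ _ _ xA xB xD _ _ _ _ _ _).
- exact: (X2 (cyA cA)).
- exact: (X2 (cyA cB)).
- exact: (X2 D).
- exact: (X3 (cyA cA) (cyA cB) f xA xB _ hA hB (e_nat [f])).
- exact: (X3 (cyA cB) D g xB xD _ hB hD (e_nat [g])).
- have [a [tha [ha [htha hta]]]] := ht (cy_ob cA).
  pose A0 := cy_ob cA.
  pose kx := kp (ι (K A0)) (ι (re_R re (cyA cA))) xA.
  pose rx := rp (sh_U sh (ι (K A0))) (sh_U sh (ι (re_R re (cyA cA)))) kx.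
  pose kj := kp (cyA cA) (ι (re_R re (cyA cA))) (j (cyA cA)).
  pose rj := rp (sh_U sh (cyA cA)) (sh_U sh (ι (re_R re (cyA cA)))) kj.
  pose rxi := rp D (sh_U sh (cyA cA)) xi.
  pose m : hom (v (K (v D))) (v (K (susp_ob su A0))) := Km (psi ∘ d).
  change (rx ∘ (t A0 ∘ m) ~ rj ∘ rxi ∘ xD).
  apply: (hl_faith HH (K_C _) (re_F H re (sh_U sh (ι (re_R re (cyA cA))))));
    apply: (e_cancel (A := v D)).
  have n : [m] ∘ e (v D) ≈ e (susp_ob su A0) ∘ (psi ∘ d) := e_nat (psi ∘ d).
  have q : [kp (cyA (cc A0)) (ι (re_R re (cyA cA))) (xA ∘ a) ∘ tha] ∘ psi ≈ [kj ∘ th].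
    apply: (susp_theta (Y := ι (re_R re (cyA cA))) (re_F H re (cyA cA)) sp hth htha).
    lc (⊖ hA ⊕ ⊖ ([xA] ∘ e A0 ▷ e1) ⊕ ⊖ ([xA] ▷ ha ◁ phi) ⊕ ⊖ (Lc xA a ◁ phi)).
  have kc := kap_comp H sh (A := cyA (cc A0)) (B := ι (K A0)) (D := ι (re_R re (cyA cA))) xA a.
  have r1 := rep_spec H re kx; have r2 := rep_spec H re kj; have r3 := rep_spec H re xi.
  pose ka := kp (cyA (cc A0)) (ι (K A0)) a.
  pose J0 := j (sh_U sh (ι (K A0))); pose J1 := j (sh_U sh (ι (re_R re (cyA cA)))).
  have s1 : rx ∘ (J0 ∘ (ka ∘ tha)) ~
      J1 ∘ (kp (cyA (cc A0)) (ι (re_R re (cyA cA))) (xA ∘ a) ∘ tha).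
    lc (! (r1 ◁ (ka ∘ tha)) ⊕' J1 ▷' kc ◁' tha).
  have s2 : J1 ∘ kj ∘ xi ≈ rj ∘ rxi ∘ j D by lc (⊖ (r2 ◁ xi) ⊕ ⊖ (rj ▷ r3)).
  have s3 := Ls s1; have s4 := Le s2.
  lc (Lc rx (t A0 ∘ m) ◁ e (v D) ⊕ [rx] ▷ Lc (t A0) m ◁ e (v D) ⊕ ([rx] ∘ [t A0]) ▷ n
     ⊕ [rx] ▷ hta ◁ (psi ∘ d) ⊕ ⊖ (Lc rx (J0 ∘ (ka ∘ tha)) ◁ (psi ∘ d)) ⊕ s3 ◁ (psi ∘ d)
     ⊕ Lc J1 (kp (cyA (cc A0)) (ι (re_R re (cyA cA))) (xA ∘ a) ∘ tha) ◁ (psi ∘ d)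
     ⊕ [J1] ▷ q ◁ d ⊕ [J1] ▷ Lc kj th ◁ d ⊕ ([J1] ∘ [kj]) ▷ eth
     ⊕ ⊖ (Lc (J1 ∘ kj) xi) ⊕ ⊖ (Lc J1 kj ◁ [xi]) ⊕ s4
     ⊕ Lc (rj ∘ rxi) (j D) ⊕ ⊖ ([rj ∘ rxi] ▷ hD) ⊕ ⊖ (Lc (rj ∘ rxi) xD ◁ e (v D))).
Qed.

Lemma K_faithful (A B : img L) (phi psi : hom A B) : Km phi ~ Km psi -> phi ≈ psi.
Proof.
change (hom (L A) (L B)) in phi; change (hom (L A) (L B)) in psi => k.
have q := Ls k; have n1 := e_nat phi; have n2 := e_nat psi.
change (phi ≈ psi).
lc (⊖ (hl_el HH B ◁ phi) ⊕ hl_el HH B ◁ psi ⊕ ⊖ (e' B ▷ n1) ⊕ e' B ▷ n2 ⊕ e' B ▷ q ◁ e A).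
Qed.

Lemma K_full (A B : img L) (g : hom (v (K A)) (v (K B))) : exists phi : hom A B, Km phi ~ g.
Proof.
pose phi : hom (L A) (L B) := e' B ∘ ([g] ∘ e A); exists phi.
pose h : hom (v (K A)) (v (K B)) := Km phi; change (h ~ g).
apply: (hl_faith HH (K_C A) (K_F B)); apply: e_cancel.
have n : [h] ∘ e A ≈ e B ∘ phi := e_nat phi.
rewrite /phi in n; lc (n ⊕ hl_er HH B ◁ ([g] ∘ e A)).
Qed.

Let RT := subfactor_rt H sh hCF re.
Let HPsi := proj1 (subfactor_shift_functor H sh hCF re).

Lemma cofibre_tri (s : rseq Sg) :
  cofibre_triangles s -> Tri (@map_rseq (img L) QCF Sg Psi K tq s).
Proof.
move=> [cA [cB [D [f [g [d [phi [th [b [e1 [sp i]]]]]]]]]]].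
have [cf [kg _]] := b; have [c cD] := coker_C H HH cf kg.
pose D' : QC := exist C D cD.
have [xi tr] := ctri_exists H sh (A := cyA cA) (B := cyA cB) (D := D') c.
have i1 := @std_cofibre cA cB D' f g xi d phi th b tr e1 sp.
have i2 := map_rseq_iso (hl_K HH) t_nat_iso RT i.
apply: (tri_iso H i2); apply: (tri_iso H _ (rtri_tri H hCF re tr)).
exact: (@rseq_iso_sym QCF (preadd_cat HQ) _ HPsi _ _ i1).
Qed.

Lemma tri_cofibre (s : rseq Sg) :
  Tri (@map_rseq (img L) QCF Sg Psi K tq s) -> cofibre_triangles s.
Proof.
move=> /(tri_rtri H) [[A cA] [[B cB] [D [f [g [xi [tr i]]]]]]]; simpl in f, g.
(* Each object of [C] underlies some cylinder object, and proof irrelevance identifies the two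
   proofs of membership in [C]. *)
have [c [ec _]] := cyl_exists H HH cA; subst A.
have ecA := proof_irrelevance _ (cy_ob_C H HH c) cA; subst cA.
(* Quantifying over all proofs of [C B'] makes the property independent of the membership proof that
   comes with the new cylinder. *)
pose R := fun (B' : T) (f' : hom (cy_ob c) B') (g' : hom B' (v D)) =>
  forall cB' : C B', exists xi', ctri (sh := sh) (A := cyA c) (B := exist C B' cB') f' g' xi' /\
    rseq_iso (Rtri hCF re (sh := sh) (A := cyA c) (B := exist C B' cB') f' g' xi')
      (@map_rseq (img L) QCF Sg Psi K tq s).
have r : R B f g.
  by move=> cB'; rewrite (proof_irrelevance _ cB' cB); exists xi.
have [c' [f' [g' [r' rc]]]] := rel_cyl_exists cB r.
have [xi' [tr' i']] := r' (cy_ob_C H HH c').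
have [d bd] := boundary_exists (cB := c') tr' rc.
have [phi [pl pr]] := hl_weq HH (su_weq su (cy_ob c)).
have [th sp] := susp_exists H sh re HH (c := c) (c' := cc (cy_ob c)) phi.
exists c, c', (v D), f', g', d, phi, th; split=> //; split=> //; split=> //.
apply: (map_rseq_iso_reflect (hl_K HH) K_full K_faithful t_nat_iso RT).
have i1 := std_cofibre (cB := c') bd tr' pr sp.
exact: (@rseq_iso_trans QCF (preadd_cat HQ) _ HPsi _ _ _ i1 i').
Qed.
End Triangles.

Theorem cofibre_comparison : exists tq : forall A : img L, @hom QCF (K (Sg A)) (Psi (K A)),
  nat_iso (F := fcomp K Sg) (G := fcomp Psi K) tq /\
  forall s : rseq Sg, cofibre_triangles s <-> Tri (@map_rseq (img L) QCF Sg Psi K tq s).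
Proof.
exists (fun A => proj1_sig (constructive_indefinite_description _ (t_exists A))).
have ht A : t_spec (proj1_sig (constructive_indefinite_description _ (t_exists A))).
  exact: (proj2_sig (constructive_indefinite_description _ (t_exists A))).
split; first exact: (t_nat_iso ht).
move=> s; split; [exact: (cofibre_tri ht) | exact: (tri_cofibre ht)].
Qed.
End Compare.

(** * The equivalence *)

Section TransportPretri.
Context {T U : precat} {ST : addstr T} {SU : addstr U}.
Variables (Psi Phi : fdata T T) (Psi' Phi' : fdata U U).
Variables (Delta : rseq Psi -> Prop) (Nabla : lseq Phi -> Prop).
Variables (Delta' : rseq Psi' -> Prop) (Nabla' : lseq Phi' -> Prop).
Hypothesis HT : category_laws T.
Variables (F : fdata T U) (HF : is_functor F).
Hypothesis full : forall X Y (g : hom (F X) (F Y)), exists f : hom X Y, fmap F f ≈ g.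
Hypothesis faithful : forall X Y (f g : hom X Y), fmap F f ≈ fmap F g -> f ≈ g.
Hypothesis surj : forall Y : U, exists (X : T) (f : hom (F X) Y), is_iso f.
Hypothesis Fadd : forall X Y (f g : hom X Y),
  fmap F (hadd ST f g) ≈ hadd SU (fmap F f) (fmap F g).
Hypothesis Fzero : forall X Y, fmap F (hzero ST X Y) ≈ hzero SU (F X) (F Y).
Hypothesis Fopp : forall X Y (f : hom X Y), fmap F (hopp ST f) ≈ hopp SU (fmap F f).
Variable t : forall X : T, hom (F (Psi X)) (Psi' (F X)).
Hypothesis Ht : nat_iso (F := fcomp F Psi) (G := fcomp Psi' F) t.
Hypothesis HD : forall s, Delta s <-> Delta' (map_rseq t s).
Variable w : forall X : T, hom (Phi' (F X)) (F (Phi X)).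
Hypothesis Hw : @nat_iso (op T) (op U) (fcomp (opF F) (opF Phi)) (fcomp (opF Phi') (opF F)) w.
Hypothesis HN : forall s : lseq Phi,
  Nabla s <-> Nabla' (@map_rseq (op T) (op U) (opF Phi) (opF Phi') (opF F) w s).
Hypothesis RU : right_triangulated SU Delta'.
Hypothesis LU : left_triangulated SU Nabla'.
Variable eps : forall X : U, hom (Psi' (Phi' X)) X.
Variable eta : forall X : U, hom X (Phi' (Psi' X)).
Hypothesis eps_nat : forall (X Y : U) (f : hom X Y),
  eps Y ∘ fmap Psi' (fmap Phi' f) ≈ f ∘ eps X.
Hypothesis eta_nat : forall (X Y : U) (f : hom X Y),
  fmap Phi' (fmap Psi' f) ∘ eta X ≈ eta Y ∘ f.
Hypothesis triangle_l : forall X, eps (Psi' X) ∘ fmap Psi' (eta X) ≈ idm _.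
Hypothesis triangle_r : forall X, fmap Phi' (eps X) ∘ eta (Phi' X) ≈ idm _.
Hypothesis compat_b : forall (A B C : U) (f : hom A B) (g : hom B C) (h : hom C (Psi' A))
    (A' B' C' : U) (f' : hom (Phi' C') A') (g' : hom A' B') (h' : hom B' C'),
  Delta' (RSeq Psi' f g h) -> Nabla' (LSeq f' g' h') -> compat eps f g h f' g' h'.
Hypothesis compat_c : forall (A B C : U) (f : hom A B) (g : hom B C) (h : hom C (Psi' A))
    (A' B' C' : U) (f' : hom (Phi' C') A') (g' : hom A' B') (h' : hom B' C'),
  Delta' (RSeq Psi' f g h) -> Nabla' (LSeq f' g' h') ->
  @compat (op U) (opF Phi') (opF Psi') eta C' B' A' h' g' f' C B A h g f.

Let HU : preadditive SU := add_preadditive (rt_additive RU).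
Let HUo : preadditive (opS SU) := op_preadditive HU.
Let HTo : category_laws (op T) := op_laws HT.
#[local] Existing Instance HU.
Let HPsi : is_functor Psi' := proj1 (rt_functor RU).
Let HPhio : is_functor (opF Phi') := proj1 (rt_functor LU).

Lemma opF_functor (T1 T2 : precat) (G : fdata T1 T2) : is_functor G -> is_functor (opF G).
Proof.
move=> [g1 g2 g3]; split=> //.
- move=> X Y f g; exact: (g1 Y X f g).
- move=> X Y Z g f; exact: (g3 Z Y X f g).
Qed.

Lemma transport_right : right_triangulated ST Delta.
Proof. exact: (transport_rt HT HF full faithful surj Fadd Fzero Fopp Ht HD RU). Qed.

Lemma transport_left : left_triangulated ST Nabla.
Proof.
refine (@transport_rt (op T) (op U) (opS ST) (opS SU) (opF Phi) Nabla (opF Phi') Nabla' HTo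
  (opF F) (opF_functor HF) _ _ _ _ _ _ w Hw HN LU).
- move=> X Y; exact: (full (X := Y) (Y := X)).
- move=> X Y; exact: (faithful (X := Y) (Y := X)).
- by move=> Y; have [X [f [g [l r]]]] := surj Y; exists X, g, f; split; [exact: l | exact: r].
- by move=> X Y f g; apply: Fadd.
- by move=> X Y; apply: Fzero.
- by move=> X Y f; apply: Fopp.
Qed.

(** Counit and unit are conjugated by [t] and [w]. Each assertion on the unit is the one on the
    counit in the opposite categories, where [t] and [w] exchange roles. *)
Theorem transport_pretriangulated : pretriangulated (@Pretri T ST Psi Phi Delta Nabla).
Proof.
split; [exact: transport_right | exact: transport_left |].
have [tn ti] := Ht; have [wn wi] := Hw.
have [t' ht'] : exists t' : forall X : T, hom (Psi' (F X)) (F (Psi X)),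
    forall X, t' X ∘ t X ≈ idm _ /\ t X ∘ t' X ≈ idm _.
  exists (fun X => proj1_sig (constructive_indefinite_description _ (ti X))) => X.
  exact: (proj2_sig (constructive_indefinite_description _ (ti X))).
have [w' hw'] : exists w' : forall X : T, hom (F (Phi X)) (Phi' (F X)),
    forall X, w X ∘ w' X ≈ idm _ /\ w' X ∘ w X ≈ idm _.
  exists (fun X => proj1_sig (constructive_indefinite_description _ (wi X))) => X.
  exact: (proj2_sig (constructive_indefinite_description _ (wi X))).
have lift X Y (g : hom (F X) (F Y)) : {f : hom X Y | fmap F f ≈ g}.
  exact: constructive_indefinite_description.
pose epsT X := proj1_sig (lift (Psi (Phi X)) X (eps (F X) ∘ fmap Psi' (w' X) ∘ t (Phi X))).
have epsTE X : fmap F (epsT X) ≈ eps (F X) ∘ fmap Psi' (w' X) ∘ t (Phi X).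
  exact: (proj2_sig (lift _ _ _)).
pose etaT X := proj1_sig (lift X (Phi (Psi X)) (w (Psi X) ∘ (fmap Phi' (t' X) ∘ eta (F X)))).
have etaTE X : fmap F (etaT X) ≈ w (Psi X) ∘ (fmap Phi' (t' X) ∘ eta (F X)).
  exact: (proj2_sig (lift _ _ _)).
have wl X : w' X ∘ w X ≈ idm _ := proj2 (hw' X).
have wr X : w X ∘ w' X ≈ idm _ := proj1 (hw' X).
have tl X : t' X ∘ t X ≈ idm _ := proj1 (ht' X).
have tr X : t X ∘ t' X ≈ idm _ := proj2 (ht' X).
have wn' X Y (f : hom X Y) : w Y ∘ fmap Phi' (fmap F f) ≈ fmap F (fmap Phi f) ∘ w X.
  apply: es; exact: (wn Y X f).
have fullo (X Y : op T) (g : hom (opF F X) (opF F Y)) : exists f : hom X Y, fmap (opF F) f ≈ g.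
  exact: (full (X := Y) (Y := X)).
have faitho (X Y : op T) (f g : hom X Y) : fmap (opF F) f ≈ fmap (opF F) g -> f ≈ g.
  exact: (faithful (X := Y) (Y := X)).
have tno (X Y : T) (f : hom X Y) : fmap Psi' (fmap F f) ∘ t X ≈ t Y ∘ fmap F (fmap Psi f).
  apply: es; exact: (tn X Y f).
exists etaT, epsT; split.
- split.
    move=> X Y f; apply: es.
    exact: (@transport_eps_nat (op T) (op U) (opS SU) HUo (opF Phi) (opF Psi)
      (opF Phi') (opF Psi') HPhio (opF F) (opF_functor HF) faitho w t t'
      wn (fun X Y f => tno Y X f) tr tl eta (fun X Y f => eta_nat f) etaT etaTE Y X f).
  split.
    move=> X Y f.
    exact: (@transport_eps_nat T U SU HU Psi Phi Psi' Phi' HPsi F HF faithful t w w' tn wn'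
      wl wr eps eps_nat epsT epsTE X Y f).
  split=> X.
    exact: (@transport_triangle T U SU HU Psi Phi Psi' Phi' HPsi F HF faithful t w w' t' tn
      wl tl eps eta eps_nat triangle_l epsT etaT epsTE etaTE X).
  exact: (@transport_triangle (op T) (op U) (opS SU) HUo (opF Phi) (opF Psi)
      (opF Phi') (opF Psi') HPhio (opF F) (opF_functor HF) faitho w t t' w'
      wn tr wr eta eps (fun X Y f => eta_nat f) triangle_r etaT epsT etaTE epsTE X).
- move=> A B C f g h A' B' C' f' g' h' /HD d /HN d'; split.
  + move=> a b.
    exact: (@transport_compat T U SU HU Psi Phi Psi' Phi' HPsi F HF full faithful t w w' tn
      wr eps epsT epsTE A B C f g h A' B' C' f' g' h' (compat_b d d') a b).
  + move=> b a k.
    have [c [c1 c2]] := @transport_compat (op T) (op U) (opS SU) HUo (opF Phi) (opF Psi)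
      (opF Phi') (opF Psi') HPhio (opF F) (opF_functor HF) fullo faitho w t t'
      wn tl eta etaT etaTE C' B' A' h' g' f' C B A h g f (compat_c d d') a b k.
    exists c; split; first exact: c1.
    exact: (et c2 (es (comp_assoc _ _ _ _))).
Qed.
End TransportPretri.

(** Reversal exchanges [e] and [e']; naturality of [e'] follows from that of its inverse [e]. *)
Lemma ho_setup_op (T : precat) (S : addstr T) (E : conf_class T) (C W F X CF : T -> Prop)
    (sim : rel_class T) (M : model_data T) (Hc : precat) (SH : addstr Hc) (L : fdata T Hc)
    (K : fdata (img L) (quot CF sim))
    (e : forall A : T, hom (L A) (L (proj1_sig (K A))))
    (e' : forall A : T, hom (L (proj1_sig (K A))) (L A)) :
  hovey_setup S E C W F X CF sim -> ho_setup S E C W F M SH e e' ->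
  @ho_setup (op T) (opS S) (opE E) F W C CF (op_rel sim) (opM M) (op Hc) (opS SH) (opF L)
    (opF K) e' e.
Proof.
move=> H HH; have HSH := hl_pre HH; have HA := ex_additive (hs_exact H).
have HS := add_preadditive HA.
split.
- by move=> A B f; have [a b] := hl_fib HH f; split=> [/a [N [n [c d]]]|[N [n [c d]]]];
    [exists N, n | apply: b; exists N, n].
- by move=> A B f; have [a b] := hl_cof HH f; split=> [/a [N [n [c d]]]|[N [n [c d]]]];
    [exists N, n | apply: b; exists N, n].
- move=> A B f; have [a b] := hl_weqE HH f; split.
  + by move=> /a [D [i [p [k [k1 k2]]]]]; exists D, p, i.
  + by move=> [D [i [p [k [k1 k2]]]]]; apply: b; exists D, p, i.
- exact: op_preadditive.
- have [[l1 l2 l3] l4] := hl_add HH; split; first split.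
  + by move=> A B f g; apply: l1.
  + by move=> A; apply: l2.
  + by move=> A B D g f; apply: l3.
  + by move=> A B f g; apply: l4.
- by move=> A B f g; apply: (hl_sim HH).
- by move=> A B f w; have [g [l r]] := hl_weq HH w; exists g; split; [exact: r | exact: l].
- by move=> A B phi fA cB; apply: (hl_full HH).
- by move=> A B f g fA cB; apply: (hl_faith HH).
- have [k1 k2 k3] := hl_K HH; split.
  + by move=> A B f g; apply: k1.
  + by move=> A; apply: k2.
  + by move=> A B D g f; apply: k3.
- exact: (hl_el HH).
- exact: (hl_er HH).
- move=> A B phi; change (@hom Hc (L B) (L A)) in phi.
  change (e' A ∘ fmap L (@fmap (img L) (quot CF sim) K B A phi :
      @hom T (proj1_sig (K B)) (proj1_sig (K A))) ≈ phi ∘ e' B).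
  have n := hl_nat HH phi.
  set k := fmap L _ in n *.
  lc (⊖ ((e' A ∘ k) ▷ hl_er HH B) ⊕ e' A ▷ n ◁ e' B ⊕ hl_el HH A ◁ (phi ∘ e' B)).
Qed.

(** * Hovey triples and the equivalence *)

Section Main.
Variables (A : precat) (S : addstr A) (E : conf_class A) (C W F : A -> Prop).
Hypotheses (hE : exact_category S E) (hwic : weakly_idempotent_complete E).
Hypothesis hCWF : hovey_triple S E C W F.
Notation X := (cap C (cap W F)).
Notation CF := (cap C F).
Notation sim := (stable_eq S X).
Notation M := (hovey_model E C W F).

Lemma hovey_setup_of_triple : hovey_setup S E C W F X CF sim.
Proof.
have [th [[[c1 c2] [c3 c4]] [[d1 d2] [d3 d4]]]] := hCWF; split=> //.
- move=> P Q cP fQ [wP|wQ].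
  + by apply: (proj1 (d1 P)).
  + by apply: (proj1 (c1 P)).
- by move=> P k; apply/c1 => Y [wY fY]; apply: k.
- by move=> P k; apply/d2 => Y [cY wY]; apply: k.
- by move=> P; have [Y [Q [i [d [c [[? ?] ?]]]]]] := c3 P; exists Y, Q, i, d.
- by move=> P; have [Y [Q [i [d [c [? [? ?]]]]]]] := d4 P; exists Q, Y, d, i.
- by move=> P; have [Y [Q [i [d [c [? [? ?]]]]]]] := d3 P; exists Y, Q, i, d.
- by move=> P; have [Y [Q [i [d [c [[? ?] ?]]]]]] := c4 P; exists Q, Y, d, i.
Qed.

Let H := hovey_setup_of_triple.

(** Listing [F] before [W] for the kernel, as [C] before [W] for the cokernel, makes the description
    of weak equivalences literally self-dual. *)
Lemma hovey_weq (P Q : A) (f : hom P Q) :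
  weq M f <-> exists (B : A) (i : hom P B) (p : hom B Q), f ≈ p ∘ i /\
    (exists (Z : A) (d : hom B Z), E i d /\ C Z /\ W Z) /\
    (exists (K : A) (k : hom K B), E k p /\ F K /\ W K).
Proof.
by split=> [[B [i [p [e [t [K [k [c [? ?]]]]]]]]]|[B [i [p [e [t [K [k [c [? ?]]]]]]]]]];
  exists B, i, p; split=> //; split=> //; exists K, k.
Qed.

Variable rC : repl_choice E C W CF.
Notation L := (loc_functor M).
Notation QCF := (quot CF sim).
Notation K := (bifun H rC M : fdata (img L) QCF).
Notation SH := (ho_add H rC hovey_weq).

Lemma hovey_ho_setup : @ho_setup A S E C W F CF sim M (Ho M) SH L K
  (ho_e H rC hovey_weq) (ho_e' H rC hovey_weq).
Proof.
split.
- by [].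
- by [].
- exact: hovey_weq.
- exact: ho_preadditive.
- exact: L_additive.
- by move=> P Q f g; apply: (L_sim H hovey_weq).
- by move=> P Q f; apply: L_weq.
- by move=> P Q phi; apply: (L_full H rC hovey_weq).
- by move=> P Q f g; apply: (L_faithful H rC hovey_weq).
- exact: (bifun_functor H rC hovey_weq).
- exact: ho_el.
- exact: ho_er.
- exact: ho_e_nat.
Qed.
End Main.

Theorem theorem6p6 (A : precat) (S : addstr A) (E : conf_class A) (C W F : A -> Prop)
  (hE : exact_category S E) (hwic : weakly_idempotent_complete E)
  (hCWF : hovey_triple S E C W F)
  (cyl : susp_choice S (hovey_model E C W F))
  (path : susp_choice (opS S) (opM (hovey_model E C W F)))
  (sC : shift_choice E C (cap C (cap W F)))
  (rC : repl_choice E C W (cap C F))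
  (sF : @shift_choice (op A) (opE E) F (cap C (cap W F)))
  (rF : @repl_choice (op A) (opE E) F W (cap C F)) :
  exists SH : addstr (Ho (hovey_model E C W F)),
    pretriangulated (ho_pretri cyl path SH) /\
    pretriangulated (subfactor_pretri S sC rC sF rF) /\
    pretri_equiv (ho_pretri cyl path SH) (subfactor_pretri S sC rC sF rF).
Proof.
pose X := cap C (cap W F); pose CF := cap C F; pose sim := stable_eq S X.
pose M := hovey_model E C W F; pose HM := @hovey_weq A E C W F.
pose H : hovey_setup S E C W F X CF sim := hovey_setup_of_triple hE hwic hCWF.
have Hop := hovey_setup_op H.
pose hC : forall P, CF P -> C P := fun P h => proj1 h.
pose hF : forall P, CF P -> F P := fun P h => proj2 h.
pose SH := ho_add H rC HM; pose K := bifun H rC M.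
have HH := hovey_ho_setup hE hwic hCWF rC.
have HHo := ho_setup_op H HH.
(* The same comparison is applied to the triple and to its opposite: once for suspensions, once for
   loops. *)
have [t [Ht HD]] := cofibre_comparison H sC hC rC HH cyl.
have [w [Hw HN]] := cofibre_comparison Hop sF hF rF HHo path.
have PS := subfactor_pretriangulated H sC hC rC sF hF rF.
have QP := quot_preadditive H CF.
exists SH; split; last split.
- refine (@transport_pretriangulated (Ho M) (quot CF sim) SH (quotS S CF sim)
    (suspension (loc_functor M) cyl) (opF (suspension (opF (loc_functor M)) path))
    (subfactor_shift S sim hC sC rC) (opF (subfactor_shift (opS S) (op_rel sim) hF sF rF))
    (@cofibre_triangles A S M (Ho M) (loc_functor M) cyl)
    (@cofibre_triangles (op A) (opS S) (opM M) (op (Ho M)) (opF (loc_functor M)) path)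
    (@subfactor_triangles A S E C W X sim CF hC sC rC)
    (@subfactor_triangles (op A) (opS S) (opE E) F W X (op_rel sim) CF hF sF rF)
    (preadd_cat (ho_preadditive H rC HM)) K (bifun_functor H rC HM) _ _ _ _ _ _ t Ht HD w Hw HN
    (pt_rt PS) (pt_lt PS) (eps0 H sC hC rC sF hF rF) (eta0 H sC hC rC sF hF rF) _ _ _ _ _ _).
  + move=> P Q g; exact: (bifun_full HM).
  + move=> P Q f g; exact: (bifun_faithful HM).
  + exact: (bifun_surj H rC HM).
  + move=> P Q f g; exact: (bmap_pre HM).
  + move=> P Q; exact: (bmap_pre HM).
  + move=> P Q f; exact: (bmap_pre HM).
  + move=> P Q f; exact: eps0_nat.
  + move=> P Q f; exact: eta0_nat.
  + exact: eps0_eta0.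
  + exact: eta0_eps0.
  + move=> A1 B1 C1 f g h A' B' C' f' g' h'; exact: tri_compat.
  + move=> A1 B1 C1 f g h A' B' C' f' g' h'; exact: eta0_compat.
- exact: PS.
- exists K; split; first exact: (bifun_equivalence H rC HM).
  split; first by split; [exact: (bifun_functor H rC HM) | move=> P Q f g; exact: (bmap_pre HM)].
  split; first by exists t; split; [exact: Ht | move=> s /HD].
  exists w; split; last by move=> s /HN.
  have [wn wi] := Hw; split.
    move=> P Q f; apply: (@es _ (preadd_cat QP)); exact: (wn Q P f).
  by move=> P; have [g [l r]] := wi P; exists g; split; [exact: r | exact: l].
Qed.
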